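(* Let $b\in\{N,D\}$. Let $\mu$ be a non-atomic Borel probability measure on $[0,1]$ with $0,1\in\operatorname{supp}(\mu)$, and let $(\mu_n)_{n\in\mathbb{N}}$ be a sequence of non-atomic Borel probability measures on $[0,1]$ with $0,1\in\operatorname{supp}(\mu_n)$ and $\operatorname{supp}(\mu)\subseteq\operatorname{supp}(\mu_n)$ for all $n$, such that $\mu_n$ converges weakly to $\mu$ as $n\to\infty$. Let $(\bar T_t^b)_{t\ge 0}$ and $(\bar T_{t,n}^b)_{t\ge 0}$ be the restricted semigroups on $(C[0,1])_\mu^b$ and $(C[0,1])_{\mu_n}^b$ defined by $\mu$ and $\mu_n$, respectively, and let $\pi_n:(C[0,1])_\mu^b\to(C[0,1])_{\mu_n}^b$ be the embedding. Then for every $f\in(C[0,1])_\mu^b$ and all $t\ge 0$, $$\lim_{n\to\infty}\left\lVert \pi_n\bar T_t^b f-\bar T_{t,n}^b\pi_n f\right\rVert_\infty=0,$$ uniformly for $t$ in bounded intervals.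
   Context: For a non-atomic Borel probability measure $\nu$ on $[0,1]$ with $0,1\in\operatorname{supp}(\nu)$: Let $\mathcal{D}_\nu^2$ be the set of $f\in C^1([0,1])$ for which there is $(f')^\nu\in L^2([0,1],\nu)$ with $f'(x)=f'(0)+\int_0^x (f')^\nu\,d\nu$ for all $x\in[0,1]$. The Krein-Feller operators $\Delta_\nu^N$ (Neumann) and $\Delta_\nu^D$ (Dirichlet) on $L^2([0,1],\nu)$ are given by $f\mapsto(f')^\nu$ (computed from the representative in $\mathcal{D}_\nu^2$), with domains: $\mathcal{D}(\Delta_\nu^N)$ is the set of $f\in L^2([0,1],\nu)$ having a representative $\bar f\in\mathcal{D}_\nu^2$ with $\bar f'(0)=\bar f'(1)=0$; $\mathcal{D}(\Delta_\nu^D)$ is the set of $f\in L^2([0,1],\nu)$ having a representative $\bar f\in\mathcal{D}_\nu^2$ with $\bar f(0)=\bar f(1)=0$. Both operators are self-adjoint and non-positive; for $b\in\{N,D\}$, $\Delta_\nu^b$ generates a strongly continuous contraction semigroup on $L^2([0,1],\nu)$, denoted $(T_t^b)_{t\ge0}$ when $\nu=\mu$ and $(T_{t,n}^b)_{t\ge0}$ when $\nu=\mu_n$. $(C[0,1])_\nu^N$ is the set of elements of $L^2([0,1],\nu)$ having a continuous representative on $[0,1]$; $(C[0,1])_\nu^D$ is the set of those having a continuous representative $\bar f$ with $\bar f(0)=\bar f(1)=0$. Each is a Banach space with norm $\lVert f\rVert_\infty:=\sup_{x\in\operatorname{supp}(\nu)}|\bar f(x)|$, $\bar f$ a continuous representative;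 equivalently, the sup norm over $[0,1]$ of the continuous representative that is linear on every interval contained in $[0,1]\setminus\operatorname{supp}(\nu)$. The $L^2$-semigroup maps $(C[0,1])_\nu^b$ into itself, and the restricted semigroup is its restriction to $(C[0,1])_\nu^b$, denoted $\bar T_t^b$ for $\nu=\mu$ and $\bar T_{t,n}^b$ for $\nu=\mu_n$. When $\operatorname{supp}(\mu)\subseteq\operatorname{supp}(\mu_n)$, the embedding $\pi_n:(C[0,1])_\mu^b\to(C[0,1])_{\mu_n}^b$ sends $f$ to the $L^2([0,1],\mu_n)$-equivalence class of the continuous representative of $f$ that is linear on every interval contained in $[0,1]\setminus\operatorname{supp}(\mu)$. *)

(* Defs.v *)
From HB Require Import structures.
From mathcomp Require Import all_boot all_order all_algebra.
From mathcomp Require Import all_classical all_reals all_analysis.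
From mathcomp Require Import measurable_realfun.

Set Implicit Arguments.
Unset Strict Implicit.
Unset Printing Implicit Defensive.

Import Order.TTheory GRing.Theory Num.Theory.
Import numFieldNormedType.Exports.

Local Open Scope classical_set_scope.
Local Open Scope ring_scope.

(* A Borel measure on [0,1] is represented by a Borel measure on R that gives
   full mass to [0,1]; a function on [0,1] is represented by a function on R,
   whose values off [0,1] play no role. *)
Notation borel_probability R := (probability (measurableTypeR R) R).

Lemma ae_eq_Lnorm2 d (T : measurableType d) (R : realType)
    (mu : {measure set T -> \bar R}) (f g : T -> R) :
  measurable_fun [set: T] f -> measurable_fun [set: T] g ->
  f = g %[ae mu] -> ('N[mu]_2%:E[EFin \o f] = 'N[mu]_2%:E[EFin \o g])%E.
Proof.
have mp (h : T -> \bar R) : measurable_fun [set: T] h ->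
    measurable_fun [set: T] (fun x => `|h x| `^ 2)%E.
  move=> mh; apply: (@measurableT_comp _ _ _ _ _ _ (fun x => x `^ 2)%E) => //=.
    exact: (measurableT_comp (measurable_poweR _)).
  exact: measurableT_comp.
move=> mf mg fg; rewrite unlock; congr (_ `^ _)%E.
apply: ae_eq_integral => //;
  [exact/mp/measurable_EFinP|exact/mp/measurable_EFinP|].
by apply: filterS fg => x /= + _ => /(_ I) ->.
Qed.

Variant boundary_condition := Neumann | Dirichlet.

Section KreinFeller.
Context {R : realType}.
Implicit Types (nu : borel_probability R) (b : boundary_condition).

Local Notation mR := (measurableTypeR R).
Local Notation I01 := (`[0, 1]%classic : set R).

Definition nonatomic nu : Prop :=
  forall A : set mR, measurable A -> (0 < nu A)%E ->
    exists B : set mR, [/\ measurable B, B `<=` A & (0 < nu B < nu A)%E].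

Definition supp nu : set R :=
  [set x | forall U : set R, open U -> U x -> (0 < nu U)%E].

Definition admissible nu : Prop :=
  [/\ nu I01 = 1%E, nonatomic nu, supp nu 0 & supp nu 1].

Definition cvg_weakly (nun : nat -> borel_probability R) nu : Prop :=
  forall phi : R -> R, {within I01, continuous phi} ->
    (\int[nun n]_(x in I01) phi x)%R @[n --> \oo] -->
    (\int[nu]_(x in I01) phi x)%R.

(* Elements of [L2 nu] are classes modulo nu-a.e. equality; the coercion to
   functions picks a representative.  The library puts no module structure on
   this type, so linear combinations are taken on representatives. *)
Definition L2 nu : Type := LspaceType nu (lee1n 2).

Definition L2norm nu (f : R -> R) : \bar R := 'N[nu]_2%:E[EFin \o f].

Lemma L2_class_finite nu (f : {mfun mR >-> mR}) :
  finite_norm nu 2%:E f ->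
  finite_norm nu 2%:E (\pi_({mfun_ nu, mR >-> mR})%qT f : {mfun_ nu, mR >-> mR}).
Proof.
apply: le_lt_trans; rewrite le_eqVlt; apply/orP; left; apply/eqP.
apply: ae_eq_Lnorm2.
- exact: (@measurable_funPT _ _ mR mR).
- exact: (@measurable_funPT _ _ mR mR).
- by apply/asboolP; have /eqquotP := reprK (\pi_({mfun_ nu, mR >-> mR})%qT f).
Qed.

Definition L2_class nu (f : {mfun mR >-> mR}) (h : finite_norm nu 2%:E f) :
    L2 nu :=
  LebesgueSpace.Pack (LebesgueSpace.Class
    (isFinLebesgue.Build _ _ _ nu _ (lee1n 2) _ (L2_class_finite h))).

Lemma finite_norm_0 nu : finite_norm nu 2%:E (cst 0 : {mfun mR >-> mR}).
Proof. by rewrite /finite_norm Lnorm0 ?ltry// gt_eqF. Qed.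

Definition L2_zero nu : L2 nu := L2_class (finite_norm_0 nu).

(* One-sided derivatives at 0 and 1. *)
Definition C1_with_derivative (f f' : R -> R) : Prop :=
  {within I01, continuous f'} /\
  forall x, I01 x ->
    (y - x)^-1 * (f y - f x) @[y --> within I01 x^'] --> f' x.

(* [f] is in the domain D^2_nu, with [f'] its derivative and [w] its
   nu-derivative (f')^nu. *)
Definition D2 nu (f f' : R -> R) (w : L2 nu) : Prop :=
  C1_with_derivative f f' /\
  forall x, I01 x ->
    f' x = f' 0 + (\int[nu]_(y in (`[0, x]%classic : set R)) w y)%R.

(* [krein_feller nu b u w]: u is in the domain of the Krein-Feller operator
   with boundary condition b, and the operator maps u to w. *)
Definition krein_feller nu b (u w : L2 nu) : Prop :=
  exists f f' : R -> R,
    [/\ D2 f f' w, u = f %[ae nu] &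
        match b with
        | Neumann => f' 0 = 0 /\ f' 1 = 0
        | Dirichlet => f 0 = 0 /\ f 1 = 0
        end].

(* Only nonnegative times are constrained. *)
Definition contraction_semigroup nu (T : R -> L2 nu -> L2 nu) : Prop :=
  [/\ (forall t, 0 <= t -> forall (a : R) (u v w : L2 nu),
         w = (fun x => a * u x + v x) %[ae nu] ->
         T t w = (fun x => a * T t u x + T t v x) %[ae nu]),
      (forall u, T 0 u = u),
      (forall s t, 0 <= s -> 0 <= t -> forall u, T (s + t) u = T s (T t u)),
      (forall t, 0 <= t -> forall u, (L2norm nu (T t u) <= L2norm nu u)%E) &
      (forall u, L2norm nu (fun x => T t u x - u x) @[t --> 0^'+] --> 0%E)].

Definition generator nu (T : R -> L2 nu -> L2 nu) (u w : L2 nu) : Prop :=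
  L2norm nu (fun x => h^-1 * (T h u x - u x) - w x) @[h --> 0^'+] --> 0%E.

Definition krein_feller_semigroup nu b (T : R -> L2 nu -> L2 nu) : Prop :=
  contraction_semigroup T /\
  forall u w, generator T u w <-> krein_feller b u w.

(* The space (C[0,1])_nu^b, as a predicate on classes given by any
   representative [u]. *)
Definition Cspace nu b (u : R -> R) : Prop :=
  exists f : R -> R,
    [/\ {within I01, continuous f}, u = f %[ae nu] &
        match b with
        | Neumann => True
        | Dirichlet => f 0 = 0 /\ f 1 = 0
        end].

(* The continuous representative that is linear on every interval contained in
   [0,1] \ supp nu; on [0,1] it is unique for admissible nu. *)
Definition gap_linear_rep nu (u : R -> R) : R -> R :=
  xget (cst 0) [set f : R -> R |
    [/\ {within I01, continuous f}, u = f %[ae nu] &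
        forall i : interval R, [set` i] `<=` I01 `\` supp nu ->
          exists k m : R, forall x, x \in i -> f x = k * x + m]].

(* The value +oo off (C[0,1])_nu^b makes finiteness of the norm include
   membership in that space. *)
Definition Cnorm nu b (u : R -> R) : \bar R :=
  if `[< Cspace nu b u >] then
    ereal_sup [set `|gap_linear_rep nu u x|%:E | x in supp nu]
  else +oo%E.

(* The embedding pi_n for mu and nu = mu_n: the class in L2 nu of the
   gap-linear representative (with respect to mu) of u. *)
Definition embedding (mu nu : borel_probability R) (u : L2 mu) : L2 nu :=
  if pselect (exists v : L2 nu, v = gap_linear_rep mu u %[ae nu]) is left h
  then projT1 (cid h) else L2_zero nu.

End KreinFeller.

(* Main.v *)
Require Import Defs.
From HB Require Import structures.
From mathcomp Require Import all_boot all_order all_algebra.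
From mathcomp Require Import all_classical all_reals all_analysis.
From mathcomp Require Import measurable_realfun.
From mathcomp Require Import ring lra.

Set Implicit Arguments.
Unset Strict Implicit.
Unset Printing Implicit Defensive.

Import Order.TTheory GRing.Theory Num.Theory.
Import numFieldNormedType.Exports.

Local Open Scope classical_set_scope.
Local Open Scope ring_scope.

(** The proof rests on a maximum principle and on an explicit solution operator
    whose kernel does not depend on the measure; resolvents of the operators are
    not needed. Write A for the operator of mu, A_n for that of mu_n.

    Maximum principle. Green's formula shows that the integral of (u - k)^+ A u
    is nonpositive for u in the domain and k >= 0 ([energy_le0]). Hence, if a
    curve e in L2 has right derivative A e + r with r <= c, and e starts
    nonpositive, then the squared norm of (e - c t)^+ does not increase and
    e <= c t almost everywhere ([curve_nonpos], [duhamel]). With r = 0 this says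
    that the semigroup contracts the supremum norm and preserves the space of
    continuous functions ([sg_sup_contr], [sg_Cspace]).

    Solution operator. The solution of A u = h with the given boundary condition
    is [Vop], an integral of h against a kernel built from (x - s)^+, up to
    normalising constants that are again integrals of h. Weak convergence is
    uniform on totally bounded families of integrands, so that the operators
    [Vop] of mu_n converge to that of mu, uniformly along bounded Lipschitz
    curves of right-hand sides ([Vop_cvg_curve]).

    Density. A continuous gap-linear function is a uniform limit of piecewise
    linear functions with nodes in the support; spreading each kink into a small
    bump of the measure turns these into elements of the domain with a continuous
    image ([density_step]). Iterating, the elements g for which A^3 g is
    continuous are dense in the supremum norm ([smooth_dense]).

    Comparison. For such a g put u(t) = T_t g, and let v(t) solve A_n v = A u(t)
    (in the Neumann case after subtracting a small constant from A u(t)). Then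
    v(t) is uniformly close to u(t), and its time derivative, obtained by applying
    the solution operator of mu_n to A^2 u(t), is close to A u(t), hence to
    A_n v(t). Thus v solves the evolution equation of A_n up to a small defect,
    and [duhamel] bounds its distance to the orbit of v(0) under the semigroup of
    mu_n ([orbit_comparison]). Contractivity in the supremum norm carries the
    estimate over from g to an arbitrary continuous f. *)

(** Linear arithmetic, after clearing the hypotheses that are neither
    equations nor inequalities. *)
Ltac linarith :=
  repeat match goal with
  | H : ?P |- _ => lazymatch type of P with Prop => lazymatch P with
      is_true _ => fail | _ = _ => fail | _ /\ _ => fail | _ => clear H end end
  end; lra.

(** * Integrals and square-integrable functions *)

Section L2_basics.
Context d (T : measurableType d) {R : realType} (nu : probability T R).

Local Notation meas f := (measurable_fun [set: T] f).
(** Integrability of a real-valued function over the whole space. *)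
Definition intg (f : T -> R) : Prop := nu.-integrable setT (EFin \o f).
Local Notation mean f := (Rintegral nu setT f).

Implicit Types f g : T -> R.

Lemma intg_meas f : intg f -> meas f.
Proof. by case/integrableP => /measurable_EFinP. Qed.

Lemma ae_eq_intg f g : meas f -> f = g %[ae nu] -> intg g -> intg f.
Proof.
move=> mf fg ig; have mg := intg_meas ig.
case/integrableP: ig => _ ig; apply/integrableP; split; first exact/measurable_EFinP.
have -> : (\int[nu]_x `|(EFin \o f) x| = \int[nu]_x `|(EFin \o g) x|)%E.
  apply: ae_eq_integral => //.
  - by apply: measurableT_comp => //; exact/measurable_EFinP.
  - by apply: measurableT_comp => //; exact/measurable_EFinP.
  - by apply: filterS fg => x /= + _ => /(_ I) ->.
exact: ig.
Qed.

Lemma ae_eq_mean f g : meas f -> meas g -> f = g %[ae nu] -> mean f = mean g.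
Proof.
move=> mf mg fg; congr fine; apply: ae_eq_integral => //.
- exact/measurable_EFinP.
- exact/measurable_EFinP.
- by apply: filterS fg => x /= + _ => /(_ I) ->.
Qed.

Lemma le_intg f g : meas f -> intg g -> {ae nu, forall x, `|f x| <= g x} -> intg f.
Proof.
move=> mf ig fg; have mg := intg_meas ig.
have ih : intg (fun x => Num.max (g x) `|f x|).
  apply: (ae_eq_intg _ _ ig).
  - apply: measurable_maxr => //; exact: measurableT_comp.
  - by apply: filterS fg => x fgx _; rewrite /= /Num.max; case: ltP => //; linarith.
apply: (le_integrable measurableT _ _ ih); first exact/measurable_EFinP.
by move=> x _ /=; rewrite lee_fin; apply: (le_trans _ (ler_norm _)); rewrite le_max lexx orbT.
Qed.

Lemma intg_cst c : intg (cst c).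
Proof. exact: finite_measure_integrable_cst. Qed.

Lemma intgD f g : intg f -> intg g -> intg (fun x => f x + g x).
Proof. by move=> iF ig; exact: (integrableD measurableT iF ig). Qed.
Lemma intgB f g : intg f -> intg g -> intg (fun x => f x - g x).
Proof. by move=> iF ig; exact: (integrableB measurableT iF ig). Qed.
Lemma intgZ c f : intg f -> intg (fun x => c * f x).
Proof. by move=> iF; exact: (integrableZl measurableT c iF). Qed.
Lemma intg_abs f : intg f -> intg (fun x => `|f x|).
Proof. by move=> iF; exact: (integrable_norm iF). Qed.

Lemma meanD f g : intg f -> intg g -> mean (fun x => f x + g x) = mean f + mean g.
Proof. by move=> iF ig; rewrite RintegralD. Qed.
Lemma meanB f g : intg f -> intg g -> mean (fun x => f x - g x) = mean f - mean g.
Proof. by move=> iF ig; rewrite RintegralB. Qed.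
Lemma meanZ c f : intg f -> mean (fun x => c * f x) = c * mean f.
Proof. by move=> iF; rewrite RintegralZl. Qed.
Lemma mean_cst c : mean (cst c) = c.
Proof.
transitivity (c * fine (nu [set: T])); first exact: Rintegral_cst.
by rewrite probability_setT /= mulr1.
Qed.

Lemma le_mean f g : intg f -> intg g -> {ae nu, forall x, f x <= g x} -> mean f <= mean g.
Proof.
move=> iF ig fg; have mf := intg_meas iF; have mg := intg_meas ig.
have mm : meas (fun x => Num.max (g x) (f x)) by apply: measurable_maxr.
have gm : (fun x => Num.max (g x) (f x)) = g %[ae nu].
  by apply: filterS fg => x fgx _; rewrite /= /Num.max; case: ltP => //; linarith.
rewrite -(ae_eq_mean mm mg gm); apply: le_Rintegral => //.
  exact: (ae_eq_intg mm gm).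
by move=> x _; rewrite le_max lexx orbT.
Qed.

Lemma mean_ge0 f : {ae nu, forall x, 0 <= f x} -> meas f -> 0 <= mean f.
Proof.
move=> f0 mf; rewrite (@ae_eq_mean f (fun x => Num.max 0 (f x))) //.
- by apply: Rintegral_ge0 => x _; rewrite le_max lexx.
- by apply: measurable_maxr.
- by apply: filterS f0 => x f0 _; rewrite /= /Num.max; case: ltP => //; linarith.
Qed.

Lemma normr_mean_le f : intg f -> `|mean f| <= mean (fun x => `|f x|).
Proof. by move=> iF; apply: le_normr_Rintegral. Qed.

Lemma mean_bound f c : meas f -> {ae nu, forall x, `|f x| <= c} -> `|mean f| <= c.
Proof.
move=> mf fc; have iF : intg f by apply: (le_intg mf (intg_cst c)).
apply: (le_trans (normr_mean_le iF)); rewrite -[leRHS]mean_cst.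
by apply: le_mean => //; [exact: intg_abs|exact: intg_cst].
Qed.

Lemma mean_le0_eq0 f : intg f -> {ae nu, forall x, 0 <= f x} -> mean f <= 0 ->
  {ae nu, forall x, f x = 0}.
Proof.
move=> iF f0 Ef; have mf := intg_meas iF.
have E0 : mean f = 0 by apply/eqP; rewrite eq_le Ef mean_ge0.
have af : (fun x => `|f x|) = f %[ae nu].
  by apply: filterS f0 => x ? _; rewrite /= ger0_norm.
have E0' : mean (fun x => `|f x|) = 0.
  by rewrite -E0; apply: ae_eq_mean => //; exact: measurableT_comp.
have : (\int[nu]_x `|(f x)%:E|)%E = 0%E.
  rewrite -[LHS]fineK; last first.
    by have := integrable_fin_num measurableT (intg_abs iF).
  by congr EFin.
move/(ae_eq_integral_abs nu measurableT); rewrite measurable_EFinP => /(_ mf).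
by apply: filterS => x /(_ I) [].
Qed.

(** Square-integrable functions, as functions rather than as classes modulo
    equality almost everywhere. *)
Definition sqi f := meas f /\ intg (fun x => f x ^+ 2).

Lemma sqi_meas f : sqi f -> meas f. Proof. by case. Qed.
Lemma sqi_sq f : sqi f -> intg (fun x => f x ^+ 2). Proof. by case. Qed.

Lemma sqi_intgM f g : sqi f -> sqi g -> intg (fun x => f x * g x).
Proof.
move=> [mf iF] [mg ig]; apply: (le_intg _ (intgD iF ig)); first exact: measurable_funM.
by apply: nearW => x; rewrite ler_norml; apply/andP; split; nra.
Qed.

Lemma sqi_cst c : sqi (cst c).
Proof. by split; [exact: measurable_cst|exact: (intg_cst (c ^+ 2))]. Qed.

Lemma sqi_intg f : sqi f -> intg f.
Proof.
move=> sf; have := sqi_intgM sf (sqi_cst 1).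
by congr intg; apply/funext => x /=; rewrite mulr1.
Qed.

Lemma sqiD f g : sqi f -> sqi g -> sqi (fun x => f x + g x).
Proof.
move=> sf sg; split; first by apply: measurable_funD; [case: sf|case: sg].
have := intgD (intgD (sqi_sq sf) (sqi_sq sg)) (intgZ 2 (sqi_intgM sf sg)).
by congr intg; apply/funext => x; ring.
Qed.

Lemma sqiZ c f : sqi f -> sqi (fun x => c * f x).
Proof.
move=> sf; split; first by apply: measurable_funM => //; case: sf.
have := intgZ (c ^+ 2) (sqi_sq sf).
by congr intg; apply/funext => x; ring.
Qed.

Lemma sqiB f g : sqi f -> sqi g -> sqi (fun x => f x - g x).
Proof.
move=> sf sg; have := sqiD sf (sqiZ (-1) sg).
by congr sqi; apply/funext => x; ring.
Qed.

Lemma sqi_le f g : meas f -> sqi g -> {ae nu, forall x, `|f x| <= `|g x|} -> sqi f.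
Proof.
move=> mf sg fg; split => //; apply: (le_intg _ (sqi_sq sg)); first exact: measurable_funX.
apply: filterS fg => x fg; rewrite normrX -[leRHS]ger0_norm ?sqr_ge0// normrX.
by rewrite ler_sqr ?nnegrE.
Qed.

Lemma sqi_bnd f c : meas f -> {ae nu, forall x, `|f x| <= c} -> sqi f.
Proof.
move=> mf fc; apply: (sqi_le mf (sqi_cst c)); apply: filterS fc => x /= fc.
exact: (le_trans fc (ler_norm _)).
Qed.

Lemma sqi_pos f : sqi f -> sqi (fun x => Num.max 0 (f x)).
Proof.
move=> sf; apply: (sqi_le _ sf); first by apply: measurable_maxr => //; case: sf.
by apply: nearW => x; rewrite /Num.max; case: ltP => // _; rewrite normr0.
Qed.

Lemma aeS (P Q : T -> Prop) : (forall x, P x -> Q x) ->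
  {ae nu, forall x, P x} -> {ae nu, forall x, Q x}.
Proof. by move=> PQ; apply: filterS => x; exact: PQ. Qed.

Lemma aeS2 (P1 P2 Q : T -> Prop) : (forall x, P1 x -> P2 x -> Q x) ->
  {ae nu, forall x, P1 x} -> {ae nu, forall x, P2 x} -> {ae nu, forall x, Q x}.
Proof. by move=> PQ; apply: filterS2 => x; exact: PQ. Qed.

Lemma aeI (P Q : T -> Prop) : {ae nu, forall x, P x} -> {ae nu, forall x, Q x} ->
  {ae nu, forall x, P x /\ Q x}.
Proof. by apply: aeS2 => x; split. Qed.

Lemma ae_all_nat (P : nat -> T -> Prop) :
  (forall n, {ae nu, forall x, P n x}) -> {ae nu, forall x, forall n, P n x}.
Proof. by move=> H; apply/ae_foralln. Qed.

Lemma ae_eq_iff f g : f = g %[ae nu] <-> {ae nu, forall x, f x = g x}.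
Proof. by split; apply: filterS => x //; apply. Qed.

End L2_basics.
(** The integral of a real-valued function with respect to a probability. *)
Notation mean nu f := (Rintegral nu setT f).

(** * Elements of L2 *)

Section L2_space.
Context {R : realType} (nu : borel_probability R).
Local Notation mR := (measurableTypeR R).
Local Notation meas f := (@measurable_fun _ _ mR mR [set: mR] f).
Implicit Types f g : R -> R.
Lemma L2norm_poweR f : meas f ->
  (L2norm nu f = (\int[nu]_x (f x ^+ 2)%:E) `^ (2^-1))%E.
Proof.
move=> mf; rewrite /L2norm unlock; congr (_ `^ _)%E; apply: eq_integral => x _ /=.
by congr EFin; rewrite powR_mulrn// real_normK// num_real.
Qed.

Lemma L2norm_sqrt f : sqi nu f -> L2norm nu f = (Num.sqrt (mean nu (fun x => f x ^+ 2)))%:E.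
Proof.
move=> sf; rewrite L2norm_poweR; last by case: sf.
rewrite -[X in (X `^ _)%E]fineK; last by have := integrable_fin_num measurableT (sqi_sq sf).
by rewrite poweR_EFin powR12_sqrt// Rintegral_ge0// => x _; exact: sqr_ge0.
Qed.

Lemma L2_meas (u : L2 nu) : meas u.
Proof. exact: (@measurable_funPT _ _ mR mR). Qed.

Lemma L2_sqi (u : L2 nu) : sqi nu u.
Proof.
split; first exact: L2_meas.
apply/integrableP; split.
  by apply/measurable_EFinP; apply: measurable_funX; exact: L2_meas.
have : (L2norm nu u < +oo)%E by case: u => u [[]].
rewrite L2norm_poweR; last exact: L2_meas.
under [X in _ -> (X < _)%E]eq_integral do rewrite /= ger0_norm ?sqr_ge0//.
rewrite !ltey; apply: contra => /eqP ->.
by rewrite poweRyr.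
Qed.

Lemma sqi_finite f : sqi nu f -> (L2norm nu f < +oo)%E.
Proof. by move=> sf; rewrite L2norm_sqrt// ltry. Qed.

Lemma sqi_L2 f : sqi nu f -> exists v : L2 nu, v = f %[ae nu].
Proof.
move=> sf; have ff := sqi_finite sf.
have mf : f \in @mfun _ _ mR mR by rewrite inE /=; apply: sqi_meas sf.
have ff' : finite_norm nu 2%:E (@mfun_Sub _ _ mR mR f mf) by [].
exists (L2_class ff').
by apply/asboolP; have /eqquotP := reprK (\pi_({mfun_ nu, mR >-> mR})%qT (@mfun_Sub _ _ mR mR f mf)).
Qed.

End L2_space.

(** * Continuous and C1 functions on the unit interval *)

Section unit_interval.
Context {R : realType}.
Local Notation I01 := (`[0, 1]%classic : set R).
Implicit Types f g h : R -> R.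

Lemma I01E (x : R) : I01 x <-> 0 <= x <= 1.
Proof. by rewrite /= in_itv. Qed.

Lemma cont01P f : {within I01, continuous f} <->
  forall x, I01 x -> forall e : R, 0 < e -> exists2 d : R, 0 < d &
    forall y, I01 y -> `|y - x| < d -> `|f y - f x| < e.
Proof.
split.
- move=> /subspace_continuousP fc x Ix e e0.
  have /cvgrPdist_lt /(_ e e0) := fc x Ix.
  rewrite near_withinE => /nbhs_ballP[d /= d0 H].
  exists d => // y Iy yx; rewrite distrC; apply: H => //.
  by rewrite /ball /= distrC.
- move=> H; apply/subspace_continuousP => x Ix; apply/cvgrPdist_lt => e e0.
  have [d d0 {}H] := H x Ix e e0; rewrite near_withinE; apply/nbhs_ballP.
  exists d => // y; rewrite /ball /= distrC => yx Iy; rewrite distrC; exact: H.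
Qed.

(** The projection onto the unit interval. Composing with it makes a function
    that is continuous on [0,1] continuous, hence measurable, on the line. *)
Definition clamp (x : R) : R := Num.max 0 (Num.min 1 x).

Lemma clamp01 x : I01 (clamp x).
Proof.
apply/I01E; rewrite /clamp /Num.max /Num.min.
by case: (ltP 1 x) => ?; [case: (ltP 0 1)|case: (ltP 0 x)] => ?; linarith.
Qed.

Lemma clampE x : I01 x -> clamp x = x.
Proof.
move=> /I01E Ix; rewrite /clamp /Num.max /Num.min.
by case: (ltP 1 x) => ?; [case: (ltP 0 1)|case: (ltP 0 x)] => ?; linarith.
Qed.

Lemma clamp_lip x y : `|clamp x - clamp y| <= `|x - y|.
Proof.
have clampE' z : [\/ z <= 0 /\ clamp z = 0, 0 <= z <= 1 /\ clamp z = z |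
    1 <= z /\ clamp z = 1].
  rewrite /clamp /Num.max /Num.min.
  case: (ltP 1 z) => z1; [case: (ltP 0 1)|case: (ltP 0 z)] => z0.
  - by apply: Or33; linarith.
  - by exfalso; linarith.
  - by apply: Or32; linarith.
  - by apply: Or31; linarith.
have := ler_norm (x - y); have := ler_norm (- (x - y)); rewrite normrN => h1 h2.
by rewrite ler_norml; case: (clampE' x) => -[? ->]; case: (clampE' y) => -[? ->]; linarith.
Qed.

Lemma cont_clamp f : {within I01, continuous f} -> continuous (f \o clamp).
Proof.
move=> /cont01P fc x; apply/cvgrPdist_lt => e e0.
have [d d0 H] := fc _ (clamp01 x) e e0; apply/nbhs_ballP.
exists d => // y; rewrite /ball /= distrC => yx; rewrite distrC; apply: H.
  exact: clamp01.
exact: (le_lt_trans (clamp_lip _ _)).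
Qed.

Lemma unif01 f : {within I01, continuous f} ->
  forall e : R, 0 < e -> exists2 d : R, 0 < d &
    forall x y, I01 x -> I01 y -> `|y - x| < d -> `|f y - f x| < e.
Proof.
move=> /cont01P fc e e0.
have /compact_near_coveringP nc : compact I01 by exact: segment_compact.
have := nc _ (0^'+ : set_system R) (fun d x => I01 x -> forall y, I01 y ->
  `|y - x| < d -> `|f y - f x| < e) _.
case=> [x Ix|d /= d0 H].
- have [d d0 H] := fc x Ix (e / 2) (divr_gt0 e0 (ltr0n _ 2)).
  have d20 : 0 < d / 2 by linarith.
  near=> x' d' => /= Ix' y Iy yx'.
  have x'x : `|x' - x| < d / 2.
    by near: x'; apply/nbhs_ballP; exists (d / 2) => // z; rewrite /ball /= distrC.
  have d'd : d' < d / 2 by near: d'; exact: nbhs_right_lt.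
  have := H x' Ix' _; have := H y Iy _.
  have := ler_distD x' y x; have := ler_distD (f x) (f y) (f x').
  rewrite (distrC (f x) (f x')).
  by move=> ? ? h1 h2; have := h1 _; have := h2 _; linarith.
- exists (d / 2) => [|x y Ix Iy yx]; first by linarith.
  by apply: (H (d / 2)) => //; rewrite ?divr_gt0//= sub0r normrN gtr0_norm ?divr_gt0//; linarith.
Unshelve. all: by end_near.
Qed.

Lemma bnd01 f : {within I01, continuous f} ->
  exists2 M : R, 0 <= M & forall x, I01 x -> `|f x| <= M.
Proof.
move=> fc; have [d d0 H] := unif01 fc ltr01.
have claim n : exists M, forall x, I01 x -> x < n%:R * d -> `|f x| <= M.
  elim: n => [|n [M IH]].
    by exists 0 => x /I01E Ix; rewrite mul0r; linarith.
  exists (Num.max M (`|f (clamp (n%:R * d))| + 1)) => x Ix xd.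
  have [xn|xn] := ltP x (n%:R * d); first by rewrite le_max IH.
  have h : `|x - clamp (n%:R * d)| < d.
    rewrite -{1}(clampE Ix); apply: (le_lt_trans (clamp_lip _ _)).
    by rewrite ger0_norm; move: xd; rewrite -natr1 mulrDl mul1r; linarith.
  rewrite le_max; apply/orP; right.
  have := H _ _ (clamp01 (n%:R * d)) Ix h.
  have := ler_distD 0 (f x) (f (clamp (n%:R * d))).
  have := ler_normD (f x - f (clamp (n%:R * d))) (f (clamp (n%:R * d))).
  rewrite subrK; linarith.
have [M HM] := claim (Num.bound (d^-1)).+1.
exists (Num.max 0 M) => [|x Ix]; first by rewrite le_max lexx.
rewrite le_max HM ?orbT//; move/I01E: Ix => Ix.
have := archi_boundP (ltW (etrans (invr_gt0 d) d0)).
rewrite -natr1 -(ltr_pM2r d0) mulVf ?gt_eqF//; nra.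
Qed.

(** A function that does not increase over short steps does not increase. *)
Lemma step_nonincr (J : R -> R) (a b d : R) : a <= b -> 0 < d ->
  (forall x y, a <= x -> x <= y -> y <= b -> y - x < d -> J y <= J x) ->
  J b <= J a.
Proof.
move=> ab d0 H.
have claim n x : a <= x -> x <= b -> x - a <= n%:R * (d / 2) -> J x <= J a.
  elim: n x => [|n IH] x ax xb; rewrite ?mul0r => xa.
    by have -> : x = a by linarith.
  have [h|h] := leP (x - d / 2) a; first by apply: H => //; linarith.
  apply: (@le_trans _ _ (J (x - d / 2))); first by apply: H; linarith.
  by apply: IH; try linarith; move: xa; rewrite -natr1 mulrDl mul1r; linarith.
pose N := Num.bound ((b - a) / (d / 2)).
apply: (claim N) => //; rewrite -ler_pdivrMr ?divr_gt0//.
by apply/ltW/archi_boundP; rewrite divr_ge0//; linarith.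
Qed.

Lemma der01P f f' : C1_with_derivative f f' <-> {within I01, continuous f'} /\
  forall x, I01 x -> forall e : R, 0 < e -> exists2 d : R, 0 < d &
    forall y, I01 y -> y != x -> `|y - x| < d ->
      `|(y - x)^-1 * (f y - f x) - f' x| < e.
Proof.
split=> -[fc H]; split => // x Ix.
- move=> e e0; have /cvgrPdist_lt /(_ e e0) := H x Ix.
  rewrite near_withinE near_withinE => /nbhs_ballP[d /= d0 {}H].
  by exists d => // y Iy yx yd; rewrite distrC; apply: H => //; rewrite /ball /= distrC.
- apply/cvgrPdist_lt => e e0; have [d d0 {}H] := H x Ix e e0.
  rewrite near_withinE near_withinE; apply/nbhs_ballP; exists d => // y.
  by rewrite /ball /= distrC => yd yx Iy; rewrite distrC; apply: H.
Qed.

Lemma C1_cont f f' : C1_with_derivative f f' -> {within I01, continuous f}.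
Proof.
move=> /der01P[fc H]; apply/cont01P => x Ix e e0.
have [d d0 {}H] := H x Ix 1 ltr01.
pose K := `|f' x| + 1; have K0 : 0 < K by rewrite /K; have := normr_ge0 (f' x); linarith.
exists (Num.min d (e / K)) => [|y Iy]; first by rewrite lt_min d0 divr_gt0.
rewrite lt_min => /andP[yd ye].
have [->|yx] := eqVneq y x; first by rewrite subrr normr0.
have yx0 : y - x != 0 by rewrite subr_eq0.
have -> : f y - f x = (y - x) * ((y - x)^-1 * (f y - f x)) by field.
rewrite normrM; apply: (@le_lt_trans _ _ (`|y - x| * K)).
  rewrite ler_wpM2l//; have := H y Iy yx yd.
  have := ler_normD ((y - x)^-1 * (f y - f x) - f' x) (f' x).
  rewrite subrK /K; linarith.
by rewrite -ltr_pdivlMr.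
Qed.

(** The mean value theorem, for one-sided derivatives at the end points. *)
Lemma C1_MVT f f' x y : C1_with_derivative f f' -> 0 <= x -> x < y -> y <= 1 ->
  exists2 c : R, x < c < y & f y - f x = f' c * (y - x).
Proof.
move=> Cf x0 xy y1; have fc := C1_cont Cf; move/der01P: Cf => [f'c H].
have [||c] := @MVT R f f' x y xy; last by rewrite in_itv /=; exists c.
- move=> z; rewrite in_itv /= => zxy.
  have cv : h^-1 *: ((f \o shift z) (h *: (1 : R)) - f z) @[h --> 0^'] --> f' z.
    apply/cvgrPdist_lt => e e0; have [|d d0 {}H] := H z _ e e0; first by apply/I01E; linarith.
    rewrite near_withinE; apply/nbhs_ballP.
    exists (Num.min d (Num.min (z - x) (y - z))) => /=.
      by rewrite !lt_min d0 /=; apply/andP; split; linarith.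
    move=> h; rewrite /ball /= sub0r normrN !lt_min => /and3P[hd h1 h2] h0.
    have := H (h + z); rewrite addrK => {}H.
    rewrite distrC; have -> : h *: (1 : R) = h by rewrite /GRing.scale /= mulr1.
    apply: H => //; last by rewrite -subr_eq0 addrK.
    by apply/I01E; move: h1 h2; rewrite !ltr_norml => /andP[? ?] /andP[? ?]; linarith.
  apply: DeriveDef; last exact: (cvg_lim (@Rhausdorff R) cv).
  by apply/cvg_ex; exists (f' z).
- apply: (@continuous_subspaceW _ _ _ I01 _ _ fc) => z /=.
  by rewrite !in_itv /= => /andP[? ?]; apply/andP; split; linarith.
Qed.

(** The derivative of a C1 function is uniform. *)
Lemma C1_unif f f' : C1_with_derivative f f' -> forall e : R, 0 < e ->
  exists2 d : R, 0 < d & forall x y, I01 x -> I01 y -> `|y - x| < d ->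
    `|f y - f x - f' x * (y - x)| <= e * `|y - x|.
Proof.
move=> Cf e e0; have f'c := Cf.1; have [d d0 H] := unif01 f'c e0.
exists d => // x y Ix Iy yx; move/I01E: (Ix) => Ix'; move/I01E: (Iy) => Iy'.
have key c : I01 c -> `|c - x| < d -> f y - f x = f' c * (y - x) ->
    `|f y - f x - f' x * (y - x)| <= e * `|y - x|.
  move=> Ic cx ->; rewrite -mulrBl normrM ler_wpM2r// ltW//; exact: H.
have [xy|xy|xy] := ltgtP x y.
- have x0 : 0 <= x by linarith.
  have y1 : y <= 1 by linarith.
  have [c cxy ec] := C1_MVT Cf x0 xy y1.
  apply: (key c) => //; first by apply/I01E; linarith.
  by move: yx; rewrite !gtr0_norm; linarith.
- have y0 : 0 <= y by linarith.
  have x1 : x <= 1 by linarith.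
  have [c cxy ec] := C1_MVT Cf y0 xy x1.
  apply: (key c) => //; first by apply/I01E; linarith.
    by move: yx; rewrite !ltr0_norm; linarith.
  by move: ec; linarith.
- by rewrite xy !subrr mulr0 subrr normr0 mulr0.
Qed.

Lemma cont_lin a f g : {within I01, continuous f} -> {within I01, continuous g} ->
  {within I01, continuous (fun x => a * f x + g x)}.
Proof.
move=> /subspace_continuousP fc /subspace_continuousP gc.
apply/subspace_continuousP => x Ix; apply: cvgD; last exact: gc.
apply: cvgM; [exact: cvg_cst|exact: fc].
Qed.

Lemma cont_mul f g : {within I01, continuous f} -> {within I01, continuous g} ->
  {within I01, continuous (fun x => f x * g x)}.
Proof.
move=> /subspace_continuousP fc /subspace_continuousP gc.
apply/subspace_continuousP => x Ix.
apply: cvgM; [exact: fc|exact: gc].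
Qed.

Lemma cont_cst (c : R) : {within I01, continuous (fun=> c)}.
Proof. by apply/subspace_continuousP => x Ix; exact: cvg_cst. Qed.

Lemma cont_eq f g : (forall x, I01 x -> f x = g x) ->
  {within I01, continuous f} -> {within I01, continuous g}.
Proof.
move=> fg /cont01P fc; apply/cont01P => x Ix e e0.
by have [d d0 H] := fc x Ix e e0; exists d => // y Iy yx; rewrite -!fg//; exact: H.
Qed.

Lemma C1_lin a f f' g g' : C1_with_derivative f f' -> C1_with_derivative g g' ->
  C1_with_derivative (fun x => a * f x + g x) (fun x => a * f' x + g' x).
Proof.
move=> [fc Hf] [gc Hg]; split=> [|x Ix]; first exact: cont_lin.
have -> : (fun y => (y - x)^-1 * (a * f y + g y - (a * f x + g x))) =
  (fun y => a * ((y - x)^-1 * (f y - f x)) + (y - x)^-1 * (g y - g x)).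
  by apply/funext => y; ring.
apply: cvgD; last exact: Hg.
apply: cvgM; [exact: cvg_cst|exact: Hf].
Qed.

(** Functions with the same derivative and the same value at 0 agree. *)
Lemma C1_eq f g f' : C1_with_derivative f f' -> C1_with_derivative g f' ->
  f 0 = g 0 -> forall x, I01 x -> f x = g x.
Proof.
move=> Cf Cg fg0 x /I01E Ix; have Ch := C1_lin (-1) Cf Cg.
have [->//|x0] := eqVneq x 0.
have {}x0 : 0 < x by move: x0; rewrite neq_lt; case/orP; linarith.
have x1 : x <= 1 by linarith.
have [c cx] := C1_MVT Ch (lexx 0) x0 x1.
rewrite /= fg0; have -> : -1 * f' c + f' c = 0 by ring.
by rewrite mul0r; linarith.
Qed.
Lemma C1_affine (a k : R) : C1_with_derivative (fun x => a + k * x) (fun=> k).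
Proof.
apply/der01P; split; first exact: cont_cst.
move=> x Ix e e0; exists 1 => // y Iy yx _.
have yx0 : y - x != 0 by rewrite subr_eq0.
have -> : (y - x)^-1 * (a + k * y - (a + k * x)) - k = 0 by field.
by rewrite normr0.
Qed.

Lemma C1_ext f f' g g' : (forall x, I01 x -> f x = g x) ->
  (forall x, I01 x -> f' x = g' x) ->
  C1_with_derivative f f' -> C1_with_derivative g g'.
Proof.
move=> fg fg' /der01P[fc H]; apply/der01P; split; first exact: (cont_eq fg').
move=> x Ix e e0; have [d d0 {}H] := H x Ix e e0; exists d => // y Iy yx yd.
by rewrite -!fg// -fg'//; exact: H.
Qed.
End unit_interval.
Arguments cont_lin {R} a [f g] _ _.
Arguments cont_cst {R} c.

(** * Non-atomic measures and their supports *)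

Section measure_on_unit_interval.
Context {R : realType} (nu : borel_probability R).
Local Notation mR := (measurableTypeR R).
Local Notation I01 := (`[0, 1]%classic : set R).
Local Notation meas f := (@measurable_fun _ _ mR mR [set: mR] f).
Implicit Types f g h w : R -> R.
Hypothesis nu_adm : admissible nu.

Lemma mI01 : measurable (I01 : set mR).
Proof. exact: measurable_itv. Qed.

Lemma ae01 (P : R -> Prop) : (forall x, I01 x -> P x) -> {ae nu, forall x, P x}.
Proof.
move=> IP; have [n1 _ _ _] := nu_adm; exists (~` I01); split.
- by apply: measurableC; exact: mI01.
- by rewrite probability_setC ?n1 ?subee//; exact: mI01.
- by move=> x; apply: contra_not => Ix; exact: IP.
Qed.

Lemma ae01_I : {ae nu, forall x, I01 x}.
Proof. exact: ae01. Qed.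

Lemma nu_point x : nu [set x] = 0%E.
Proof.
have [_ na _ _] := nu_adm; apply: contrapT => n0.
have [||B [mB BA /andP[B0 B1]]] := na [set x].
- exact: measurable_set1.
- by rewrite lt0e measure_ge0 andbT; apply/eqP.
- have [Bx|Bx] := pselect (B x).
    have BE : B = [set x] by apply/seteqP; split => // y ->.
    by move: B1; rewrite BE ltxx.
  have BE : B = set0 by apply/seteqP; split => // y By; have := BA _ By => /= yx; apply: Bx; rewrite -yx.
  by move: B0; rewrite BE measure0 ltxx.
Qed.

Lemma nu_fin A : measurable (A : set mR) -> nu A = (fine (nu A))%:E.
Proof. by move=> mA; rewrite fineK// fin_num_measure. Qed.

Lemma nu_small x e : 0 < e -> exists2 d : R, 0 < d &
  fine (nu `[x - d, x + d]%classic) < e.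
Proof.
move=> e0; pose F (n : nat) : set mR := `[x - n.+1%:R^-1, x + n.+1%:R^-1]%classic.
have mF n : measurable (F n) by exact: measurable_itv.
have FI : \bigcap_n F n = [set x].
  apply/seteqP; split => [y Fy|y -> n _]; last first.
    have k0 : 0 < (n.+1%:R^-1 : R) by [].
    by rewrite /F; move: (n.+1%:R^-1 : R) k0 => k k0; rewrite /= in_itv /=; linarith.
  apply/eqP; rewrite -subr_eq0 -normr_le0 leNgt; apply/negP => yx.
  have [_ /(_ (Num.bound (`|y - x|^-1)) I)] : True /\ (\bigcap_n F n) y by [].
  rewrite /F; set N := Num.bound _.
  have : (N.+1%:R^-1 : R) < `|y - x|.
    rewrite invf_plt ?posrE//; apply: (@lt_trans _ _ N%:R); last by rewrite ltr_nat.
    by apply: archi_boundP; rewrite invr_ge0.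
  move: (N.+1%:R^-1 : R) => k; rewrite /= in_itv /= => kyx yk.
  by move: kyx; case: (ger0P (y - x)) => *; linarith.
have : nu (F n) @[n --> \oo] --> (0%E : \bar R).
  rewrite -(nu_point x) -FI; apply: nonincreasing_cvg_mu => //.
  - by rewrite -ge0_fin_numE// fin_num_measure.
  - by rewrite FI; exact: measurable_set1.
  - move=> m n mn; apply/subsetPset => y; rewrite /F.
    have : n.+1%:R^-1 <= m.+1%:R^-1 :> R by rewrite lef_pV2 ?posrE// ler_nat.
    by move: (n.+1%:R^-1 : R) (m.+1%:R^-1 : R) => ? ?; rewrite /= !in_itv /=; linarith.
move=> /fine_cvgP[_ /cvgrPdist_lt /(_ e e0)] [N _ /(_ N (leqnn N))] /=.
rewrite sub0r normrN => h; exists (N.+1%:R^-1) => //.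
exact: (le_lt_trans (ler_norm _) h).
Qed.

Lemma supp_sub01 x : supp nu x -> I01 x.
Proof.
move=> sx; apply: contrapT => Ix.
have oI : open (~` I01) by apply: closed_openC; exact: itv_closed.
have := sx _ oI Ix; have [n1 _ _ _] := nu_adm.
by rewrite probability_setC ?n1 ?subee ?ltxx//; exact: mI01.
Qed.

Lemma nsuppP x : ~ supp nu x -> exists2 d : R, 0 < d & nu `]x - d, x + d[%classic = 0%E.
Proof.
move=> /existsNP[U] /not_implyP[oU] /not_implyP[Ux U0].
have : nbhs x U by apply: open_nbhs_nbhs.
move=> /nbhs_ballP[d /= d0 dU]; exists d => //.
have nU : nu U = 0%E.
  by apply/eqP; rewrite -measure_le0 leNgt; exact/negP.
apply/eqP; rewrite -measure_le0 -nU; apply: le_measure; rewrite ?inE.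
- exact: measurable_itv.
- exact: open_measurable.
- move=> y; rewrite /= in_itv /= => yx; apply: dU; rewrite /ball /= ltr_norml; linarith.
Qed.

Lemma nsupp_open x : ~ supp nu x -> exists2 d : R, 0 < d &
  forall y, `|y - x| < d -> ~ supp nu y.
Proof.
move=> /nsuppP[d d0 nd]; exists d => // y yx sy.
have := sy _ (interval_open _ _ : open `]x - d, x + d[%classic) _.
rewrite nd ltxx /= in_itv /= => /(_ isT isT) H; have : false; last by [].
by apply: H; move: yx; rewrite ltr_norml; linarith.
Qed.

Lemma gap_null x y : (forall z, x <= z <= y -> ~ supp nu z) -> nu `[x, y]%classic = 0%E.
Proof.
move=> xy; have [yx|{}xy'] := ltP y x; first by rewrite set_itv_ge ?measure0// bnd_simp -ltNge.
have /compact_near_coveringP nc : compact (`[x, y]%classic : set R) by exact: segment_compact.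
have := nc _ (0^'+ : set_system R) (fun d z => nu `]z - d, z + d[%classic = 0%E) _.
case=> [z|d /= d0 H].
  rewrite /= in_itv /= => /xy /nsuppP[d d0 nd].
  have d20 : 0 < d / 2 by linarith.
  near=> z' d' => /=.
  have x'x : `|z - z'| < d / 2.
    by near: z'; apply/nbhs_ballP; exists (d / 2) => // ?; rewrite /ball /= distrC.
  have d'd : d' < d / 2 by near: d'; exact: nbhs_right_lt.
  apply/eqP; rewrite -measure_le0 -nd; apply: le_measure; rewrite ?inE.
  - exact: measurable_itv.
  - exact: measurable_itv.
  - by move=> ?; rewrite /= !in_itv /=; move: x'x; rewrite ltr_norml; linarith.
have d20 : 0 < d / 2 by linarith.
have {}H z : x <= z <= y -> nu `]z - d / 2, z + d / 2[%classic = 0%E.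
  move=> zxy; have dd : ball_ Num.Def.normr 0 d (d / 2).
    by rewrite /= sub0r normrN gtr0_norm; linarith.
  by apply: (H _ dd d20); rewrite /= in_itv.
pose J z := fine (nu `[x, z]%classic).
have : J y <= J x.
  apply: (step_nonincr xy' d20) => s t xs st ty std.
  rewrite /J fine_le ?fin_num_measure//; try exact: measurable_itv.
  apply: (@le_trans _ _ (nu (`[x, s]%classic `|` `]s - d / 2, s + d / 2[%classic))).
    apply: le_measure; rewrite ?inE; first exact: measurable_itv.
      by apply: measurableU; exact: measurable_itv.
    move=> u; rewrite /= !in_itv /= => ux; case: (leP u s) => us; [left|right]; linarith.
  rewrite -[leRHS]adde0 -(H s); last by linarith.
  by apply: measureU2; exact: measurable_itv.
have -> : J x = 0 by rewrite /J set_itv1 nu_point.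
move=> J0; rewrite nu_fin; last exact: measurable_itv.
congr EFin; apply/eqP; rewrite eq_le J0 fine_ge0//.
Unshelve. all: by end_near.
Qed.

Lemma ae_le_supp f g : {within I01, continuous f} -> {within I01, continuous g} ->
  {ae nu, forall x, f x <= g x} -> forall x, supp nu x -> f x <= g x.
Proof.
move=> fc gc fg x sx; rewrite leNgt; apply/negP => gf.
have Ix := supp_sub01 sx.
have /cont01P := cont_lin (-1) gc fc.
move=> /(_ x Ix (f x - g x)); rewrite subr_gt0 => /(_ gf)[d d0 H].
have := sx _ (interval_open _ _ : open `]x - d, x + d[%classic) _.
rewrite /= in_itv /= => /(_ isT isT) h.
have xd : x - d < x < x + d by linarith.
have {}h := h xd.
have [N [mN N0 NP]] : {ae nu, forall x, I01 x /\ f x <= g x}.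
  by apply: aeS2 fg ae01_I => z.
move: h; rewrite ltNge -N0 => /negP; apply; apply: le_measure; rewrite ?inE; [exact: measurable_itv|exact: mN|].
move=> z; rewrite /= in_itv /= => zx; apply: NP => -[Iz fgz].
have zxd : `|z - x| < d by rewrite ltr_norml; linarith.
by have := H z Iz zxd; rewrite ltr_norml; linarith.
Qed.

Lemma cont_meas f : {within I01, continuous f} -> meas (f \o clamp).
Proof. by move=> fc; apply: continuous_measurable_fun; exact: cont_clamp. Qed.

Lemma clamp_ae f : f \o clamp = f %[ae nu].
Proof. by apply/ae_eq_iff/ae01 => x Ix /=; rewrite clampE. Qed.

Lemma cont_sqi f : {within I01, continuous f} -> sqi nu (f \o clamp).
Proof.
move=> fc; have [M M0 HM] := bnd01 fc; apply: (sqi_bnd (c := M)); first exact: cont_meas.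
by apply: nearW => x; apply: HM; exact: clamp01.
Qed.

Lemma cont_L2 f : {within I01, continuous f} -> exists v : L2 nu, v = f %[ae nu].
Proof.
move=> fc; have [v vf] := sqi_L2 (cont_sqi fc); exists v; apply/ae_eq_iff.
by apply: aeS2 ((ae_eq_iff _ _ _).1 vf) ((ae_eq_iff _ _ _).1 (clamp_ae f)) => x -> ->.
Qed.

(** The indicator function of the half-line up to [x]. *)
Definition upto (x y : R) : R := (y <= x)%R%:R.

Lemma upto_meas x : meas (upto x).
Proof.
have -> : upto x = \1_(`]-oo, x]%classic : set R).
  apply/funext => y; rewrite /upto indicE; congr (nat_of_bool _)%:R.
  by apply/idP/idP; rewrite inE /= in_itv.
exact: measurable_indic (measurable_itv _).
Qed.

Lemma upto01 x y : 0 <= upto x y <= 1.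
Proof. by rewrite /upto; case: (y <= x); rewrite ?lexx ?ler01. Qed.

Lemma intg_upto w x : intg nu w -> intg nu (fun y => w y * upto x y).
Proof.
move=> iw; apply: (le_intg _ (intg_abs iw)).
  by apply: measurable_funM; [exact: (intg_meas iw)|exact: upto_meas].
apply: nearW => y; rewrite normrM (ger0_norm (_ : 0 <= upto x y)); last by have := upto01 x y; linarith.
by apply: ler_piMr => //; have := upto01 x y; linarith.
Qed.

(** Integrals over an initial segment, as integrals over the whole line. *)
Lemma int_seg w x : intg nu w ->
  (\int[nu]_(y in (`[0%R, x]%classic : set R)) w y)%R =
  mean nu (fun y => w y * upto x y).
Proof.
move=> iw; rewrite Rintegral_mkcond.
have mw := intg_meas iw.
apply: ae_eq_mean.
- apply/(measurable_restrictT w (measurable_itv `[0, x])).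
  exact: measurable_funS mw.
- by apply: measurable_funM => //; exact: upto_meas.
- apply/ae_eq_iff/ae01 => y /I01E Iy; rewrite patchE /upto.
  case: ifPn; rewrite ?inE ?notin_setE /= in_itv /=; case: (leP y x) => /=; rewrite ?mulr1 ?mulr0 //.
    by move=> yx; rewrite andbF.
  by move=> yx; rewrite andbT => /negP; linarith.
Qed.

End measure_on_unit_interval.
Arguments ae01 {R nu} _ [P].
Arguments ae01_I {R nu} _.
Arguments clamp_ae {R nu} _ f.

(** * Gap-linear functions *)

Section gap_linear.
Context {R : realType} (nu : borel_probability R).
Local Notation mR := (measurableTypeR R).
Local Notation I01 := (`[0, 1]%classic : set R).
Local Notation meas f := (@measurable_fun _ _ mR mR [set: mR] f).
Implicit Types f g h w p q : R -> R.
Hypothesis nu_adm : admissible nu.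

(** Continuous functions that are affine on every interval off the support. *)
Definition glin p : Prop := {within I01, continuous p} /\
  forall i : interval R, [set` i] `<=` I01 `\` supp nu ->
    exists k m : R, forall x, x \in i -> p x = k * x + m.

(** The interval with end points [l], [r] is a gap of the support. *)
Definition isgap (l r : R) : Prop :=
  [/\ supp nu l, supp nu r, l < r & forall z, l < z < r -> ~ supp nu z].

Lemma supp0 : supp nu 0. Proof. by case: nu_adm. Qed.
Lemma supp1 : supp nu 1. Proof. by case: nu_adm. Qed.

(** The complement of the support is a union of null intervals with rational
    end points. *)
Lemma ae_supp : {ae nu, forall x, supp nu x}.
Proof.
pose P (n : nat) (x : R) := if (unpickle n : option (rat * rat)) is Some (q1, q2) then
  nu `](ratr q1 : R), ratr q2[%classic = 0%E -> ~ (ratr q1 < x < ratr q2) else True.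
have : {ae nu, forall x, forall n, P n x}.
  apply: ae_all_nat => n; rewrite /P; case: unpickle => [[q1 q2]|]; last exact: nearW.
  have [n0|n0] := pselect (nu `](ratr q1 : R), ratr q2[%classic = 0%E); last first.
    by apply: nearW => x h; case: (n0 h).
  exists `](ratr q1 : R), ratr q2[%classic; split; [exact: measurable_itv|exact: n0|].
  by move=> x /= /not_implyP[_] /contrapT; rewrite in_itv.
apply: aeS => x H; apply: contrapT => /nsuppP[d d0 nd].
have x1 : x - d < x by linarith.
have x2 : x < x + d by linarith.
have [q1] := rat_in_itvoo x1; rewrite in_itv /= => q1x.
have [q2] := rat_in_itvoo x2; rewrite in_itv /= => q2x.
have := H (pickle (q1, q2)); rewrite /P pickleK; apply; last by linarith.
apply/eqP; rewrite -measure_le0 -nd; apply: le_measure; rewrite ?inE.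
- exact: measurable_itv.
- exact: measurable_itv.
- by move=> z; rewrite /= !in_itv /=; linarith.
Qed.

Lemma supp_left x : I01 x -> exists l, [/\ supp nu l, l <= x &
  forall z, l < z <= x -> ~ supp nu z].
Proof.
move=> /I01E Ix; pose A := [set z | supp nu z /\ z <= x].
have A0 : A 0 by split; [exact: supp0|linarith].
have hA : has_sup A by split; [exists 0|exists x => z []].
have Ax : sup A <= x by apply: ge_sup; [exists 0|move=> z []].
exists (sup A); split => //.
- apply: contrapT => /nsupp_open[d d0 H].
  have [z [sz zx] zA] := sup_adherent d0 hA.
  have := ub_le_sup hA.2 (conj sz zx : A z) => zs.
  by apply: (H z) => //; rewrite ltr_norml; linarith.
- by move=> z /andP[z1 z2] sz; have := ub_le_sup hA.2 (conj sz z2 : A z); linarith.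
Qed.

Lemma supp_right x : I01 x -> exists r, [/\ supp nu r, x <= r &
  forall z, x <= z < r -> ~ supp nu z].
Proof.
move=> /I01E Ix; pose A := [set z | supp nu z /\ x <= z].
have A0 : A 1 by split; [exact: supp1|linarith].
have hA : has_inf A by split; [exists 1|exists x => z []].
have Ax : x <= inf A by apply: lb_le_inf; [exists 1|move=> z []].
exists (inf A); split => //.
- apply: contrapT => /nsupp_open[d d0 H].
  have [z [sz zx] zA] := inf_adherent d0 hA.
  have := ge_inf hA.2 (conj sz zx : A z) => zs.
  by apply: (H z) => //; rewrite ltr_norml; linarith.
- by move=> z /andP[z1 z2] sz; have := ge_inf hA.2 (conj sz z1 : A z); linarith.
Qed.

Lemma gap_around x : I01 x -> ~ supp nu x -> exists l r, isgap l r /\ l < x < r.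
Proof.
move=> Ix nx; have [l [sl lx Hl]] := supp_left Ix; have [r [sr xr Hr]] := supp_right Ix.
have {}lx : l < x by rewrite lt_neqAle lx andbT; apply/eqP => lx'; apply: nx; rewrite -lx'.
have {}xr : x < r by rewrite lt_neqAle xr andbT; apply/eqP => xr'; apply: nx; rewrite xr'.
exists l, r; split; last by rewrite lx xr.
split=> //; first exact: lt_trans xr.
move=> z /andP[lz zr]; case: (leP z x) => zx; first by apply: Hl; rewrite lz.
by apply: Hr; rewrite zr ltW.
Qed.

Lemma gap_unique l r l' r' x : isgap l r -> isgap l' r' -> l < x < r -> l' < x < r' ->
  l = l' /\ r = r'.
Proof.
move=> [sl sr lr H] [sl' sr' lr' H'] x1 x2.
have h1 := H l'; have h2 := H r'; have h3 := H' l; have h4 := H' r.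
split.
- case: (ltgtP l l') => // ll.
  + by exfalso; apply: h1 => //; linarith.
  + by exfalso; apply: h3 => //; linarith.
- case: (ltgtP r r') => // ll.
  + by exfalso; apply: h4 => //; linarith.
  + by exfalso; apply: h2 => //; linarith.
Qed.

Lemma gap01 l r x : isgap l r -> l <= x <= r -> I01 x.
Proof.
move=> [/(supp_sub01 nu_adm)/I01E sl /(supp_sub01 nu_adm)/I01E sr lr _] xlr.
by apply/I01E; linarith.
Qed.

Lemma affine_limit p k m l : {within I01, continuous p} -> I01 l ->
  (forall d, 0 < d -> exists2 y, I01 y /\ `|y - l| < d & p y = k * y + m) ->
  p l = k * l + m.
Proof.
move=> pc Il H; apply: contrapT => /eqP; rewrite -subr_eq0 => pl.
have e0 : 0 < `|p l - (k * l + m)| by rewrite normr_gt0.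
have qc := cont_lin (-1) (C1_cont (C1_affine m k)) pc.
move/cont01P: qc => /(_ l Il _ e0)[d d0 {}H'].
have [y [Iy yl] py] := H d d0; have := H' y Iy yl.
have -> : -1 * (m + k * y) + p y - (-1 * (m + k * l) + p l) = - (p l - (k * l + m)).
  by rewrite py; ring.
by rewrite normrN ltxx.
Qed.

Lemma glin_gap p l r : glin p -> isgap l r ->
  exists k m, forall x, l <= x <= r -> p x = k * x + m.
Proof.
move=> [pc Hp] lr; have [sl sr lr' nz] := lr.
have [|k [m km]] := Hp `]l, r[.
  move=> x; rewrite /= in_itv /= => xlr; split; last exact: nz.
  by apply: (gap01 lr); linarith.
exists k, m => x xlr.
have [->|xl] := eqVneq x l.
  apply: (affine_limit pc (supp_sub01 nu_adm _)) => //.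
  move=> d d0; pose y := l + Num.min (d / 2) ((r - l) / 2).
  have y1 : 0 < y - l <= d / 2 /\ y - l <= (r - l) / 2.
    by rewrite /y /Num.min; case: (ltP (d / 2) ((r - l) / 2)) => ?; linarith.
  exists y; last by apply: km; rewrite in_itv /=; linarith.
  by split; [apply: (gap01 lr); linarith|rewrite ger0_norm; linarith].
have [->|xr] := eqVneq x r.
  apply: (affine_limit pc (supp_sub01 nu_adm _)) => //.
  move=> d d0; pose y := r - Num.min (d / 2) ((r - l) / 2).
  have y1 : 0 < r - y <= d / 2 /\ r - y <= (r - l) / 2.
    by rewrite /y /Num.min; case: (ltP (d / 2) ((r - l) / 2)) => ?; linarith.
  exists y; last by apply: km; rewrite in_itv /=; linarith.
  by split; [apply: (gap01 lr); linarith|rewrite ler0_norm; linarith].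
by apply: km; rewrite in_itv /=; apply/andP; rewrite !lt_neqAle eq_sym xl xr; linarith.
Qed.

(** A gap-linear function attains its bounds on the support. *)
Lemma glin_bound p (e : R) : glin p -> (forall x, supp nu x -> `|p x| <= e) ->
  forall x, I01 x -> `|p x| <= e.
Proof.
move=> gp pe x Ix; have [sx|nx] := pselect (supp nu x); first exact: pe.
have [l [r [lr xlr]]] := gap_around Ix nx; have [sl sr lr' _] := lr.
have [k [m km]] := glin_gap gp lr.
have := pe _ sl; have := pe _ sr; rewrite !km; try linarith.
rewrite !ler_norml => h1 h2.
have E1 : (r - l) * (e - (k * x + m)) =
  (r - x) * (e - (k * l + m)) + (x - l) * (e - (k * r + m)) by ring.
have E2 : (r - l) * (e + (k * x + m)) =
  (r - x) * (e + (k * l + m)) + (x - l) * (e + (k * r + m)) by ring.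
have P1 : 0 <= (r - l) * (e - (k * x + m)) by rewrite E1 addr_ge0// mulr_ge0; linarith.
have P2 : 0 <= (r - l) * (e + (k * x + m)) by rewrite E2 addr_ge0// mulr_ge0; linarith.
have rl : 0 < r - l by linarith.
by move: P1 P2; rewrite !pmulr_rge0//; linarith.
Qed.

Lemma glin_ae_bound p (e : R) : glin p -> {ae nu, forall x, `|p x| <= e} ->
  forall x, I01 x -> `|p x| <= e.
Proof.
move=> gp pe; apply: glin_bound => // x sx; rewrite ler_norml.
have h1 := ae_le_supp nu_adm gp.1 (cont_cst e).
have h2 := ae_le_supp nu_adm (cont_cst (- e)) gp.1.
rewrite h1 ?h2//; apply: aeS pe => z; rewrite ler_norml; linarith.
Qed.

Lemma glin_lin a p q : glin p -> glin q -> glin (fun x => a * p x + q x).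
Proof.
move=> [pc Hp] [qc Hq]; split; first exact: cont_lin.
move=> i iS; have [k [m H]] := Hp i iS; have [k' [m' H']] := Hq i iS.
by exists (a * k + k'), (a * m + m') => x xi; rewrite H// H'//; ring.
Qed.

Lemma glin_eq p q : glin p -> glin q -> p = q %[ae nu] -> forall x, I01 x -> p x = q x.
Proof.
move=> gp gq pq x Ix; have := glin_ae_bound (e := 0) (glin_lin (-1) gq gp) _ Ix.
rewrite normr_le0 mulN1r addrC subr_eq0 => H; apply/eqP/H.
by apply: aeS ((ae_eq_iff _ _ _).1 pq) => z ->; rewrite mulN1r addrC subrr normr0.
Qed.

End gap_linear.

(** * Gap-linear representatives *)

Section gap_linear_representatives.
Context {R : realType} (nu : borel_probability R).
Local Notation mR := (measurableTypeR R).
Local Notation I01 := (`[0, 1]%classic : set R).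
Implicit Types f g h w p q : R -> R.
Hypothesis nu_adm : admissible nu.
Local Notation glin := (glin nu).
Local Notation isgap := (isgap nu).

(** The function that agrees with [f] on the support and interpolates [f]
    linearly on each gap. The default value [f x] is used exactly when no gap
    contains [x]. *)
Definition gap_interpolant f (x : R) : R := xget (f x)
  [set v | exists l r, [/\ isgap l r, l < x < r & v = f l + (f r - f l) / (r - l) * (x - l)]].

Lemma gap_interpolant_supp f x : supp nu x -> gap_interpolant f x = f x.
Proof.
move=> sx; rewrite /gap_interpolant; case: xgetP => // v _ [l [r [[_ _ _ H] xlr _]]].
by case: (H x).
Qed.

Lemma gap_interpolantE f l r x : isgap l r -> l <= x <= r ->
  gap_interpolant f x = f l + (f r - f l) / (r - l) * (x - l).
Proof.
move=> lr xlr; have [sl sr lr' _] := lr.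
have rl0 : r - l != 0 by rewrite subr_eq0 gt_eqF.
have [->|xl] := eqVneq x l; first by rewrite gap_interpolant_supp// subrr mulr0 addr0.
have [->|xr] := eqVneq x r; first by rewrite gap_interpolant_supp//; field.
have {}xlr : l < x < r by apply/andP; rewrite !lt_neqAle eq_sym xl xr; linarith.
rewrite /gap_interpolant; case: xgetP => [v _ [l' [r' [lr2 xlr2 ->]]]|/(_ _)/= H].
  by have [<- <-] := gap_unique lr lr2 xlr xlr2.
by exfalso; apply: (H (f l + (f r - f l) / (r - l) * (x - l))); exists l, r.
Qed.

Lemma gap_interpolant_glin f : {within I01, continuous f} -> glin (gap_interpolant f).
Proof.
move=> fc; split; last first.
  move=> i iS; have [[x0 xi]|ni] := pselect (exists x, x \in i); last first.
    by exists 0, 0 => x xi; case: ni; exists x.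
  have [Ix0 nx0] := iS _ xi; have [l [r [lr xlr]]] := gap_around nu_adm Ix0 nx0.
  have [sl sr lr' _] := lr.
  exists ((f r - f l) / (r - l)), (f l - (f r - f l) / (r - l) * l) => x xi'.
  have conv a b z : a \in i -> b \in i -> a <= z <= b -> z \in i.
    by move=> ai bi zab; have := @interval_is_interval R i a b ai bi z zab.
  rewrite (gap_interpolantE f lr); first by ring.
  apply/andP; split; rewrite leNgt; apply/negP => h.
    by have /iS[] : l \in i by apply: (conv x x0) => //; linarith.
  by have /iS[] : r \in i by apply: (conv x0 x) => //; linarith.
apply/cont01P => x0 Ix0 e e0.
have [d d0 Hd] := unif01 fc (divr_gt0 e0 (ltr0n _ 4)).
have [M M0 HM] := bnd01 fc.
pose d' := Num.min d ((e / 4) * d / (2 * M + 1)).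
have d'0 : 0 < d' by rewrite lt_min d0 /= !divr_gt0// ?mulr_gt0// ?divr_gt0//; linarith.
have d'1 : d' <= d by rewrite ge_min lexx.
have d'2 : d' * (2 * M + 1) <= e / 4 * d.
  by rewrite -ler_pdivlMr ?ge_min ?lexx ?orbT//; linarith.
(* within one gap, including its end points *)
have A l r s t : isgap l r -> l <= s <= r -> l <= t <= r -> s <= t -> t - s < d' ->
    `|gap_interpolant f t - gap_interpolant f s| <= e / 4.
  move=> lr sl tl st std; rewrite !(gap_interpolantE f lr)//.
  have [/(supp_sub01 nu_adm) Il /(supp_sub01 nu_adm) Ir lr' _] := lr.
  have rl0 : 0 < r - l by linarith.
  have -> : f l + (f r - f l) / (r - l) * (t - l) - (f l + (f r - f l) / (r - l) * (s - l)) =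
     (f r - f l) * ((t - s) / (r - l)) by field; rewrite gt_eqF.
  rewrite normrM (ger0_norm (_ : 0 <= (t - s) / (r - l))); last by rewrite divr_ge0//; linarith.
  rewrite mulrA ler_pdivrMr//.
  have [rld|rld] := ltP (r - l) d.
    have : `|f r - f l| < e / 4 by apply: Hd => //; rewrite ger0_norm; linarith.
    have := normr_ge0 (f r - f l); move: (`|_|) => k k0 k1.
    by apply: ler_pM; linarith.
  have : `|f r - f l| <= 2 * M.
    by have := ler_normB (f r) (f l); have := HM _ Il; have := HM _ Ir; linarith.
  have := normr_ge0 (f r - f l); move: (`|_|) => k k0 k1.
  apply: (@le_trans _ _ (2 * M * d')); first by apply: ler_pM; linarith.
  by apply: (@le_trans _ _ (e / 4 * d)); [linarith|rewrite ler_pM2l; linarith].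
have B x y : I01 x -> I01 y -> x <= y -> y - x < d' ->
    `|gap_interpolant f y - gap_interpolant f x| < e.
  move=> Ix Iy xy yxd.
  have [r [sr xr Hr]] := supp_right nu_adm Ix; have [l [sl ly Hl]] := supp_left nu_adm Iy.
  have [yr|ry] := ltP y r.
    have nx : ~ supp nu x by apply: Hr; linarith.
    have [l' [r' [lr' xlr]]] := gap_around nu_adm Ix nx; have [sl' sr' l'r' H'] := lr'.
    have yr' : y <= r' by rewrite leNgt; apply/negP => h; apply: (Hr r') => //; linarith.
    by apply: (@le_lt_trans _ _ (e / 4)); [apply: (A l' r') => //; linarith|linarith].
  have rl : r <= l.
    by rewrite leNgt; apply/negP => lr; apply: (Hl r) => //; linarith.
  have h1 : `|gap_interpolant f r - gap_interpolant f x| <= e / 4.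
    have [sx|nx] := pselect (supp nu x).
      have -> : r = x; last by rewrite subrr normr0; linarith.
      by apply/eqP; rewrite eq_le xr andbT leNgt; apply/negP => h; apply: (Hr x) => //; linarith.
    have [l' [r' [lr' xlr]]] := gap_around nu_adm Ix nx; have [sl' sr' l'r' H'] := lr'.
    have r'r : r' = r.
      apply/eqP; rewrite eq_le; apply/andP; split; rewrite leNgt; apply/negP => h.
        by apply: (H' r) => //; linarith.
      by apply: (Hr r') => //; linarith.
    by have := A _ _ _ _ lr'; rewrite r'r; apply; linarith.
  have h2 : `|gap_interpolant f y - gap_interpolant f l| <= e / 4.
    have [sy|ny] := pselect (supp nu y).
      have -> : l = y; last by rewrite subrr normr0; linarith.
      by apply/eqP; rewrite eq_le ly leNgt; apply/negP => h; apply: (Hl y) => //; linarith.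
    have [l' [r' [lr' xlr]]] := gap_around nu_adm Iy ny; have [sl' sr' l'r' H'] := lr'.
    have r'r : l' = l.
      apply/eqP; rewrite eq_le; apply/andP; split; rewrite leNgt; apply/negP => h.
        by apply: (Hl l') => //; linarith.
      by apply: (H' l) => //; linarith.
    by have := A _ _ _ _ lr'; rewrite r'r; apply; linarith.
  have h3 : `|gap_interpolant f l - gap_interpolant f r| < e / 4.
    rewrite !gap_interpolant_supp//; apply: Hd; try exact: (supp_sub01 nu_adm).
    by rewrite ger0_norm; linarith.
  move: (gap_interpolant f) h1 h2 h3 => F h1 h2 h3.
  have -> : F y - F x = (F y - F l) + ((F l - F r) + (F r - F x)) by ring.
  have := ler_normD (F y - F l) ((F l - F r) + (F r - F x)).
  have := ler_normD (F l - F r) (F r - F x); linarith.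
exists d' => // y Iy yx; case: (leP x0 y) => x0y.
  by apply: B => //; move: yx; rewrite ger0_norm; linarith.
rewrite distrC; apply: B => //; first exact: ltW.
by move: yx; rewrite ltr0_norm; linarith.
Qed.

(** Spelling out the boundary conditions of the space of continuous functions. *)
Definition bc0 (b : boundary_condition) p : Prop :=
  if b is Dirichlet then p 0 = 0 /\ p 1 = 0 else True.

(** The chosen gap-linear representative has its defining properties, and it
    inherits the boundary condition, since 0 and 1 are in the support. *)
Lemma gap_linear_repP b (u : R -> R) : Cspace nu b u ->
  [/\ glin (gap_linear_rep nu u), u = gap_linear_rep nu u %[ae nu] &
      bc0 b (gap_linear_rep nu u)].
Proof.
move=> [f [fc uf bf]].
have uf' : u = gap_interpolant f %[ae nu].
  apply/ae_eq_iff; apply: (aeS2 _ ((ae_eq_iff _ _ _).1 uf) (ae_supp nu)) => x -> sx.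
  by rewrite gap_interpolant_supp.
have gf := gap_interpolant_glin fc.
have [] : [set p : R -> R |
    [/\ {within I01, continuous p}, u = p %[ae nu] &
        forall i : interval R, [set` i] `<=` I01 `\` supp nu ->
          exists k m : R, forall x, x \in i -> p x = k * x + m]] (gap_linear_rep nu u).
  by apply: xgetPex; exists (gap_interpolant f); split => //; case: gf.
move=> pc up ga; have gp : glin (gap_linear_rep nu u) by [].
split=> //; rewrite /bc0; case: b bf => // -[f0 f1].
have pf : gap_interpolant f = gap_linear_rep nu u %[ae nu].
  by apply/ae_eq_iff; apply: (aeS2 _ ((ae_eq_iff _ _ _).1 uf') ((ae_eq_iff _ _ _).1 up)) => x <- <-.
rewrite -!(glin_eq nu_adm gf gp pf); try by apply/I01E; linarith.
by rewrite !gap_interpolant_supp//; [exact: supp1|exact: supp0].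
Qed.

(** Gaps are null sets, so the derivative is constant there. *)
Lemma D2_glin f f' (w : L2 nu) : D2 f f' w -> glin f.
Proof.
move=> [Cf fw]; split; first exact: C1_cont Cf.
move=> i iS; have [[x0 xi]|ni] := pselect (exists x, x \in i); last first.
  by exists 0, 0 => x xi; case: ni; exists x.
have iw := sqi_intg (L2_sqi w).
have f'c x y : x \in i -> y \in i -> x < y -> f' x = f' y.
  move=> xi' yi xy; have [Ix _] := iS _ xi'; have [Iy _] := iS _ yi.
  rewrite (fw _ Ix) (fw _ Iy) !int_seg//; congr (_ + _).
  apply: ae_eq_mean.
  - exact: (intg_meas (intg_upto x iw)).
  - exact: (intg_meas (intg_upto y iw)).
  apply/ae_eq_iff; exists `[x, y]%classic; split.
  - exact: measurable_itv.
  - apply: gap_null => // z xzy.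
    by have /iS[] : z \in i by exact: (@interval_is_interval R i x y).
  - move=> z; apply: contra_notP => nz /=; rewrite /upto.
    congr (_ * (nat_of_bool _)%:R); apply/idP/idP => h; first by linarith.
    by rewrite leNgt; apply/negP => xz; apply: nz; rewrite /= in_itv /=; linarith.
exists (f' x0), (f x0 - f' x0 * x0) => x xi'.
have [/I01E Ix0 _] := iS _ xi; have [/I01E Ix _] := iS _ xi'.
have [xx|xx|->] := ltgtP x x0; last by ring.
- have x00 : x0 <= 1 by linarith.
  have x10 : 0 <= x by linarith.
  have [c cx ec] := C1_MVT Cf x10 xx x00.
  have ci : c \in i by apply: (@interval_is_interval R i x x0) => //; linarith.
  have c0 : f' c = f' x0 by apply: f'c => //; linarith.
  by move: ec; rewrite c0 => ec; linarith.
- have x00 : x <= 1 by linarith.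
  have x10 : 0 <= x0 by linarith.
  have [c cx ec] := C1_MVT Cf x10 xx x00.
  have ci : c \in i by apply: (@interval_is_interval R i x0 x) => //; linarith.
  have c0 : f' x0 = f' c by apply: f'c => //; linarith.
  by move: ec; rewrite -c0 => ec; linarith.
Qed.

End gap_linear_representatives.

(** * Dissipativity of the Krein-Feller operators *)

Section energy.
Context {R : realType} (nu : borel_probability R).
Local Notation mR := (measurableTypeR R).
Local Notation I01 := (`[0, 1]%classic : set R).
Implicit Types f g h w p q : R -> R.
Hypothesis nu_adm : admissible nu.

Lemma mean_upto1 w : intg nu w -> mean nu (fun y => w y * upto 1 y) = mean nu w.
Proof.
move=> iw; apply: ae_eq_mean; [exact: (intg_meas (intg_upto 1 iw))|exact: intg_meas iw|].
apply/ae_eq_iff; apply: (ae01 nu_adm) => y /I01E /andP[_ y1].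
by rewrite /upto y1 mulr1.
Qed.

Lemma mean_upto0 w : intg nu w -> mean nu (fun y => w y * upto 0 y) = 0.
Proof.
move=> iw; rewrite -[RHS](mean_cst nu 0).
apply: ae_eq_mean; [exact: (intg_meas (intg_upto 0 iw))|exact: (measurable_cst (0 : R))|].
have n0 : {ae nu, forall y, y != 0}.
  exists [set (0 : R)]; split; [exact: measurable_set1|exact: (nu_point nu_adm)|].
  by move=> y /negP; rewrite negbK => /eqP.
apply/ae_eq_iff; apply: (aeS2 _ n0 (ae01_I nu_adm)) => y y0 /I01E Iy.
by rewrite /upto leNgt lt_neqAle eq_sym y0 (_ : 0 <= y) ?mulr0//; linarith.
Qed.

Lemma D2_mean f f' (w : L2 nu) : D2 f f' w -> forall x, I01 x ->
  f' x = f' 0 + mean nu (fun y => w y * upto x y).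
Proof. by move=> [_ H] x Ix; rewrite H// int_seg//; exact: (sqi_intg (L2_sqi w)). Qed.

(** Green's formula, as an inequality: the Krein-Feller operator is
    dissipative for the truncations at nonnegative levels. *)
Lemma energy_le0 b (u w : L2 nu) k : krein_feller b u w -> 0 <= k ->
  mean nu (fun x => Num.max 0 (u x - k) * w x) <= 0.
Proof.
move=> [f [f' [Df uf bf]]] k0; have [Cf _] := Df.
have fc := C1_cont Cf; have f'c := Cf.1.
pose p x := Num.max 0 (f x - k).
have pE x : [\/ f x <= k /\ p x = 0 | k <= f x /\ p x = f x - k].
  rewrite /p /Num.max; case: ltP => h; first by apply: or_intror; linarith.
  by apply: or_introl; linarith.
have pc : {within I01, continuous p}.
  apply/cont01P => x Ix e e0; have /cont01P /(_ x Ix e e0)[d d0 H] := fc.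
  exists d => // y Iy yx; apply: le_lt_trans (H y Iy yx).
  have := ler_norm (f y - f x); have := ler_norm (- (f y - f x)); rewrite normrN => h1 h2.
  by rewrite ler_norml; case: (pE x) => -[? ->]; case: (pE y) => -[? ->]; linarith.
have sw := L2_sqi w; have iw := sqi_intg sw; have iaw := intg_abs iw.
pose P := p \o clamp; have sP : sqi nu P := cont_sqi nu pc.
have iPw := sqi_intgM sP sw.
have -> : mean nu (fun x => Num.max 0 (u x - k) * w x) = mean nu (fun x => P x * w x).
  apply: ae_eq_mean; [|exact: intg_meas iPw|].
    apply: measurable_funM; last exact: L2_meas.
    by apply: measurable_maxr => //; apply: measurable_funB => //; exact: L2_meas.
  apply/ae_eq_iff; apply: (aeS2 _ ((ae_eq_iff _ _ _).1 uf) (ae01_I nu_adm)) => x -> Ix.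
  by rewrite /P /p /= clampE.
have [M M0 HM] := bnd01 f'c.
have pf' : p 0 * f' 0 = 0 /\ p 1 * f' 1 = 0.
  case: b bf => -[h0 h1]; first by rewrite h0 h1 !mulr0.
  have [-> ->] : p 0 = 0 /\ p 1 = 0; last by rewrite !mul0r.
  by move: (pE 0) (pE 1); rewrite h0 h1 => -[] [? ->] [] [? ->]; linarith.
have main e : 0 < e -> mean nu (fun x => P x * w x) <=
   e * (mean nu (fun x => `|w x|) + (M + 1)).
  move=> e0; have e1 : 0 < Num.min e 1 by rewrite lt_min e0 ltr01.
  have [d1 d10 H1] := C1_unif Cf e1; have [d2 d20 H2] := unif01 pc e0.
  (* by parts, the first two terms of J amount, up to a constant, to the integral
     of - p' f' over [0, x], and p' f' >= 0; the last term absorbs the errors of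
     order e made over short steps *)
  pose J x := mean nu (fun y => P y * w y * upto x y) - p x * f' x -
     e * (mean nu (fun y => `|w y| * upto x y) + (M + 1) * x).
  have : J 1 <= J 0.
    have d0 : 0 < Num.min d1 d2 by rewrite lt_min d10.
    apply: (step_nonincr ler01 d0) => x y x0 xy y1; rewrite lt_min => /andP[xy1 xy2].
    have Ix : I01 x by apply/I01E; linarith.
    have Iy : I01 y by apply/I01E; linarith.
    have key1 : mean nu (fun s => P s * w s * upto y s) - mean nu (fun s => P s * w s * upto x s)
      - p y * (f' y - f' x) <= e * (mean nu (fun s => `|w s| * upto y s) - mean nu (fun s => `|w s| * upto x s)).
      rewrite (D2_mean Df Ix) (D2_mean Df Iy).
      set a := f' 0.
      have -> : mean nu (fun s => P s * w s * upto y s) - mean nu (fun s => P s * w s * upto x s) -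
        p y * (a + mean nu (fun s => w s * upto y s) - (a + mean nu (fun s => w s * upto x s))) =
        mean nu (fun s => P s * w s * upto y s - P s * w s * upto x s -
          p y * (w s * upto y s - w s * upto x s)).
        have i1 := intgB (intg_upto y iPw) (intg_upto x iPw).
        have i2 := intgB (intg_upto y iw) (intg_upto x iw).
        rewrite (meanB i1 (intgZ (p y) i2)) (meanZ (p y) i2).
        rewrite (meanB (intg_upto y iPw) (intg_upto x iPw)).
        by rewrite (meanB (intg_upto y iw) (intg_upto x iw)); ring.
      rewrite -meanB; try exact: intg_upto.
      rewrite -meanZ; last by apply: intgB; exact: intg_upto.
      apply: le_mean.
      - apply: intgB; first by apply: intgB; exact: intg_upto.
        by apply: intgZ; apply: intgB; exact: intg_upto.
      - by apply: intgZ; apply: intgB; exact: intg_upto.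
      apply: (ae01 nu_adm) => s Is; rewrite /upto.
      have [sy|ys] := leP s y; have [sx|xs] := leP s x; rewrite ?mulr1 ?mulr0 ?subrr ?subr0 ?mulr0 ?subrr //.
        rewrite -mulrBl; apply: (le_trans (ler_norm _)); rewrite normrM ler_wpM2r//.
        rewrite /P /= clampE// ltW// distrC; apply: H2 => //.
        by rewrite ger0_norm; linarith.
      by exfalso; linarith.
    have key2 : - (e * (M + 1) * (y - x)) <= f' x * (p y - p x).
      have [->|xy'] := eqVneq x y; first by rewrite !subrr !mulr0 oppr0.
      have {}xy' : 0 < y - x by rewrite subr_gt0 lt_neqAle xy'.
      have := H1 x y Ix Iy; rewrite (gtr0_norm xy') => /(_ xy1).
      have m1 : Num.min e 1 <= e by rewrite ge_min lexx.
      have m2 : Num.min e 1 <= 1 by rewrite ge_min lexx orbT.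
      move: (Num.min e 1) e1 m1 m2 => e' e1 m1 m2.
      have [q1 q2] : `|p y - p x| <= `|f y - f x| /\ 0 <= (p y - p x) * (f y - f x).
        have := ler_norm (f y - f x); have := ler_norm (- (f y - f x)); rewrite normrN => h1 h2.
        split; first by clear -pE h1 h2; rewrite ler_norml; case: (pE x) => -[? ->]; case: (pE y) => -[? ->]; linarith.
        clear -pE; have [h|h] := leP (f x) (f y).
          by apply: mulr_ge0; [|linarith]; case: (pE x) => -[? ->]; case: (pE y) => -[? ->]; linarith.
        by apply: mulr_le0; [|linarith]; case: (pE x) => -[? ->]; case: (pE y) => -[? ->]; linarith.
      move=> q3; have := HM _ Ix; move: (p y - p x) q1 q2 => dp q1 q2 q4.
      have q5 : `|f y - f x| <= (M + 1) * (y - x).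
        have := ler_normD (f y - f x - f' x * (y - x)) (f' x * (y - x)).
        rewrite subrK [X in _ <= _ + X]normrM (gtr0_norm xy').
        have : `|f' x| * (y - x) <= M * (y - x) by rewrite ler_pM2r.
        have : e' * (y - x) <= 1 * (y - x) by rewrite ler_pM2r.
        linarith.
      rewrite -(ler_pM2r xy').
      have q6 : `|dp * (f y - f x - f' x * (y - x))| <= (M + 1) * (y - x) * (e * (y - x)).
        rewrite normrM ler_pM//; first exact: le_trans q5.
        by apply: (le_trans q3); rewrite ler_pM2r.
      by move: q6; rewrite ler_norml; linarith.
    have [pf0 pf1] := pf'.
    clear -key1 key2; rewrite /J; set A1 := mean nu _ in key1 *; set A2 := mean nu _ in key1 *; set B1 := mean nu _ in key1 *; set B2 := mean nu _ in key1 *.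
    have E1 : p y * (f' y - f' x) + f' x * (p y - p x) = p y * f' y - p x * f' x by ring.
    linarith.
  have [pf0 pf1] := pf'.
  rewrite /J !mean_upto1// !mean_upto0// pf0 pf1 mulr0 mulr1; linarith.
have iL : 0 <= mean nu (fun x => `|w x|).
  by apply: mean_ge0; [exact: nearW|exact: intg_meas iaw].
rewrite leNgt; apply/negP => h; set A := mean nu _ in h main; set B := mean nu _ in iL main.
have K0 : 0 < B + (M + 1) by linarith.
have := main (A / (2 * (B + (M + 1)))).
have -> : A / (2 * (B + (M + 1))) * (B + (M + 1)) = A / 2 by field; rewrite gt_eqF.
by rewrite divr_gt0 ?mulr_gt0// => /(_ isT); linarith.
Qed.

End energy.

(** * Second primitives with respect to a measure *)

Section clamped_means.
Context {R : realType} (nu : borel_probability R).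
Local Notation mR := (measurableTypeR R).
Local Notation I01 := (`[0, 1]%classic : set R).
Implicit Types f g h w p q : R -> R.
Hypothesis nu_adm : admissible nu.

(** The integral over [0,1] of a function that is continuous there. *)
Definition cmean h : R := mean nu (h \o clamp).

Lemma cont_intg h : {within I01, continuous h} -> intg nu (h \o clamp).
Proof. by move=> hc; apply: sqi_intg; exact: cont_sqi. Qed.

Lemma cmean_lin a f g : {within I01, continuous f} -> {within I01, continuous g} ->
  cmean (fun x => a * f x + g x) = a * cmean f + cmean g.
Proof.
move=> fc gc; rewrite -(meanZ a (cont_intg fc)) -meanD //; last exact: cont_intg.
exact: (intgZ a (cont_intg fc)).
Qed.

Lemma cmean_cst (c : R) : cmean (fun=> c) = c.
Proof. exact: mean_cst. Qed.

Lemma cmean_eq f g : (forall x, I01 x -> f x = g x) -> cmean f = cmean g.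
Proof.
by move=> fg; congr (Rintegral nu setT _); apply/funext => x /=; apply: fg; exact: clamp01.
Qed.

Lemma cmean_bound f (B : R) : {within I01, continuous f} ->
  {ae nu, forall x, `|f x| <= B} -> `|cmean f| <= B.
Proof.
move=> fc fB; apply: mean_bound; first exact: cont_meas.
by apply: (aeS2 _ fB (ae01_I nu_adm)) => x fx Ix; rewrite /= clampE.
Qed.

(** The indicator function of the interval of radius [d] around [x]. *)
Definition box (x d s : R) : R := (x - d <= s <= x + d)%R%:R.

Lemma box_mean x d : intg nu (box x d) /\ mean nu (box x d) = fine (nu `[x - d, x + d]%classic).
Proof.
have boxE : box x d = \1_(`[x - d, x + d]%classic : set R).
  apply/funext => y; rewrite /box indicE; congr (nat_of_bool _)%:R.
  by apply/idP/idP; rewrite inE /= in_itv.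
have mI : measurable (`[x - d, x + d]%classic : set mR) by exact: measurable_itv.
split.
  apply: (le_intg _ (intg_cst nu 1)); first by rewrite boxE; exact: measurable_indic.
  by apply: nearW => y; rewrite /box; case: (_ && _); rewrite ?normr1 ?normr0.
by rewrite /Rintegral boxE integral_indic// setIT.
Qed.

Lemma box_small x (e : R) : 0 < e -> exists2 d : R, 0 < d & mean nu (box x d) < e.
Proof. by move=> e0; have [d d0 H] := nu_small nu_adm x e0; exists d => //; rewrite (box_mean x d).2. Qed.

(** The positive part of [x - s]. *)
Definition relu (x s : R) : R := Num.max 0 (x - s).

Lemma reluE x s : [\/ x <= s /\ relu x s = 0 | s <= x /\ relu x s = x - s].
Proof.
rewrite /relu /Num.max; case: ltP => h; first by apply: or_intror; linarith.
by apply: or_introl; linarith.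
Qed.

Lemma relu_lip x y s t : `|relu x s - relu y t| <= `|x - y| + `|s - t|.
Proof.
have := ler_norm (x - y); have := ler_norm (- (x - y)).
have := ler_norm (s - t); have := ler_norm (- (s - t)); rewrite !normrN => h1 h2 h3 h4.
by rewrite ler_norml; case: (reluE x s) => -[? ->]; case: (reluE y t) => -[? ->]; linarith.
Qed.

Lemma relu_cont x : {within I01, continuous (relu x)}.
Proof.
apply/cont01P => s Is e e0; exists e => // t It ts.
by apply: (le_lt_trans (relu_lip x x t s)); rewrite subrr normr0 add0r.
Qed.

Lemma relu01 x s : I01 x -> I01 s -> 0 <= relu x s <= 1.
Proof. by move=> /I01E Ix /I01E Is; case: (reluE x s) => -[? ->]; linarith. Qed.

(** The solution of w'' = h with w(0) = w'(0) = 0, the second derivative being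
    taken with respect to [nu]. *)
Definition Qop h (x : R) : R := cmean (fun s => relu x s * h s).

Lemma Qop_cont_integrand h x : {within I01, continuous h} ->
  {within I01, continuous (fun s => relu x s * h s)}.
Proof. by move=> hc; apply: cont_mul => //; exact: relu_cont. Qed.

Lemma Qop_lin a f g x : {within I01, continuous f} -> {within I01, continuous g} ->
  Qop (fun s => a * f s + g s) x = a * Qop f x + Qop g x.
Proof.
move=> fc gc; rewrite -cmean_lin; try exact: Qop_cont_integrand.
by apply: cmean_eq => s _; ring.
Qed.

Lemma Qop_bound f (B : R) x : I01 x -> {within I01, continuous f} ->
  {ae nu, forall s, `|f s| <= B} -> `|Qop f x| <= B.
Proof.
move=> Ix fc fB; apply: cmean_bound; first exact: Qop_cont_integrand.
apply: (aeS2 _ fB (ae01_I nu_adm)) => s fs Is; rewrite normrM.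
have := relu01 Ix Is => r01; rewrite ger0_norm; last by linarith.
by apply: le_trans fs; apply: ler_piMl => //; linarith.
Qed.

Lemma Qop0 f : Qop f 0 = 0.
Proof.
rewrite -[RHS](cmean_cst 0); apply: cmean_eq => s /I01E Is.
by case: (reluE 0 s) => -[? ->]; rewrite ?mul0r// (_ : 0 - s = 0) ?mul0r//; linarith.
Qed.

(** The derivative of the second primitive is the first primitive; it is
    continuous because [nu] has no atoms. *)
Lemma Qop_C1 h : {within I01, continuous h} ->
  C1_with_derivative (Qop h) (fun x => mean nu (fun s => h (clamp s) * upto x s)).
Proof.
move=> hc; have [B B0 HB] := bnd01 hc; have ih := cont_intg hc.
have small (x e : R) : 0 < e -> exists2 d : R, 0 < d & B * mean nu (box x d) < e.
  move=> e0; have B1 : 0 < B + 1 by linarith.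
  have [d d0 H] := box_small x (divr_gt0 e0 B1); exists d => //.
  have b0 : 0 <= mean nu (box x d).
    by apply: mean_ge0; [apply: nearW => y; exact: ler0n|exact: intg_meas (box_mean x d).1].
  by move: H; rewrite ltr_pdivlMr//; linarith.
have bnd (x d : R) (F : R -> R) (c : R) : 0 <= c -> intg nu F ->
    {ae nu, forall s, `|F s| <= B * (c * box x d s)} -> `|mean nu F| <= c * (B * mean nu (box x d)).
  move=> c0 iF HF; apply: (le_trans (normr_mean_le iF)).
  have [ib _] := box_mean x d.
  have ib' := intgZ (B * c) ib.
  have -> : c * (B * mean nu (box x d)) = B * c * mean nu (box x d) by ring.
  rewrite -(meanZ (B * c) ib); apply: le_mean => //; first exact: intg_abs.
  by apply: aeS HF => s; rewrite mulrA.
apply/der01P; split.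
- apply/cont01P => x Ix e e0; have [d d0 H] := small x e e0; exists d => // y Iy yx.
  rewrite -(meanB (intg_upto y ih) (intg_upto x ih)).
  apply: (@le_lt_trans _ _ (1 * (B * mean nu (box x d)))); last by rewrite mul1r.
  apply: bnd => //; first exact: (intgB (intg_upto y ih) (intg_upto x ih)).
  apply: nearW => s; rewrite -mulrBr normrM mul1r ler_pM//; first exact/HB/clamp01.
  move: yx; rewrite ltr_norml => yx; rewrite /upto /box.
  case: (leP s y) => sy; case: (leP s x) => sx; rewrite ?subrr ?normr0 ?ler0n// ?subr0 ?sub0r ?normrN ?normr1.
  + by rewrite (_ : (_ <= s <= _) = true)//; apply/andP; linarith.
  + by rewrite (_ : (_ <= s <= _) = true)//; apply/andP; linarith.
- move=> x Ix e e0; have [d d0 H] := small x e e0; exists d => // y Iy yx yxd.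
  have yx0 : y - x != 0 by rewrite subr_eq0.
  have i1 := cont_intg (Qop_cont_integrand (x := y) hc); have i2 := cont_intg (Qop_cont_integrand (x := x) hc).
  have i3 := intgZ (y - x) (intg_upto x ih).
  have E1 : Qop h y - Qop h x - (y - x) * mean nu (fun s => h (clamp s) * upto x s) =
    mean nu (fun s => relu y (clamp s) * h (clamp s) - relu x (clamp s) * h (clamp s)
      - (y - x) * (h (clamp s) * upto x s)).
    by rewrite (meanB (intgB i1 i2) i3) (meanB i1 i2) (meanZ (y - x) (intg_upto x ih)).
  have -> : (y - x)^-1 * (Qop h y - Qop h x) - mean nu (fun s => h (clamp s) * upto x s) =
    (y - x)^-1 * (Qop h y - Qop h x - (y - x) * mean nu (fun s => h (clamp s) * upto x s)) by field.
  rewrite normrM normfV mulrC ltr_pdivrMr ?normr_gt0// E1 [X in _ < X]mulrC.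
  apply: (@le_lt_trans _ _ (`|y - x| * (B * mean nu (box x d)))); last by rewrite ltr_pM2l ?normr_gt0.
  apply: bnd => //; first exact: (intgB (intgB i1 i2) i3).
  apply: (ae01 nu_adm) => s Is; rewrite clampE//.
  have -> : relu y s * h s - relu x s * h s - (y - x) * (h s * upto x s) =
    h s * (relu y s - relu x s - (y - x) * upto x s) by ring.
  rewrite normrM ler_pM//; first exact: HB.
  have := ler_norm (y - x); have := ler_norm (- (y - x)); rewrite normrN => n1 n2.
  move: yxd; rewrite ltr_norml => yxd; rewrite /upto /box.
  clear -n1 n2 yxd.
  have [xs|sx] := ltP x s; have [ys|sy] := ltP y s.
  + case: (reluE x s) => -[? ->]; last by linarith.
    case: (reluE y s) => -[? ->]; last by linarith.
    by rewrite mulr0 !subrr normr0 mulr_ge0.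
  + case: (reluE x s) => -[? ->]; last by linarith.
    rewrite (_ : (x - d <= s <= x + d) = true); last by apply/andP; linarith.
    by case: (reluE y s) => -[? ->]; rewrite mulr0 mulr1 ler_norml; linarith.
  + case: (reluE y s) => -[? ->]; last by linarith.
    rewrite (_ : (x - d <= s <= x + d) = true); last by apply/andP; linarith.
    by case: (reluE x s) => -[? ->]; rewrite !mulr1 ler_norml; linarith.
  + case: (reluE x s) => -[? ->]; case: (reluE y s) => -[? ->]; rewrite ?mulr1.
    * have -> : 0 - 0 - (y - x) = 0 by linarith.
      by rewrite normr0 mulr_ge0.
    * have -> : y - s - 0 - (y - x) = 0 by linarith.
      by rewrite normr0 mulr_ge0.
    * have -> : 0 - (x - s) - (y - x) = 0 by linarith.
      by rewrite normr0 mulr_ge0.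
    * have -> : y - s - (x - s) - (y - x) = 0 by linarith.
      by rewrite normr0 mulr_ge0.
Qed.

End clamped_means.

(** * The solution operator *)

Section solution_operator.
Context {R : realType} (nu : borel_probability R) (b : boundary_condition).
Local Notation mR := (measurableTypeR R).
Local Notation I01 := (`[0, 1]%classic : set R).
Local Notation gl := (gap_linear_rep nu).
Implicit Types f g h w p q : R -> R.
Hypothesis nu_adm : admissible nu.

(** The constant to subtract from [h] so that the Neumann problem with
    right-hand side [h] becomes solvable. *)
Definition mshift h : R := if b is Neumann then cmean nu h else 0.
(** The derivative at 0 of the solution: zero under the Neumann condition; under
    the Dirichlet condition, the value that makes a solution vanishing at 0 vanish
    at 1 as well. *)
Definition slope h : R := if b is Dirichlet then - Qop nu h 1 else 0.

(** The solution with value [a] at 0 of the boundary value problem with right-hand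
    side [h - mshift h]. The Dirichlet condition requires [a = 0]. *)
Definition Vop (a : R) h (x : R) : R :=
  a + slope h * x + Qop nu (fun s => h s - mshift h) x.

Lemma cont_sub f g : {within I01, continuous f} -> {within I01, continuous g} ->
  {within I01, continuous (fun x => f x - g x)}.
Proof. by move=> fc gc; apply: cont_eq (cont_lin (-1) gc fc) => x _; ring. Qed.

Lemma cont_shift f (c : R) : {within I01, continuous f} ->
  {within I01, continuous (fun x => f x - c)}.
Proof. by move=> fc; apply: cont_sub => //; exact: cont_cst. Qed.

Lemma mshift_lin c f g : {within I01, continuous f} -> {within I01, continuous g} ->
  mshift (fun s => c * f s + g s) = c * mshift f + mshift g.
Proof.
by move=> fc gc; rewrite /mshift; case: b; [exact: cmean_lin|rewrite mulr0 addr0].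
Qed.

Lemma slope_lin c f g : {within I01, continuous f} -> {within I01, continuous g} ->
  slope (fun s => c * f s + g s) = c * slope f + slope g.
Proof.
move=> fc gc; rewrite /slope; case: b; first by rewrite mulr0 addr0.
by rewrite Qop_lin//; ring.
Qed.

Lemma Vop_lin c a a' f g x : {within I01, continuous f} -> {within I01, continuous g} ->
  Vop (c * a + a') (fun s => c * f s + g s) x = c * Vop a f x + Vop a' g x.
Proof.
move=> fc gc; rewrite /Vop slope_lin// mshift_lin//.
have -> : (fun s => c * f s + g s - (c * mshift f + mshift g)) =
  (fun s => c * (f s - mshift f) + (g s - mshift g)) by apply/funext => s; ring.
rewrite (Qop_lin nu c x (cont_shift (c := mshift f) fc) (cont_shift (c := mshift g) gc)).
by move: (Qop nu _ x) (Qop nu _ x) => p q; ring.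
Qed.

Lemma Vop_bound (A B a : R) h x : I01 x -> {within I01, continuous h} ->
  `|a| <= A -> {ae nu, forall s, `|h s| <= B} -> `|Vop a h x| <= A + 3 * B.
Proof.
move=> Ix hc aA hB; have I1 : I01 1 by apply/I01E; rewrite ler01 lexx.
have Q1 := Qop_bound nu_adm I1 hc hB; have m1 := cmean_bound nu_adm hc hB.
have B0 : 0 <= B by apply: le_trans m1.
have m2 : `|mshift h| <= B by clear -m1 B0; rewrite /mshift; case: b; rewrite ?normr0.
have s2 : `|slope h| <= B by rewrite /slope; case: b; rewrite ?normr0 ?normrN.
have hB' : {ae nu, forall s, `|h s - mshift h| <= 2 * B}.
  by apply: aeS hB => s hs; have := ler_normB (h s) (mshift h); linarith.
have := Qop_bound nu_adm Ix (cont_shift (c := mshift h) hc) hB'.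
rewrite /Vop; have := ler_normD (a + slope h * x) (Qop nu (fun s => h s - mshift h) x).
have := ler_normD a (slope h * x); have : `|slope h * x| <= B.
  rewrite normrM; move/I01E: Ix => Ix; rewrite (ger0_norm (_ : 0 <= x)); last by linarith.
  by apply: le_trans s2; apply: ler_piMr => //; linarith.
linarith.
Qed.

Lemma Vop0 a h : Vop a h 0 = a.
Proof. by rewrite /Vop mulr0 Qop0 !addr0. Qed.

Lemma Vop_C1 a h : {within I01, continuous h} -> C1_with_derivative (Vop a h)
  (fun x => slope h + mean nu (fun s => (h (clamp s) - mshift h) * upto x s)).
Proof.
move=> hc; have := C1_lin 1 (C1_affine a (slope h)) (Qop_C1 nu_adm (cont_shift (c := mshift h) hc)).
by apply: C1_ext => x _; rewrite /Vop mul1r.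
Qed.

Lemma Vop_cont a h : {within I01, continuous h} -> {within I01, continuous (Vop a h)}.
Proof. by move=> /(Vop_C1 a)/C1_cont. Qed.

Lemma krein_feller_Vop a h (u w : L2 nu) : {within I01, continuous h} ->
  (b = Dirichlet -> a = 0) -> u = Vop a h %[ae nu] ->
  w = (fun s => h s - mshift h) %[ae nu] -> krein_feller b u w.
Proof.
move=> hc a0 uV wh; have iw := sqi_intg (L2_sqi w).
have ih := cont_intg nu (cont_shift (c := mshift h) hc).
have seg x : mean nu (fun y => w y * upto x y) =
    mean nu (fun s => (h (clamp s) - mshift h) * upto x s).
  apply: ae_eq_mean; [exact: intg_meas (intg_upto x iw)|exact: (intg_meas (intg_upto x ih))|].
  apply/ae_eq_iff; apply: (aeS2 _ ((ae_eq_iff _ _ _).1 wh) (ae01_I nu_adm)) => s -> Is.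
  by rewrite clampE.
exists (Vop a h), (fun x => slope h + mean nu (fun s => (h (clamp s) - mshift h) * upto x s)).
have z0 : mean nu (fun s => (h (clamp s) - mshift h) * upto 0 s) = 0.
  exact: (mean_upto0 nu_adm ih).
split=> //.
  split; first exact: Vop_C1.
  by move=> x Ix; rewrite z0 addr0 int_seg// seg.
have bE : b = Neumann \/ b = Dirichlet by case: b; [left|right].
rewrite /Vop /slope /mshift in z0 *; case: b a0 z0 => a0 z0.
  split; rewrite ?z0 ?addr0//.
  rewrite add0r (_ : mean nu _ = cmean nu (fun s => h s - cmean nu h)); last first.
    exact: (mean_upto1 nu_adm (cont_intg nu (cont_shift (c := cmean nu h) hc))).
  rewrite (_ : (fun s => _) = (fun s => (-1) * (fun=> cmean nu h) s + h s)); last first.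
    by apply/funext => s /=; ring.
  by rewrite (cmean_lin nu) ?cmean_cst//; [ring|exact: cont_cst].
rewrite a0// mulr0 Qop0 !addr0; split=> //.
have -> : (fun s => h s - 0) = h by apply/funext => s; rewrite subr0.
by rewrite add0r mulr1 addNr.
Qed.

Lemma krein_feller_Cspace (u w : L2 nu) : krein_feller b u w -> Cspace nu b u.
Proof.
move=> [f [f' [[Cf Df] uf bf]]]; exists f; split => //; first exact: C1_cont Cf.
by case: b bf.
Qed.

Lemma krein_feller_gl (u w : L2 nu) : krein_feller b u w -> exists f', D2 (gl u) f' w /\
  match b with Neumann => f' 0 = 0 /\ f' 1 = 0 | Dirichlet => gl u 0 = 0 /\ gl u 1 = 0 end.
Proof.
move=> kf; have [gg ug _] := gap_linear_repP nu_adm (krein_feller_Cspace kf).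
move: kf => [f [f' [Df uf bf]]].
have gf := D2_glin nu_adm Df.
have fg : forall x, I01 x -> f x = gl u x.
  apply: (glin_eq nu_adm gf gg); apply/ae_eq_iff.
  by apply: (aeS2 _ ((ae_eq_iff _ _ _).1 uf) ((ae_eq_iff _ _ _).1 ug)) => x <- <-.
exists f'; split.
  by case: Df => Cf Df; split => //; apply: C1_ext Cf.
have I0 : I01 0 by apply/I01E; rewrite ler01 lexx.
have I1 : I01 1 by apply/I01E; rewrite ler01 lexx.
by case: b bf => // -[]; rewrite !fg.
Qed.

(** Conversely, [Vop] recovers an element of the domain from its image and its
    value at 0. *)
Lemma Vop_unique (u w : L2 nu) h : krein_feller b u w -> {within I01, continuous h} ->
  w = h %[ae nu] -> mshift h = 0 /\ forall x, I01 x -> gl u x = Vop (gl u 0) h x.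
Proof.
move=> kf hc wh; have [f' [Df bf]] := krein_feller_gl kf.
have I0 : I01 0 by apply/I01E; rewrite ler01 lexx.
have I1 : I01 1 by apply/I01E; rewrite ler01 lexx.
have iw := sqi_intg (L2_sqi w).
have ih := cont_intg nu hc.
have f'E x : I01 x -> f' x = f' 0 + mean nu (fun s => h (clamp s) * upto x s).
  move=> Ix; rewrite (D2_mean nu_adm Df Ix); congr (_ + _).
  apply: ae_eq_mean; [exact: intg_meas (intg_upto x iw)|exact: (intg_meas (intg_upto x ih))|].
  apply/ae_eq_iff; apply: (aeS2 _ ((ae_eq_iff _ _ _).1 wh) (ae01_I nu_adm)) => s -> Is.
  by rewrite clampE.
have m0 : mshift h = 0.
  rewrite /mshift; case: b bf => // -[f0 f1].
  by have := f'E 1 I1; rewrite (mean_upto1 nu_adm ih) f0 f1 add0r.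
split=> //; have [Cf _] := Df.
have CV := Vop_C1 (gl u 0) hc.
(* both sides have second derivative h, so that they differ by an affine map *)
pose k := f' 0 - slope h.
have H : forall x, I01 x -> gl u x = Vop (gl u 0) h x + k * x.
  have C2 := C1_lin 1 CV (C1_affine 0 k).
  have C3 : C1_with_derivative (fun x => Vop (gl u 0) h x + k * x) f'.
    apply: C1_ext C2 => x Ix; first by rewrite mul1r add0r.
    rewrite f'E// mul1r /k m0 (_ : (fun s => (h (clamp s) - 0) * _) = (fun s => h (clamp s) * upto x s)).
      by ring.
    by apply/funext => s; rewrite subr0.
  by apply: (C1_eq Cf C3); rewrite mulr0 addr0 Vop0.
have k0 : k = 0.
  rewrite /k; have := H 1 I1; rewrite /Vop /k m0.
  have -> : (fun s => h s - 0) = h by apply/funext => s; rewrite subr0.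
  rewrite /slope; case: b bf => -[-> h1]; first by rewrite subr0.
  by rewrite h1; linarith.
by move=> x Ix; rewrite H// k0 mul0r addr0.
Qed.

End solution_operator.

(** * Density of the domain in the space of continuous functions *)

Section density.
Context {R : realType} (nu : borel_probability R).
Local Notation mR := (measurableTypeR R).
Local Notation I01 := (`[0, 1]%classic : set R).
Implicit Types f g h w p q : R -> R.
Hypothesis nu_adm : admissible nu.

Lemma cont_id : {within I01, continuous (fun x : R => x)}.
Proof. by apply/cont01P => x Ix e e0; exists e. Qed.

(** An approximate point mass at a point [y] of the support. *)
Lemma bump_exists (y r : R) : supp nu y -> 0 < r -> exists phi : R -> R,
  [/\ {within I01, continuous phi}, phi 0 = 0, phi 1 = 0, cmean nu phi = 1 &
      forall x, I01 x -> `|Qop nu phi x - relu x y| <= r].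
Proof.
move=> sy r0; (* the factor z (1 - z) makes the bump vanish at 0 and 1 and, as these points
   have measure zero, does not affect the positivity of its integral *)
pose B (z : R) : R := Num.max 0 (r - `|z - y|) * (z * (1 - z)).
have mE z : [\/ r <= `|z - y| /\ Num.max 0 (r - `|z - y|) = 0 |
    `|z - y| < r /\ Num.max 0 (r - `|z - y|) = r - `|z - y|].
  rewrite /Num.max; case: ltP => h; first by apply: or_intror; linarith.
  by apply: or_introl; linarith.
have Bc : {within I01, continuous B}.
  apply: cont_mul; last first.
    by apply: cont_mul; [exact: cont_id|apply: cont_sub; [exact: cont_cst|exact: cont_id]].
  apply/cont01P => x Ix e e0; exists e => // z Iz zx; apply: le_lt_trans zx.
  have : `| `|z - y| - `|x - y| | <= `|z - x|.
    by apply: (le_trans (ler_dist_dist _ _)); rewrite opprB addrA subrK.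
  clear -mE; rewrite !ler_norml.
  by case: (mE x) => -[? ->]; case: (mE z) => -[? ->]; linarith.
have B0 z : I01 z -> 0 <= B z.
  move=> /I01E Iz; rewrite /B; apply: mulr_ge0; last by apply: mulr_ge0; linarith.
  by rewrite le_max lexx.
have c0 : 0 < cmean nu B.
  rewrite ltNge; apply/negP => h.
  have iB := cont_intg nu Bc.
  have B0' : {ae nu, forall x, 0 <= (B \o clamp) x} by apply: nearW => x; apply: B0; exact: clamp01.
  have [N [mN N0 NP]] : {ae nu, forall x, x != 0 /\ x != 1 /\ I01 x /\ B x = 0}.
    have n0 (a : R) : {ae nu, forall y, y != a}.
      exists [set a]; split; [exact: measurable_set1|exact: (nu_point nu_adm)|].
      by move=> z /negP; rewrite negbK => /eqP.
    apply: (aeS2 _ (n0 0)); last first.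
      apply: (aeS2 _ (n0 1)); last first.
        by apply: (aeS2 _ (mean_le0_eq0 iB B0' h) (ae01_I nu_adm)) => x H1 H2; exact: (conj H1 H2).
      by move=> x H1 H2; exact: (conj H1 H2).
    by move=> x x0 [x1 [Bx Ix]]; split => //; split => //; split => //; move: Bx; rewrite /= clampE.
  have := sy _ (interval_open _ _ : open `]y - r, y + r[%classic) _.
  rewrite /= in_itv /= => /(_ isT isT) H.
  have yr : y - r < y < y + r by linarith.
  have := H yr; rewrite ltNge -N0 => /negP; apply.
  apply: le_measure; rewrite ?inE; [exact: measurable_itv|exact: mN|].
  move=> z; rewrite /= in_itv /= => zr; apply: NP => -[z0 [z1 [/I01E Iz Bz]]].
  have z01 : 0 < z < 1 by apply/andP; rewrite !lt_neqAle eq_sym z0 z1; linarith.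
  have zyr : `|z - y| < r by rewrite ltr_norml; linarith.
  suff : 0 < B z by rewrite Bz ltxx.
  rewrite /B; apply: mulr_gt0; last by apply: mulr_gt0; linarith.
  by case: (mE z) => -[? ->]; linarith.
pose phi (z : R) : R := (cmean nu B)^-1 * B z; exists phi.
have pc : {within I01, continuous phi}.
  by apply: cont_mul => //; exact: cont_cst.
have p1 : cmean nu phi = 1.
  have := cmean_lin nu (cmean nu B)^-1 Bc (cont_cst 0).
  rewrite cmean_cst addr0 mulVf ?gt_eqF// => <-.
  by apply: cmean_eq => x _; rewrite addr0.
split=> //.
- by rewrite /phi /B mul0r !mulr0.
- by rewrite /phi /B subrr !mulr0.
- move=> x Ix.
  have rc := Qop_cont_integrand (x := x) pc.
  have -> : Qop nu phi x - relu x y = cmean nu (fun s => - relu x y * phi s + relu x s * phi s).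
    by rewrite (cmean_lin nu (- relu x y) pc rc) p1 mulr1 addrC.
  have qc := cont_lin (- relu x y) pc rc.
  apply: (le_trans (normr_mean_le (cont_intg nu qc))).
  rewrite -[leRHS]mulr1 -p1 -(meanZ r (cont_intg nu pc)); apply: le_mean.
  + exact: (intg_abs (cont_intg nu qc)).
  + exact: (intgZ r (cont_intg nu pc)).
  apply: (ae01 nu_adm) => s Is /=; rewrite clampE//.
  have p0 : 0 <= phi s by rewrite /phi mulr_ge0 ?invr_ge0 ?(ltW c0)//; exact: B0.
  have -> : - relu x y * phi s + relu x s * phi s = (relu x s - relu x y) * phi s by ring.
  rewrite normrM (ger0_norm p0); have [rs|sr] := leP r `|s - y|.
    rewrite (_ : phi s = 0) ?mulr0// /phi /B; case: (mE s) => -[? ->]; first by rewrite mul0r mulr0.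
    by linarith.
  apply: ler_wpM2r => //; apply: (le_trans (relu_lip x x s y)).
  by rewrite subrr normr0 add0r ltW.
Qed.

(** [reach f e a]: on [0, a] the function [f] is within [e] of the solution of a
    Neumann problem with a continuous right-hand side that vanishes at 0 and 1,
    up to an error as small as we please; on [a, 1] this solution is nearly constant. *)
Definition reach f (e a : R) : Prop := forall eta : R, 0 < eta -> exists w : R -> R,
  [/\ {within I01, continuous w} /\ cmean nu w = 0, w 0 = 0, w 1 = 0,
      (forall x, I01 x -> x <= a -> `|f 0 + Qop nu w x - f x| <= e + eta) &
      (forall x, I01 x -> a <= x -> `|f 0 + Qop nu w x - f a| <= eta)].

Lemma reach0 f (e : R) : 0 <= e -> reach f e 0.
Proof.
move=> e0 eta eta0; exists (fun=> 0).
have Q0 x : Qop nu (fun=> 0) x = 0.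
  by rewrite -[RHS](cmean_cst nu 0); apply: cmean_eq => s _; rewrite mulr0.
split=> //; first by split; [exact: cont_cst|exact: cmean_cst].
- move=> x /I01E Ix x0; have -> : x = 0 by linarith.
  by rewrite Q0 addr0 subrr normr0; linarith.
- by move=> x Ix x0; rewrite Q0 addr0 subrr normr0; linarith.
Qed.

(** Two bumps of opposite signs, at [a] and [s], contribute almost nothing before
    [a], a constant slope between [a] and [s], and a constant after [s]. *)
Lemma reach_step f (e a s : R) : supp nu a -> supp nu s -> a < s -> reach f e a ->
  (forall x, a <= x <= s -> `|f x - (f a + (f s - f a) / (s - a) * (x - a))| <= e) ->
  reach f e s.
Proof.
move=> sa ss as_ ra fe eta eta0.
have Ia := supp_sub01 nu_adm sa; have Is := supp_sub01 nu_adm ss.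
set d := (f s - f a) / (s - a) in fe.
have dE : d * (s - a) = f s - f a by rewrite /d; field; rewrite subr_eq0 gt_eqF.
have d1 : 0 < `|d| + 1 by have := normr_ge0 d; linarith.
pose r := eta / 4 / (`|d| + 1).
have r0 : 0 < r by rewrite !divr_gt0//; linarith.
have rd : `|d| * r <= eta / 4.
  have : r * (`|d| + 1) = eta / 4 by rewrite /r; field; rewrite gt_eqF.
  by linarith.
have [phi [pc p0 p1 pm pQ]] := bump_exists sa r0.
have [psi [qc q0 q1 qm qQ]] := bump_exists ss r0.
have eta2 : 0 < eta / 2 by linarith.
have [w [[wc wm] w0 w1 wQ1 wQ2]] := ra _ eta2.
have c1 := cont_lin d pc wc; have c2 := cont_lin (- d) qc c1.
exists (fun x => - d * psi x + (d * phi x + w x)).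
have QE x : Qop nu (fun x => - d * psi x + (d * phi x + w x)) x =
    - d * Qop nu psi x + (d * Qop nu phi x + Qop nu w x).
  by rewrite (Qop_lin nu (- d) x qc c1) (Qop_lin nu d x pc wc).
have key x : I01 x -> `|- d * Qop nu psi x + d * Qop nu phi x - d * (relu x a - relu x s)| <= eta / 2.
  move=> Ix; have := pQ x Ix; have := qQ x Ix; set P := Qop nu phi x; set Q := Qop nu psi x => h1 h2.
  have -> : - d * Q + d * P - d * (relu x a - relu x s) = d * ((P - relu x a) - (Q - relu x s)) by ring.
  rewrite normrM; have h3 := ler_normB (P - relu x a) (Q - relu x s).
  apply: (@le_trans _ _ (`|d| * (2 * r))); last by linarith.
  by apply: ler_wpM2l => //; linarith.
split.
- split; first exact: c2.
  by rewrite (cmean_lin nu (- d) qc c1) (cmean_lin nu d pc wc) qm pm wm; ring.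
- by rewrite p0 q0 w0; ring.
- by rewrite p1 q1 w1; ring.
- move=> x Ix xs; rewrite QE; have := key x Ix.
  have [xa|ax] := leP x a.
    have := wQ1 x Ix xa; set P := Qop nu phi x; set Q := Qop nu psi x; set W := Qop nu w x.
    case: (reluE x a) => -[? ->]; case: (reluE x s) => -[? ->]; rewrite !ler_norml; try linarith.
    have -> : x = a by linarith.
    by rewrite subrr; linarith.
  have := wQ2 x Ix (ltW ax); have axs : a <= x <= s by rewrite (ltW ax).
  have := fe x axs; set P := Qop nu phi x; set Q := Qop nu psi x; set W := Qop nu w x.
  case: (reluE x a) => -[? ->]; first by linarith.
  case: (reluE x s) => -[? ->]; rewrite !ler_norml; first by linarith.
  have -> : x = s by linarith.
  by rewrite subrr; linarith.
- move=> x Ix sx; rewrite QE; have := key x Ix.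
  have ax : a <= x by linarith.
  have := wQ2 x Ix ax; set P := Qop nu phi x; set Q := Qop nu psi x; set W := Qop nu w x.
  case: (reluE x a) => -[? ->]; first by linarith.
  case: (reluE x s) => -[? ->]; rewrite !ler_norml; last by linarith.
  have -> : x = s by linarith.
  by linarith.
Qed.

(** The nodes advance by steps of two kinds: short steps, on which [f] oscillates
    little, and gaps of the support, on which [f] is affine. *)
Lemma reach1 f (e : R) : glin nu f -> 0 < e -> reach f e 1.
Proof.
move=> gf e0; have [fc _] := gf.
have e2 : 0 < e / 2 by linarith.
have [d d0 Hd] := unif01 fc e2.
pose d' := d / 2; have d'0 : 0 < d' by rewrite /d'; linarith.
have fine_step a s : supp nu a -> supp nu s -> a < s -> s - a < d -> reach f e a -> reach f e s.
  move=> sa ss as_ asd ra; apply: (reach_step sa ss as_ ra) => x axs.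
  have Ia := supp_sub01 nu_adm sa; have Is := supp_sub01 nu_adm ss.
  have Ix : I01 x by move/I01E: Ia => ?; move/I01E: Is => ?; apply/I01E; linarith.
  have h1 : `|f x - f a| < e / 2 by apply: Hd => //; rewrite ger0_norm; linarith.
  have h2 : `|f s - f a| < e / 2 by apply: Hd => //; rewrite ger0_norm; linarith.
  have sa0 : 0 < s - a by linarith.
  have h3 : `|(f s - f a) / (s - a) * (x - a)| <= e / 2.
    rewrite -mulrA normrM -[leRHS]mulr1; apply: ler_pM => //; first exact: ltW.
    have xa0 : 0 <= (s - a)^-1 * (x - a) by rewrite mulr_ge0 ?invr_ge0//; linarith.
    by rewrite ger0_norm// mulrC ler_pdivrMr//; linarith.
  have := ler_normB (f x - f a) ((f s - f a) / (s - a) * (x - a)).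
  by rewrite opprD addrA; linarith.
have claim (n : nat) : exists a, [/\ supp nu a, reach f e a & a = 1 \/ n%:R * d' <= a].
  elim: n => [|n [a [sa ra ha]]].
    exists 0; split; [exact: supp0 nu_adm|exact: reach0 (ltW e0)|right].
    by rewrite mul0r.
  case: ha => [a1|na]; first by exists a; split => //; left.
  have /I01E Ia := supp_sub01 nu_adm sa.
  have [a1|a1] := eqVneq a 1; first by exists a; split => //; left.
  have {}a1 : a < 1 by rewrite lt_neqAle a1; linarith.
  have [ad|ad] := leP 1 (a + d').
    exists 1; split; [exact: supp1 nu_adm| |by left].
    by apply: (fine_step a 1) => //; [exact: supp1|rewrite /d' in ad; linarith].
  (* go to the last point s of the support before a + d', then across the gap, if
     any, to the first point s' after it *)
  have Iy : I01 (a + d') by apply/I01E; linarith.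
  have [s [ss sy Hs]] := supp_left nu_adm Iy; have [s' [ss' ys' Hs']] := supp_right nu_adm Iy.
  have as_ : a <= s by rewrite leNgt; apply/negP => h; apply: (Hs a) => //; linarith.
  have rs : reach f e s.
    have [<-//|as'] := eqVneq a s; apply: (fine_step a s) => //.
      by rewrite lt_neqAle as'.
    by rewrite /d' in sy; linarith.
  have nd : n.+1%:R * d' <= a + d' by rewrite -natr1 mulrDl mul1r lerD2r.
  have [ss'E|ss'E] := eqVneq s s'.
    by exists s; split => //; right; linarith.
  have {}ss'E : s < s' by rewrite lt_neqAle ss'E; linarith.
  exists s'; split => //; last by right; linarith.
  apply: (reach_step ss ss' ss'E rs) => x xss'.
  have gs : isgap nu s s'.
    split => // z zss'; have [zy|yz] := leP z (a + d'); first by apply: Hs; linarith.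
    by apply: Hs'; linarith.
  have [k [m km]] := glin_gap nu_adm gf gs.
  rewrite !km; try linarith.
  rewrite (_ : _ - _ = 0) ?normr0; first exact: ltW.
  by field; rewrite subr_eq0 gt_eqF.
have [a [sa ra]] := claim (Num.bound (d'^-1)).
case=> [<- //|h]; have /I01E Ia := supp_sub01 nu_adm sa.
have := archi_boundP (ltW (etrans (invr_gt0 d') d'0)).
rewrite -(ltr_pM2r d'0) mulVf ?gt_eqF//; linarith.
Qed.

(** A gap-linear function is uniformly close to an element of the domain whose
    image is continuous and vanishes at 0 and 1. *)
Lemma density_step b f (e : R) : glin nu f -> bc0 b f -> 0 < e -> exists w : R -> R,
  [/\ {within I01, continuous w}, w 0 = 0, w 1 = 0, mshift nu b w = 0 &
      forall x, I01 x -> `|Vop nu b (f 0) w x - f x| <= e].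
Proof.
move=> gf bf e0; have e4 : 0 < e / 4 by linarith.
have [w [[wc wm] w0 w1 wQ _]] := reach1 gf e4 e4.
have m0 : mshift nu b w = 0 by rewrite /mshift; case: b {bf}.
exists w; split=> // x Ix; rewrite /Vop m0.
have -> : (fun s => w s - 0) = w by apply/funext => s; rewrite subr0.
have I1 : I01 1 by apply/I01E; rewrite ler01 lexx.
have /I01E Ix' := Ix; have x1 : x <= 1 by linarith.
have := wQ x Ix x1; have := wQ 1 I1 (lexx 1).
rewrite /slope /bc0 in bf *; case: b bf {m0} => [_ _|[-> ->]].
  by rewrite mul0r addr0; linarith.
rewrite subr0 !add0r => h1 h2.
have : `|Qop nu w 1 * x| <= e / 4 + e / 4.
  rewrite normrM (ger0_norm (_ : 0 <= x)); last by linarith.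
  by apply: le_trans h1; apply: ler_piMr.
have -> : - Qop nu w 1 * x + Qop nu w x - f x = (Qop nu w x - f x) - Qop nu w 1 * x by ring.
have := ler_normB (Qop nu w x - f x) (Qop nu w 1 * x); linarith.
Qed.

End density.

(** * Differentiable curves in L2 *)

Section curves.
Context d (X : measurableType d) {R : realType} (nu : probability X R).
Implicit Types (f g : X -> R) (e v : R -> X -> R) (tau : R).

Lemma sq_mean_lin (a : R) f g : sqi nu f -> sqi nu g ->
  mean nu (fun x => (a * f x + g x) ^+ 2) <=
  2 * a ^+ 2 * mean nu (fun x => f x ^+ 2) + 2 * mean nu (fun x => g x ^+ 2).
Proof.
move=> sf sg; have i1 := sqi_sq sf; have i2 := sqi_sq sg.
rewrite -(meanZ (2 * a ^+ 2) i1) -(meanZ 2 i2) -(meanD (intgZ _ i1) (intgZ _ i2)).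
apply: le_mean; first exact: (sqi_sq (sqiD (sqiZ a sf) sg)).
  exact: (intgD (intgZ _ i1) (intgZ _ i2)).
apply: nearW => x; have := sqr_ge0 (a * f x - g x); linarith.
Qed.

(** A curve in L2 that is bounded on [0, tau]. *)
Definition L2curve tau e : Prop := exists B : R, forall t : R, 0 <= t <= tau ->
  sqi nu (e t) /\ mean nu (fun x => e t x ^+ 2) <= B.

(** The curve [e] has the right derivative [v] in L2 on [0, tau], uniformly. *)
Definition L2deriv tau e v : Prop := forall eps : R, 0 < eps -> exists2 dl : R, 0 < dl &
  forall t h : R, 0 <= t -> 0 < h < dl -> t + h <= tau ->
    mean nu (fun x => (e (t + h) x - e t x - h * v t x) ^+ 2) <= eps * h ^+ 2.

Lemma L2curve_lin tau (a : R) e v : L2curve tau e -> L2curve tau v ->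
  L2curve tau (fun t x => a * e t x + v t x).
Proof.
move=> [B HB] [C HC]; exists (2 * a ^+ 2 * B + 2 * C) => t tt.
have [se eB] := HB t tt; have [sv vC] := HC t tt.
split; first exact: sqiD (sqiZ a se) sv.
apply: (le_trans (sq_mean_lin a se sv)); rewrite lerD// ler_wpM2l//.
by rewrite mulr_ge0// sqr_ge0.
Qed.

Lemma L2curve_cst tau f : sqi nu f -> L2curve tau (fun=> f).
Proof. by move=> sf; exists (mean nu (fun x => f x ^+ 2)). Qed.

Lemma L2curve_bounded tau e (B : R) : (forall t, 0 <= t <= tau -> measurable_fun setT (e t)) ->
  (forall t, 0 <= t <= tau -> {ae nu, forall x, `|e t x| <= B}) -> L2curve tau e.
Proof.
move=> me eB; exists (B ^+ 2) => t tt; have se := sqi_bnd (me t tt) (eB t tt).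
split=> //; rewrite -[leRHS](mean_cst nu); apply: le_mean; [exact: sqi_sq|exact: intg_cst|].
apply: aeS (eB t tt) => x eBx; rewrite -[leLHS]ger0_norm ?sqr_ge0// normrX.
by rewrite ler_sqr ?nnegrE ?(le_trans _ eBx).
Qed.

Lemma L2curve_scale tau f : sqi nu f -> L2curve tau (fun t x => t * f x).
Proof.
move=> sf; exists (tau ^+ 2 * mean nu (fun x => f x ^+ 2)) => t /andP[t0 tt].
split; first exact: sqiZ.
have -> : (fun x => (t * f x) ^+ 2) = (fun x => t ^+ 2 * f x ^+ 2) by apply/funext => x; ring.
rewrite (meanZ _ (sqi_sq sf)); apply: ler_wpM2r; last by rewrite ler_sqr ?nnegrE//; linarith.
by apply: mean_ge0; [apply: nearW => x; exact: sqr_ge0|exact: intg_meas (sqi_sq sf)].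
Qed.

Lemma L2deriv_lin tau (a : R) e v e' v' : L2curve tau e -> L2curve tau v ->
  L2curve tau e' -> L2curve tau v' -> L2deriv tau e v -> L2deriv tau e' v' ->
  L2deriv tau (fun t x => a * e t x + e' t x) (fun t x => a * v t x + v' t x).
Proof.
move=> [B1 H1] [B2 H2] [B3 H3] [B4 H4] D D' eps eps0.
have c0 : 0 < 2 * a ^+ 2 + 2 by have := sqr_ge0 a; linarith.
have [dl dl0 Hd] := D _ (divr_gt0 eps0 c0); have [dl' dl'0 Hd'] := D' _ (divr_gt0 eps0 c0).
exists (Num.min dl dl') => [|t h t0]; first by rewrite lt_min dl0.
rewrite lt_min => /andP[h0 /andP[hd hd']] th.
have t1 : 0 <= t <= tau by rewrite t0; linarith.
have t2 : 0 <= t + h <= tau by rewrite th andbT; linarith.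
have s1 := sqiB (sqiB (H1 _ t2).1 (H1 _ t1).1) (sqiZ h (H2 _ t1).1).
have s2 := sqiB (sqiB (H3 _ t2).1 (H3 _ t1).1) (sqiZ h (H4 _ t1).1).
have := sq_mean_lin a s1 s2.
have := Hd t h t0 _ th; rewrite h0 hd => /(_ isT) b1.
have := Hd' t h t0 _ th; rewrite h0 hd' => /(_ isT) b2.
have -> : (fun x => (a * e (t + h) x + e' (t + h) x - (a * e t x + e' t x) -
    h * (a * v t x + v' t x)) ^+ 2) =
  (fun x => (a * (e (t + h) x - e t x - h * v t x) +
    (e' (t + h) x - e' t x - h * v' t x)) ^+ 2) by apply/funext => x; ring.
move=> /le_trans; apply.
have -> : eps * h ^+ 2 = 2 * a ^+ 2 * (eps / (2 * a ^+ 2 + 2) * h ^+ 2) +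
   2 * (eps / (2 * a ^+ 2 + 2) * h ^+ 2) by field; rewrite gt_eqF.
by apply: lerD; apply: ler_wpM2l => //; rewrite mulr_ge0// sqr_ge0.
Qed.

Lemma L2deriv_affine tau f g : L2deriv tau (fun t x => t * f x + g x) (fun=> f).
Proof.
move=> eps eps0; exists 1 => // t h t0 h0 th.
have -> : (fun x => ((t + h) * f x + g x - (t * f x + g x) - h * f x) ^+ 2) = cst 0.
  by apply/funext => x /=; ring.
by rewrite mean_cst mulr_ge0 ?sqr_ge0//; linarith.
Qed.

Lemma L2deriv_bounded tau e v (B : R) :
  (forall t, 0 <= t <= tau -> measurable_fun setT (e t)) ->
  (forall t, 0 <= t <= tau -> measurable_fun setT (v t)) ->
  (forall t h : R, 0 <= t -> 0 < h -> t + h <= tau ->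
    {ae nu, forall x, `|e (t + h) x - e t x - h * v t x| <= B * h ^+ 2}) ->
  L2deriv tau e v.
Proof.
move=> me mv H eps eps0; have c0 : 0 < B ^+ 2 + 1 by have := sqr_ge0 B; linarith.
exists (Num.min 1 (eps / (B ^+ 2 + 1))) => [|t h t0]; first by rewrite lt_min ltr01 divr_gt0.
rewrite lt_min => /andP[h0 /andP[h1 hd]] th.
have t1 : 0 <= t <= tau by rewrite t0; linarith.
have t2 : 0 <= t + h <= tau by rewrite th andbT; linarith.
have mr : measurable_fun setT (fun x => e (t + h) x - e t x - h * v t x).
  apply: measurable_funB; first by apply: measurable_funB; exact: me.
  by apply: measurable_funM => //; exact: mv.
have sr := sqi_bnd mr (H t h t0 h0 th).
apply: (@le_trans _ _ ((B * h ^+ 2) ^+ 2)).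
  rewrite -[leRHS](mean_cst nu); apply: le_mean; [exact: (sqi_sq sr)|exact: intg_cst|].
  apply: aeS (H t h t0 h0 th) => x Hx; rewrite -[leLHS]ger0_norm ?sqr_ge0// normrX.
  by rewrite ler_sqr ?nnegrE ?(le_trans _ Hx).
move: hd; rewrite ltr_pdivlMr// => hd.
have -> : (B * h ^+ 2) ^+ 2 = (h * B ^+ 2 * h) * h ^+ 2 by ring.
apply: ler_wpM2r; first exact: sqr_ge0.
have : h * B ^+ 2 * h <= h * B ^+ 2 * 1 by apply: ler_wpM2l; [rewrite mulr_ge0 ?sqr_ge0//; linarith|linarith].
linarith.
Qed.

(** The error terms of one time step of length [h] in [curve_nonpos]. *)
Lemma nonpos_step_bound (M F m1 E V Q B C eps th h ep s : R) :
  0 < h -> 0 < th -> 0 <= C -> 0 <= ep -> th * B <= eps / 4 -> ep <= th * eps / 4 -> ep <= 1 ->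
  h * (8 * (C + 1)) < eps -> m1 <= 0 -> E <= B -> V <= C -> Q <= ep * h ^+ 2 ->
  M <= F + 2 * h * m1 + h * th * E + 2 * h ^+ 2 * V + ((h * th)^-1 + 2) * Q ->
  M - eps * (s + h) <= F - eps * s.
Proof.
move=> h0 th0 C0 ep0 thB ep1 ep2 hC m0 EB VC Qe.
have p1 : 2 * h * m1 <= 0 by rewrite pmulr_rle0// mulr_gt0.
have p2 : h * th * E <= h * (eps / 4).
  rewrite -mulrA ler_pM2l//; apply: le_trans thB; by rewrite ler_pM2l.
have hC0 : 0 <= h * C by rewrite mulr_ge0// ltW.
have p3 : 2 * h ^+ 2 * V <= h * (eps / 4).
  have -> : 2 * h ^+ 2 * V = h * (2 * (h * V)) by ring.
  rewrite ler_pM2l//.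
  have : h * V <= h * C by rewrite ler_pM2l.
  linarith.
have k0 : 0 < (h * th)^-1 by rewrite invr_gt0 mulr_gt0.
have p4 : ((h * th)^-1 + 2) * Q <= h * (eps / 4) + h * (eps / 4).
  apply: (@le_trans _ _ (((h * th)^-1 + 2) * (ep * h ^+ 2))).
    by apply: ler_wpM2l => //; linarith.
  have -> : ((h * th)^-1 + 2) * (ep * h ^+ 2) = h * (ep / th) + h * (2 * (ep * h)).
    by field; rewrite !gt_eqF.
  apply: lerD; rewrite ler_pM2l//.
    by rewrite ler_pdivrMr//; linarith.
  have : ep * h <= 1 * h by rewrite ler_pM2r.
  linarith.
linarith.
Qed.

(** If the derivative of a curve never points upwards on the positive part of
    the curve, then a curve that starts nonpositive stays nonpositive. *)
Lemma curve_nonpos tau e v : L2curve tau e -> L2curve tau v -> L2deriv tau e v ->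
  (forall t, 0 <= t <= tau -> mean nu (fun x => Num.max 0 (e t x) * v t x) <= 0) ->
  {ae nu, forall x, e 0 x <= 0} ->
  forall t, 0 <= t <= tau -> {ae nu, forall x, e t x <= 0}.
Proof.
move=> [B HB] [C HC] D H e0 t /andP[t0 ttau].
(* over a step of length h, the squared norm of the positive part grows by at
   most eps h, for every eps and all small h *)
pose Phi s := mean nu (fun x => Num.max 0 (e s x) ^+ 2).
have B0 : 0 <= B.
  have [|s0 b0] := HB 0; first by rewrite lexx; linarith.
  apply: le_trans b0; apply: mean_ge0; [by apply: nearW => x; exact: sqr_ge0|exact: intg_meas (sqi_sq s0)].
have C0 : 0 <= C.
  have [|s0 b0] := HC 0; first by rewrite lexx; linarith.
  apply: le_trans b0; apply: mean_ge0; [by apply: nearW => x; exact: sqr_ge0|exact: intg_meas (sqi_sq s0)].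
have Phi0 : Phi 0 = 0.
  have [|s0 _] := HB 0; first by rewrite lexx; linarith.
  rewrite -[RHS](mean_cst nu 0); apply: ae_eq_mean; [exact: intg_meas (sqi_sq (sqi_pos s0))|exact: (measurable_cst (0:R))|].
  apply/ae_eq_iff; apply: aeS e0 => x ex; rewrite (_ : Num.max 0 (e 0 x) = 0) ?expr0n//.
  by rewrite /Num.max; case: ltP => //; linarith.
have key eps : 0 < eps -> Phi t <= eps * t.
  move=> eps0.
  pose th := eps / (4 * (B + 1)); have th0 : 0 < th by rewrite divr_gt0// mulr_gt0//; linarith.
  have thB : th * B <= eps / 4.
    have : th * (B + 1) = eps / 4 by rewrite /th; field; rewrite gt_eqF//; linarith.
    by linarith.
  pose ep := Num.min (th * eps / 4) 1.
  have ep0 : 0 < ep by rewrite lt_min ltr01 andbT divr_gt0// mulr_gt0.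
  have ep1 : ep <= th * eps / 4 by rewrite ge_min lexx.
  have ep2 : ep <= 1 by rewrite ge_min lexx orbT.
  have [dl dl0 Hd] := D _ ep0.
  pose dl' := Num.min dl (eps / (8 * (C + 1))).
  have dl'0 : 0 < dl' by rewrite lt_min dl0 divr_gt0// mulr_gt0//; linarith.
  have : Phi t - eps * t <= Phi 0 - eps * 0; last by rewrite Phi0; linarith.
  apply: (step_nonincr (J := fun s => Phi s - eps * s) t0 dl'0) => s s' s0 ss' s't.
  rewrite lt_min => /andP[sd sd'].
  have [->//|sneq] := eqVneq s s'.
  pose h := s' - s; have h0 : 0 < h by rewrite /h subr_gt0 lt_neqAle sneq.
  have hd : 0 < h < dl by rewrite h0.
  have s'E : s' = s + h by rewrite /h; ring.
  have hC : h * (8 * (C + 1)) < eps by rewrite -ltr_pdivlMr// mulr_gt0//; linarith.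
  have s1 : 0 <= s <= tau by rewrite s0; linarith.
  have s2 : 0 <= s + h <= tau by rewrite -s'E; apply/andP; linarith.
  have sht : s + h <= tau by linarith.
  have := Hd s h s0 hd sht.
  have [se eB] := HB s s1; have [sv vC] := HC s s1; have [se' _] := HB _ s2.
  have Hs := H s s1; rewrite s'E /Phi.
  pose rho x := e (s + h) x - e s x - h * v s x.
  have sr : sqi nu rho by apply: sqiB; [exact: sqiB|exact: sqiZ].
  rewrite -/(Rintegral nu setT (fun x => rho x ^+ 2)) => Hr.
  have ia := sqi_sq (sqi_pos se); have ib := sqi_intgM (sqi_pos se) sv.
  have ie := sqi_sq se; have iv := sqi_sq sv; have ir := sqi_sq sr.
  pose c5 := (h * th)^-1 + 2.
  have i1 := intgD ia (intgZ (2 * h) ib).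
  have i2 := intgD i1 (intgZ (h * th) ie).
  have i3 := intgD i2 (intgZ (2 * h ^+ 2) iv).
  have i4 := intgD i3 (intgZ c5 ir).
  have : mean nu (fun x => Num.max 0 (e (s + h) x) ^+ 2) <=
     mean nu (fun x => Num.max 0 (e s x) ^+ 2 + 2 * h * (Num.max 0 (e s x) * v s x) +
       h * th * e s x ^+ 2 + 2 * h ^+ 2 * v s x ^+ 2 + c5 * rho x ^+ 2).
    apply: le_mean; [exact: (sqi_sq (sqi_pos se'))|exact: i4|].
    apply: nearW => x; have -> : e (s + h) x = e s x + (h * v s x + rho x) by rewrite /rho; ring.
    rewrite /c5; set k := h * th; have k0 : 0 < k by exact: mulr_gt0.
    have kk : k * k^-1 = 1 by rewrite mulfV ?gt_eqF.
    move: (e s x) (v s x) (rho x) => a vv r; clear -k0 kk; move: (k^-1) kk => ki kk.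
    have [aP P0 Pa] : [/\ a <= Num.max 0 a, 0 <= Num.max 0 a & Num.max 0 a ^+ 2 <= a ^+ 2].
      by rewrite /Num.max; case: ltP => ha; split; rewrite ?expr0n ?sqr_ge0//; linarith.
    move: (Num.max 0 a) aP P0 Pa => P aP P0 Pa.
    apply: (@le_trans _ _ ((P + (h * vv + r)) ^+ 2)).
      rewrite /Num.max; case: ltP => hb; last by rewrite expr0n sqr_ge0.
      by rewrite ler_sqr ?nnegrE; linarith.
    have q1 := sqr_ge0 (h * vv - r).
    have q2 : 0 <= k * (P - ki * r) ^+ 2 by rewrite mulr_ge0 ?sqr_ge0// ltW.
    have q3 : k * (P - ki * r) ^+ 2 = k * P ^+ 2 - (k * ki) * 2 * P * r + (k * ki) * ki * r ^+ 2 by ring.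
    have q4 : k * P ^+ 2 <= k * a ^+ 2 by rewrite ler_pM2l.
    move: q2; rewrite q3 kk; linarith.
  rewrite (meanD i3 (intgZ c5 ir)) (meanD i2 (intgZ _ iv)) (meanD i1 (intgZ _ ie)) (meanD ia (intgZ _ ib)).
  rewrite (meanZ _ ib) (meanZ _ ie) (meanZ _ iv) (meanZ _ ir).
  exact: (nonpos_step_bound _ h0 th0 C0 (ltW ep0) thB ep1 ep2 hC Hs eB vC Hr).
have iP : intg nu (fun x => Num.max 0 (e t x) ^+ 2).
  have [|st _] := HB t; first by rewrite t0.
  exact: (sqi_sq (sqi_pos st)).
have : Phi t <= 0.
  rewrite leNgt; apply/negP => P0; have t1 : 0 < t + 1 by linarith.
  have := key (Phi t / (t + 1)); rewrite divr_gt0// => /(_ isT).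
  have -> : Phi t / (t + 1) * t = Phi t - Phi t / (t + 1) by field; rewrite gt_eqF.
  have : 0 < Phi t / (t + 1) by rewrite divr_gt0.
  linarith.
move=> /(mean_le0_eq0 iP _) H0; have {}H0 := H0 _.
have {H0} : {ae nu, forall x, Num.max 0 (e t x) ^+ 2 = 0}.
  by apply: H0; apply: nearW => x; exact: sqr_ge0.
apply: aeS => x /eqP; rewrite sqrf_eq0 => /eqP.
by rewrite /Num.max; case: ltP => //; linarith.
Qed.

End curves.

(** * Krein-Feller semigroups on L2 *)

Section semigroup.
Context {R : realType} (nu : borel_probability R) (b : boundary_condition).
Local Notation mR := (measurableTypeR R).
Local Notation I01 := (`[0, 1]%classic : set R).
Local Notation gl := (gap_linear_rep nu).
Hypothesis nu_adm : admissible nu.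
Variable T : R -> L2 nu -> L2 nu.
Hypothesis T_sg : krein_feller_semigroup b T.

Lemma sg_lin t (a : R) (u v w : L2 nu) : 0 <= t ->
  {ae nu, forall x, w x = a * u x + v x} ->
  {ae nu, forall x, T t w x = a * T t u x + T t v x}.
Proof.
move=> t0 wuv; have [[lin _ _ _ _] _] := T_sg.
by apply/(ae_eq_iff nu (T t w)); apply: lin => //; apply/ae_eq_iff.
Qed.

Lemma sg_zero t (u : L2 nu) : 0 <= t -> {ae nu, forall x, u x = 0} ->
  {ae nu, forall x, T t u x = 0}.
Proof.
move=> t0 u0; have uu : {ae nu, forall x, u x = (-1) * u x + u x}.
  by apply: aeS u0 => x ->; ring.
have := sg_lin t0 uu; apply: aeS => x; linarith.
Qed.

Lemma sg_comb t (a c : R) (u v q w : L2 nu) : 0 <= t ->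
  {ae nu, forall x, w x = a * u x + (c * v x + q x)} ->
  {ae nu, forall x, T t w x = a * T t u x + (c * T t v x + T t q x)}.
Proof.
move=> t0 H; have [z zE] := sqi_L2 (sqiD (sqiZ c (L2_sqi v)) (L2_sqi q)).
move/ae_eq_iff in zE.
have h : {ae nu, forall x, w x = a * u x + z x} by apply: (aeS2 _ H zE) => x -> ->.
by apply: (aeS2 _ (sg_lin t0 h) (sg_lin t0 zE)) => x -> ->.
Qed.

Lemma sg_contr t (u : L2 nu) : 0 <= t ->
  mean nu (fun x => T t u x ^+ 2) <= mean nu (fun x => u x ^+ 2).
Proof.
move=> t0; have [[_ _ _ ct _] _] := T_sg; have := ct t t0 u.
rewrite !L2norm_sqrt; try exact: L2_sqi.
rewrite lee_fin ler_sqrt//; apply: mean_ge0; first by apply: nearW => x; exact: sqr_ge0.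
exact: intg_meas (sqi_sq (L2_sqi u)).
Qed.

Lemma sg_0 (u : L2 nu) : T 0 u = u.
Proof. by have [[_ H _ _ _] _] := T_sg. Qed.

Lemma sg_add s t (u : L2 nu) : 0 <= s -> 0 <= t -> T (s + t) u = T s (T t u).
Proof. by move=> s0 t0; have [[_ _ H _ _] _] := T_sg; exact: H. Qed.

(** The generator, in terms of squared norms. *)
Lemma generatorP (u w : L2 nu) : generator T u w <->
  forall eps : R, 0 < eps -> exists2 dl : R, 0 < dl & forall h : R, 0 < h < dl ->
    mean nu (fun x => (T h u x - u x - h * w x) ^+ 2) <= eps * h ^+ 2.
Proof.
rewrite /generator.
pose q h x := T h u x - u x - h * w x.
have sq h : sqi nu (q h) by apply: sqiB; [apply: sqiB; exact: L2_sqi|apply: sqiZ; exact: L2_sqi].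
have LE h : h != 0 -> L2norm nu (fun x => h^-1 * (T h u x - u x) - w x) =
    (Num.sqrt (mean nu (fun x => q h x ^+ 2) / h ^+ 2))%:E.
  move=> h0; have -> : (fun x => h^-1 * (T h u x - u x) - w x) = (fun x => h^-1 * q h x).
    by apply/funext => x; rewrite /q; field.
  rewrite (L2norm_sqrt (sqiZ _ (sq h))); congr (Num.sqrt _)%:E.
  rewrite mulrC -exprVn -(meanZ _ (sqi_sq (sq h))); congr (Rintegral nu setT _).
  by apply/funext => x; ring.
have q0 h : 0 <= mean nu (fun x => q h x ^+ 2).
  by apply: mean_ge0; [apply: nearW => x; exact: sqr_ge0|exact: intg_meas (sqi_sq (sq h))].
split.
- move=> /fine_cvgP[_ /cvgrPdist_lt H] eps eps0.
  have se : 0 < Num.sqrt eps by rewrite sqrtr_gt0.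
  have [dl /= dl0 {}H] := H _ se; exists dl => // h /andP[h0 hd].
  have := H h; rewrite /= !sub0r normrN gtr0_norm// LE ?gt_eqF//= normrN.
  rewrite ger0_norm ?sqrtr_ge0// => /(_ hd h0).
  rewrite ltr_sqrt// ltr_pdivrMr ?exprn_gt0//; exact: ltW.
- move=> H; apply/fine_cvgP; split.
    near=> h; rewrite LE ?gt_eqF//; near: h; exact: nbhs_right_gt.
  apply/cvgrPdist_lt => e e0.
  have e2 : 0 < e ^+ 2 / 2 by rewrite divr_gt0// exprn_gt0.
  have [dl dl0 {}H] := H _ e2; near=> h.
  have h0 : 0 < h by near: h; exact: nbhs_right_gt.
  have hd : h < dl by near: h; exact: nbhs_right_lt.
  rewrite sub0r normrN /= LE ?gt_eqF//= ger0_norm ?sqrtr_ge0//.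
  rewrite -(ger0_norm (ltW e0)) -sqrtr_sqr ltr_sqrt ?exprn_gt0//.
  rewrite ltr_pdivrMr ?exprn_gt0//; apply: (@le_lt_trans _ _ (e ^+ 2 / 2 * h ^+ 2)).
    by apply: H; rewrite h0.
  by rewrite ltr_pM2r ?exprn_gt0//; have := exprn_gt0 2 e0; linarith.
Unshelve. all: by end_near.
Qed.

Lemma sg_generator (u w : L2 nu) : krein_feller b u w <-> generator T u w.
Proof. by have [_ H] := T_sg; split => /H. Qed.

(** The uniform right differentiability of the orbit of an element of the domain. *)
Lemma sg_deriv_bound (u w : L2 nu) : krein_feller b u w -> forall eps : R, 0 < eps ->
  exists2 dl : R, 0 < dl & forall t h : R, 0 <= t -> 0 < h < dl ->
    mean nu (fun x => (T (t + h) u x - T t u x - h * T t w x) ^+ 2) <= eps * h ^+ 2.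
Proof.
move=> /sg_generator/generatorP H eps eps0; have [dl dl0 {}H] := H _ eps0.
exists dl => // t h t0 hd; have h0 : 0 <= h by linarith.
rewrite (sg_add _ t0 h0); apply: le_trans (H h hd).
have sq : sqi nu (fun x => (-1) * u x + ((- h) * w x + T h u x)).
  by apply: sqiD; [|apply: sqiD]; [exact: sqiZ (L2_sqi _)|exact: sqiZ (L2_sqi _)|exact: L2_sqi].
have [q qE] := sqi_L2 sq; move/ae_eq_iff in qE.
have TqE := sg_comb t0 qE.
have := sg_contr q t0.
have sL := L2_sqi.
rewrite (@ae_eq_mean _ _ _ nu (fun x => (T t (T h u) x - T t u x - h * T t w x) ^+ 2)
  (fun x => T t q x ^+ 2)).
- move=> /le_trans; apply; rewrite le_eqVlt; apply/orP; left; apply/eqP.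
  apply: ae_eq_mean; [exact: intg_meas (sqi_sq (sL _ _ q))| |].
    by apply: intg_meas (sqi_sq _); apply: sqiB; [apply: sqiB; exact: L2_sqi|apply: sqiZ; exact: L2_sqi].
  by apply/ae_eq_iff; apply: aeS qE => x ->; ring.
- by apply: intg_meas (sqi_sq _); apply: sqiB; [apply: sqiB; exact: L2_sqi|apply: sqiZ; exact: L2_sqi].
- exact: intg_meas (sqi_sq (sL _ _ _)).
- by apply/ae_eq_iff; apply: aeS TqE => x ->; ring.
Qed.

(** The domain is invariant, and the operator commutes with the semigroup. *)
Lemma sg_flow (u w : L2 nu) t : krein_feller b u w -> 0 <= t ->
  krein_feller b (T t u) (T t w).
Proof.
move=> kf t0; apply/sg_generator/generatorP => eps eps0.
have [dl dl0 H] := sg_deriv_bound kf eps0; exists dl => // h hd.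
have := H t h t0 hd; rewrite addrC sg_add//; linarith.
Qed.

Lemma sg_L2curve tau (u : L2 nu) : L2curve nu tau (fun t => T t u).
Proof.
exists (mean nu (fun x => u x ^+ 2)) => t /andP[t0 _].
by split; [exact: L2_sqi|exact: sg_contr].
Qed.

Lemma sg_L2deriv tau (u w : L2 nu) : krein_feller b u w ->
  L2deriv nu tau (fun t => T t u) (fun t => T t w).
Proof.
move=> kf eps eps0; have [dl dl0 H] := sg_deriv_bound kf eps0.
by exists dl => // t h t0 hd _; exact: H.
Qed.

(** The maximum principle for elements of the domain. *)
Lemma sg_max_domain (u w : L2 nu) (c t : R) : krein_feller b u w -> 0 <= c -> 0 <= t ->
  {ae nu, forall x, u x <= c} -> {ae nu, forall x, T t u x <= c}.
Proof.
move=> kf c0 t0 uc.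
have C1 := L2curve_lin 1 (sg_L2curve t u) (L2curve_cst t (sqi_cst nu (- c))).
have C0 := L2curve_lin 1 (sg_L2curve t w) (L2curve_cst t (sqi_cst nu 0)).
have D : L2deriv nu t (fun s x => 1 * T s u x + cst (- c) x) (fun s x => 1 * T s w x + cst 0 x).
  apply: (@L2deriv_lin _ _ _ nu t 1 (fun s => T s u) (fun s => T s w) (fun=> cst (- c)) (fun=> cst 0)).
  - exact: sg_L2curve.
  - exact: sg_L2curve.
  - exact: L2curve_cst (sqi_cst nu (- c)).
  - exact: L2curve_cst (sqi_cst nu 0).
  - exact: sg_L2deriv.
  - move=> eps eps0; exists 1 => // s h s0 h0 sh.
    have -> : (fun x : R => (cst (- c) x - cst (- c) x - h * cst 0 x) ^+ 2) = cst (0 : R).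
      by apply/funext => x /=; ring.
    by rewrite mean_cst mulr_ge0 ?sqr_ge0// ltW.
have := curve_nonpos C1 C0 D _ _ (t := t); rewrite lexx t0.
move=> H; apply: (aeS _ (H _ _ isT)) => [x|s /andP[s0 st]|].
- by rewrite /=; linarith.
- have := energy_le0 nu_adm (sg_flow kf s0) c0.
  by congr (_ <= _); congr (Rintegral nu setT _); apply/funext => x /=; rewrite !mul1r addr0.
- by apply: aeS uc => x; rewrite sg_0 /=; linarith.
Qed.

End semigroup.

(** * The space of continuous functions *)

Lemma inv_small (R : realType) (e : R) : 0 < e -> exists n : nat, (n.+1%:R^-1 : R) < e.
Proof.
move=> e0; exists (Num.bound (e^-1)); rewrite invf_plt ?posrE//.
have := archi_boundP (ltW (etrans (invr_gt0 e) e0)) => /lt_trans; apply.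
by rewrite ltr_nat.
Qed.

Lemma small_eq0 (R : realType) (a c : R) : 0 <= c ->
  (forall n : nat, `|a| <= c * n.+1%:R^-1) -> a = 0.
Proof.
move=> c0 H; apply: contrapT => /eqP a0.
have a1 : 0 < `|a| by rewrite normr_gt0.
have c1 : 0 < c + 1 by linarith.
have [n hn] := inv_small (divr_gt0 a1 c1).
move: hn; rewrite ltr_pdivlMr// => hn; have := H n.
have : 0 < (n.+1%:R^-1 : R) by [].
move: (n.+1%:R^-1 : R) hn => k hn k0; linarith.
Qed.

Section continuous_classes.
Context {R : realType} (nu : borel_probability R) (b : boundary_condition).
Local Notation mR := (measurableTypeR R).
Local Notation I01 := (`[0, 1]%classic : set R).
Local Notation gl := (gap_linear_rep nu).
Implicit Types u v w p q : R -> R.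
Hypothesis nu_adm : admissible nu.

Lemma I01_0 : I01 0. Proof. by apply/I01E; rewrite lexx ler01. Qed.
Lemma I01_1 : I01 1. Proof. by apply/I01E; rewrite lexx ler01. Qed.

Lemma Cspace_rep p u : {within I01, continuous p} -> bc0 b p ->
  {ae nu, forall x, u x = p x} -> Cspace nu b u.
Proof.
by move=> pc bp up; exists p; split => //; exact/ae_eq_iff.
Qed.

Lemma gl_glin u : Cspace nu b u -> glin nu (gl u).
Proof. by case/(gap_linear_repP nu_adm). Qed.

Lemma gl_ae u : Cspace nu b u -> {ae nu, forall x, u x = gl u x}.
Proof. by case/(gap_linear_repP nu_adm) => _ /ae_eq_iff. Qed.

Lemma gl_bc u : Cspace nu b u -> bc0 b (gl u).
Proof. by case/(gap_linear_repP nu_adm). Qed.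

Lemma Cspace_comb (a : R) u v w : Cspace nu b u -> Cspace nu b v ->
  {ae nu, forall x, w x = a * u x + v x} -> Cspace nu b w.
Proof.
move=> Cu Cv wE; apply: (@Cspace_rep (fun x => a * gl u x + gl v x)).
- exact: cont_lin (gl_glin Cu).1 (gl_glin Cv).1.
- by have := gl_bc Cu; have := gl_bc Cv; rewrite /bc0; case: b => // -[-> ->] [-> ->]; rewrite mulr0 addr0.
- by apply: (aeS2 _ wE (aeI (gl_ae Cu) (gl_ae Cv))) => x -> [<- <-].
Qed.

Lemma gl_bound u (B : R) : Cspace nu b u -> {ae nu, forall x, `|u x| <= B} ->
  forall x, I01 x -> `|gl u x| <= B.
Proof.
move=> Cu uB; apply: (glin_ae_bound nu_adm (gl_glin Cu)).
by apply: (aeS2 _ (gl_ae Cu) uB) => x <-.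
Qed.

Lemma gl_comb_bound (a c B : R) u v w : Cspace nu b u -> Cspace nu b v -> Cspace nu b w ->
  {ae nu, forall x, `|a * u x + (c * v x + w x)| <= B} ->
  forall x, I01 x -> `|a * gl u x + (c * gl v x + gl w x)| <= B.
Proof.
move=> Cu Cv Cw H.
have g1 := glin_lin a (gl_glin Cu) (glin_lin c (gl_glin Cv) (gl_glin Cw)).
apply: (glin_ae_bound nu_adm g1).
by apply: (aeS2 _ (aeI (gl_ae Cu) (gl_ae Cv)) (aeI (gl_ae Cw) H)) => x [<- <-] [<-].
Qed.

(** A uniform limit, almost everywhere, of elements of the space is in the space. *)
Lemma Cspace_limit u : (forall e : R, 0 < e ->
    exists2 v : R -> R, Cspace nu b v & {ae nu, forall x, `|u x - v x| <= e}) ->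
  Cspace nu b u.
Proof.
move=> H.
have [p Hp] : exists p : nat -> R -> R, forall n, [/\ glin nu (p n), bc0 b (p n) &
    {ae nu, forall x, `|u x - p n x| <= n.+1%:R^-1}].
  suff /choice[p Hp] : forall n : nat, exists p : R -> R, [/\ glin nu p, bc0 b p &
      {ae nu, forall x, `|u x - p x| <= n.+1%:R^-1}] by exists p.
  move=> n; have [v Cv uv] := H (n.+1%:R^-1) (etrans (invr_gt0 _) (ltr0n _ _)).
  exists (gl v); split; [exact: gl_glin|exact: gl_bc|].
  by apply: (aeS2 _ uv (gl_ae Cv)) => x + <-.
have pp n m x : I01 x -> `|p n x - p m x| <= n.+1%:R^-1 + m.+1%:R^-1.
  move=> Ix; have [gn _ un] := Hp n; have [gm _ um] := Hp m.
  have -> : p n x - p m x = -1 * p m x + p n x by ring.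
  apply: (glin_ae_bound nu_adm (glin_lin (-1) gm gn)) Ix.
  apply: (aeS2 _ un um) => z h1 h2.
  have -> : -1 * p m z + p n z = (u z - p m z) - (u z - p n z) by ring.
  by apply: (le_trans (ler_normB _ _)); rewrite addrC lerD.
(* the limit, written as a supremum: its distance to p n is then at most the
   error bound of p n *)
pose A x := [set p n x - n.+1%:R^-1 | n in [set: nat]].
pose P x := sup (A x).
have PE n x : I01 x -> `|P x - p n x| <= n.+1%:R^-1.
  move=> Ix; have ub m : ubound (A x) (p m x + m.+1%:R^-1).
    move=> _ [k _ <-]; have := pp k m x Ix; rewrite ler_norml.
    by move: (k.+1%:R^-1 : R) (m.+1%:R^-1 : R) => ? ?; linarith.
  have A0 : A x !=set0 by exists (p 0%N x - 1%:R^-1); exists 0%N.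
  have h1 : P x <= p n x + n.+1%:R^-1 by apply: ge_sup.
  have h2 : p n x - n.+1%:R^-1 <= P x.
    by apply: ub_le_sup; [exists (p n x + n.+1%:R^-1)|exists n].
  by rewrite ler_norml; move: (n.+1%:R^-1 : R) h1 h2 => ? ? ?; linarith.
apply: (@Cspace_rep P).
- apply/cont01P => x Ix e e0; have e3 : 0 < e / 3 by linarith.
  have [n hn] := inv_small e3; have [[/cont01P pc _] _ _] := Hp n.
  have [d d0 Hd] := pc x Ix _ e3; exists d => // y Iy yx.
  have := Hd y Iy yx; have := PE n x Ix; have := PE n y Iy.
  rewrite !ltr_norml !ler_norml; move: (n.+1%:R^-1 : R) hn => k hn; linarith.
- have bz : b = Dirichlet -> P 0 = 0 /\ P 1 = 0.
    move=> bD; split; apply: (small_eq0 ler01) => n; rewrite mul1r.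
      have := PE n 0 I01_0; have [_ + _] := Hp n; rewrite /bc0 bD => -[-> _].
      by rewrite subr0.
    have := PE n 1 I01_1; have [_ + _] := Hp n; rewrite /bc0 bD => -[_ ->].
    by rewrite subr0.
  by clear -bz; rewrite /bc0; case: b bz => // bz; exact: bz.
- have all : {ae nu, forall x, forall n, `|u x - p n x| <= n.+1%:R^-1}.
    by apply: ae_all_nat => n; case: (Hp n).
  apply: (aeS2 _ all (ae01_I nu_adm)) => x ux Ix.
  apply/eqP; rewrite -subr_eq0; apply/eqP; apply: (@small_eq0 _ _ 2) => // n.
  have -> : u x - P x = (u x - p n x) - (P x - p n x) by ring.
  have := ler_normB (u x - p n x) (P x - p n x); have := ux n; have := PE n x Ix.
  by move: (n.+1%:R^-1 : R) => ? ?; linarith.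
Qed.

Lemma domain_dense u (e : R) : Cspace nu b u -> 0 < e -> exists g w : L2 nu,
  krein_feller b g w /\ {ae nu, forall x, `|u x - g x| <= e}.
Proof.
move=> Cu e0; have [w [wc w0 w1 m0 wV]] := density_step nu_adm (gl_glin Cu) (gl_bc Cu) e0.
have [g /ae_eq_iff gV] := cont_L2 nu_adm (Vop_cont (b := b) nu_adm (a := gl u 0) wc).
have [w' w'E] := cont_L2 nu_adm wc.
exists g, w'; split.
  apply: (krein_feller_Vop nu_adm wc (a := gl u 0)).
  - by move=> bD; have := gl_bc Cu; rewrite /bc0 bD => -[].
  - exact/ae_eq_iff.
  - by rewrite m0; apply/ae_eq_iff; apply: aeS ((ae_eq_iff _ _ _).1 w'E) => x ->; rewrite subr0.
apply: (aeS2 _ (aeI (gl_ae Cu) gV) (ae01_I nu_adm)) => x [-> ->] Ix.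
by rewrite distrC; exact: wV.
Qed.

End continuous_classes.

(** * Smooth elements *)

Section smooth_elements.
Context {R : realType} (nu : borel_probability R) (b : boundary_condition).
Local Notation mR := (measurableTypeR R).
Local Notation I01 := (`[0, 1]%classic : set R).
Local Notation gl := (gap_linear_rep nu).
Hypothesis nu_adm : admissible nu.

(** [smooth k g]: the operator can be applied [k] times to [g], with a result
    in the space of continuous functions. *)
Fixpoint smooth (k : nat) (g : L2 nu) : Prop :=
  if k is k'.+1 then exists w : L2 nu, krein_feller b g w /\ smooth k' w
  else Cspace nu b g.

Lemma smooth_Cspace k g : smooth k g -> Cspace nu b g.
Proof. by case: k => [|k] //= [w [kf _]]; exact: krein_feller_Cspace kf. Qed.

Lemma krein_feller_shift (c : R) (g g' w : L2 nu) : (b = Dirichlet -> c = 0) ->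
  {ae nu, forall x, g' x = g x - c} -> krein_feller b g w -> krein_feller b g' w.
Proof.
move=> c0 gg' [f [f' [[Cf Df] gf bf]]]; exists (fun x => f x - c), f'; split.
- split => //; have := C1_lin 1 Cf (C1_affine (- c) 0).
  by apply: C1_ext => x _; rewrite !mul1r ?mul0r addr0.
- apply/ae_eq_iff; apply: (aeS2 _ gg' ((ae_eq_iff _ _ _).1 gf)) => x -> ->; by [].
- by case: b c0 bf => // c0 [-> ->]; rewrite c0// subr0.
Qed.

Lemma smooth_shift (c : R) k (g g' : L2 nu) : (b = Dirichlet -> c = 0) ->
  {ae nu, forall x, g' x = g x - c} -> smooth k g -> smooth k g'.
Proof.
move=> c0 gg'; case: k => [|k] /=.
  move=> Cg; apply: (@Cspace_rep _ _ _ (fun x => gl g x - c)).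
  - exact: cont_shift (gl_glin nu_adm Cg).1.
  - have := gl_bc nu_adm Cg; rewrite /bc0; case: b c0 => // c0 [-> ->].
    by rewrite c0// subr0.
  - by apply: (aeS2 _ gg' (gl_ae nu_adm Cg)) => x -> <-.
by move=> [w [kf sw]]; exists w; split => //; apply: (krein_feller_shift c0 gg' kf).
Qed.

(** If [w] is the image of a first approximation of [u], and [h] is a smooth
    approximation of [w], then the solution with right-hand side [h] is still
    close to [u], and it is smoother than [h] by one order. *)
Lemma smooth_dense k (u : R -> R) (e : R) : Cspace nu b u -> 0 < e ->
  exists g : L2 nu, smooth k g /\ {ae nu, forall x, `|u x - g x| <= e}.
Proof.
elim: k u e => [|k IH] u e Cu e0.
  have [g /ae_eq_iff gE] := cont_L2 nu_adm (gl_glin nu_adm Cu).1.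
  exists g; split => /=; first by apply: (Cspace_rep (gl_glin nu_adm Cu).1 (gl_bc nu_adm Cu) gE).
  by apply: (aeS2 _ gE (gl_ae nu_adm Cu)) => x -> ->; rewrite subrr normr0 ltW.
have e2 : 0 < e / 2 by linarith.
have e6 : 0 < e / 6 by linarith.
have [w [wc w0 w1 m0 wV]] := density_step nu_adm (gl_glin nu_adm Cu) (gl_bc nu_adm Cu) e2.
have Cw : Cspace nu b w.
  by apply: (Cspace_rep wc); [rewrite /bc0; case: b|exact: nearW].
have [h [sh hw]] := IH w _ Cw e6.
have Ch := smooth_Cspace sh; have [hc _] := gl_glin nu_adm Ch.
pose a := gl u 0; pose m := mshift nu b (gl h).
have a0 : b = Dirichlet -> a = 0.
  by move=> bD; have := gl_bc nu_adm Cu; rewrite /bc0 bD => -[].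
have m0' : b = Dirichlet -> m = 0 by rewrite /m /mshift => ->.
have [g /ae_eq_iff gE] := cont_L2 nu_adm (Vop_cont (b := b) nu_adm (a := a) hc).
have [w' /ae_eq_iff w'E] := cont_L2 nu_adm (cont_shift (c := m) hc).
exists g; split.
  exists w'; split.
    by apply: (krein_feller_Vop nu_adm hc a0); exact/ae_eq_iff.
  by apply: (smooth_shift m0' _ sh); apply: (aeS2 _ w'E (gl_ae nu_adm Ch)) => x -> ->.
apply: (aeS2 _ (aeI (gl_ae nu_adm Cu) gE) (ae01_I nu_adm)) => x [-> ->] Ix.
have dc := cont_lin (-1) hc wc.
have hw' : {ae nu, forall s, `|-1 * gl h s + w s| <= e / 6}.
  by apply: (aeS2 _ hw (gl_ae nu_adm Ch)) => s + <-; rewrite mulN1r addrC.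
have aa : `|-1 * a + a| <= 0 by rewrite mulN1r addNr normr0.
have := Vop_bound b nu_adm Ix dc aa hw'; rewrite Vop_lin//.
have := wV x Ix; rewrite -/a; move: (Vop nu b a w x) (Vop nu b a (gl h) x) (gl u x) => p q r.
have -> : r - q = (-1 * q + p) - (p - r) by ring.
have := ler_normB (-1 * q + p) (p - r); linarith.
Qed.

End smooth_elements.

(** * The semigroup in the supremum norm *)

Section semigroup_on_continuous.
Context {R : realType} (nu : borel_probability R) (b : boundary_condition).
Local Notation mR := (measurableTypeR R).
Local Notation I01 := (`[0, 1]%classic : set R).
Local Notation gl := (gap_linear_rep nu).
Hypothesis nu_adm : admissible nu.
Variable T : R -> L2 nu -> L2 nu.
Hypothesis T_sg : krein_feller_semigroup b T.

(** The maximum principle on the space of continuous functions. *)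
Lemma sg_max (u : L2 nu) (c t : R) : Cspace nu b u -> 0 <= c -> 0 <= t ->
  {ae nu, forall x, u x <= c} -> {ae nu, forall x, T t u x <= c}.
Proof.
move=> Cu c0 t0 uc.
pose P x := Num.max 0 (T t u x - c).
have sP : sqi nu P.
  by apply: sqi_pos; apply: sqiB; [exact: L2_sqi|exact: sqi_cst].
(* compare u with an element g of the domain within e of u: the orbit of g is at
   most c + e, and that of u - g has norm at most e *)
have key e : 0 < e -> mean nu (fun x => P x ^+ 2) <= 4 * e ^+ 2.
  move=> e0; have [g [w [kf ug]]] := domain_dense nu_adm Cu e0.
  have gc : {ae nu, forall x, g x <= c + e}.
    by apply: (aeS2 _ uc ug) => x h1; rewrite ler_norml; linarith.
  have ce0 : 0 <= c + e by linarith.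
  have Tgc := sg_max_domain nu_adm T_sg kf ce0 t0 gc.
  have [q /ae_eq_iff qE] := sqi_L2 (sqiB (L2_sqi u) (L2_sqi g)).
  have uE : {ae nu, forall x, u x = 1 * q x + g x} by apply: aeS qE => x ->; ring.
  have TE := sg_lin T_sg t0 uE.
  have q2 : mean nu (fun x => T t q x ^+ 2) <= e ^+ 2.
    apply: (le_trans (sg_contr T_sg q t0)).
    rewrite -[leRHS](mean_cst nu); apply: le_mean; [exact: sqi_sq (L2_sqi q)|exact: intg_cst|].
    apply: (aeS2 _ qE ug) => x -> h; rewrite /= -[leLHS]ger0_norm ?sqr_ge0// normrX.
    by rewrite ler_sqr ?nnegrE// ltW.
  have iq := sqi_sq (L2_sqi (T t q)).
  apply: (@le_trans _ _ (mean nu (fun x => 2 * T t q x ^+ 2 + cst (2 * e ^+ 2) x))); last first.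
    by rewrite (meanD (intgZ 2 iq) (intg_cst nu _)) (meanZ 2 iq) mean_cst; linarith.
  apply: le_mean; [exact: (sqi_sq sP)|exact: (intgD (intgZ 2 iq) (intg_cst nu _))|].
  apply: (aeS2 _ TE Tgc) => x; rewrite /P /= => -> h.
  apply: (@le_trans _ _ ((`|T t q x| + e) ^+ 2)).
    have := ler_norm (T t q x); have := normr_ge0 (T t q x) => n0 n1.
    rewrite /Num.max; case: ltP => hb; last by rewrite expr0n sqr_ge0.
    by rewrite ler_sqr ?nnegrE; linarith.
  rewrite -(real_normK (num_real (T t q x))); have := sqr_ge0 (`|T t q x| - e); linarith.
have mP0 : mean nu (fun x => P x ^+ 2) <= 0.
  rewrite leNgt; apply/negP => h; set M := mean nu _ in h key.
  pose e := Num.min 1 (M / 8).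
  have e0 : 0 < e by rewrite lt_min ltr01 divr_gt0.
  have e1 : e <= 1 by rewrite ge_min lexx.
  have e2 : e <= M / 8 by rewrite ge_min lexx orbT.
  have := key e e0; have : e * e <= e * 1 by rewrite ler_pM2l.
  rewrite -expr2; linarith.
have := mean_le0_eq0 (sqi_sq sP) _ mP0 => /(_ _)/aeS; apply; last by apply: nearW => x; exact: sqr_ge0.
move=> x /eqP; rewrite sqrf_eq0 => /eqP.
by rewrite /P /Num.max; case: ltP => //; linarith.
Qed.

Lemma sg_sup_contr (u : L2 nu) (c t : R) : Cspace nu b u -> 0 <= c -> 0 <= t ->
  {ae nu, forall x, `|u x| <= c} -> {ae nu, forall x, `|T t u x| <= c}.
Proof.
move=> Cu c0 t0 uc.
have [z /ae_eq_iff z0] := sqi_L2 (sqi_cst nu 0).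
have [v /ae_eq_iff vE] := sqi_L2 (sqiB (sqi_cst nu 0) (L2_sqi u)).
have vE' : {ae nu, forall x, v x = (-1) * u x + z x}.
  by apply: (aeS2 _ vE z0) => x -> ->; rewrite /=; ring.
have Cz : Cspace nu b z.
  apply: (@Cspace_rep _ _ _ (fun=> 0)) => //; first exact: cont_cst.
  by rewrite /bc0; case: b.
have Cv := Cspace_comb nu_adm Cu Cz vE'.
have h1 : {ae nu, forall x, u x <= c} by apply: aeS uc => x; rewrite ler_norml; linarith.
have h2 : {ae nu, forall x, v x <= c}.
  by apply: (aeS2 _ uc vE) => x + ->; rewrite ler_norml /=; linarith.
have TE := sg_lin T_sg t0 vE'; have Tz := sg_zero T_sg t0 z0.
apply: (aeS2 _ (aeI (sg_max Cu c0 t0 h1) (sg_max Cv c0 t0 h2)) (aeI TE Tz)).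
by move=> x [a1 a2] [a3 a4]; rewrite ler_norml; linarith.
Qed.

Lemma sg_Cspace (u : L2 nu) (t : R) : Cspace nu b u -> 0 <= t -> Cspace nu b (T t u).
Proof.
move=> Cu t0; apply: (Cspace_limit nu_adm) => e e0.
have [g [w [kf ug]]] := domain_dense nu_adm Cu e0.
have Cg := krein_feller_Cspace kf.
exists (T t g); first exact: krein_feller_Cspace (sg_flow T_sg kf t0).
have [q /ae_eq_iff qE] := sqi_L2 (sqiB (L2_sqi u) (L2_sqi g)).
have uE : {ae nu, forall x, u x = 1 * q x + g x} by apply: aeS qE => x ->; ring.
have qE' : {ae nu, forall x, q x = -1 * g x + u x} by apply: aeS qE => x ->; ring.
have Cq := Cspace_comb nu_adm Cg Cu qE'.
have qe : {ae nu, forall x, `|q x| <= e} by apply: (aeS2 _ qE ug) => x ->.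
apply: (aeS2 _ (sg_lin T_sg t0 uE) (sg_sup_contr Cq (ltW e0) t0 qe)) => x ->.
by rewrite mul1r addrK.
Qed.

(** A curve that starts at 0 and whose derivative is bounded by [c] grows at
    most linearly, almost everywhere. *)
Lemma curve_growth tau (e v : R -> R -> R) (c : R) :
  L2curve nu tau e -> L2curve nu tau v -> L2deriv nu tau e v ->
  (forall t, 0 <= t <= tau -> {ae nu, forall x, `|v t x| <= c}) ->
  {ae nu, forall x, e 0 x = 0} ->
  forall t, 0 <= t <= tau -> {ae nu, forall x, `|e t x| <= c * t}.
Proof.
move=> ce cv D vc e0.
have one (a : R) : `|a| = 1 -> forall t, 0 <= t <= tau -> {ae nu, forall x, a * e t x <= c * t}.
  move=> a1 t tt.
  have cg : L2curve nu tau (fun t x => t * cst (- c) x + cst 0 x).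
    have := L2curve_lin 1 (L2curve_scale tau (sqi_cst nu (- c))) (L2curve_cst tau (sqi_cst nu 0)).
    by congr L2curve; apply/funext => s; apply/funext => x; rewrite mul1r.
  have cc := L2curve_cst tau (sqi_cst nu (- c)).
  have D' := L2deriv_lin a ce cv cg cc D (L2deriv_affine nu tau (cst (- c)) (cst 0)).
  have := curve_nonpos (L2curve_lin a ce cg) (L2curve_lin a cv cc) D' _ _ tt.
  move=> H; apply: aeS (H _ _) => [x|s ss|].
  - by rewrite /=; linarith.
  - have [B HB] := L2curve_lin a ce cg; have [B' HB'] := L2curve_lin a cv cc.
    rewrite -[leRHS](mean_cst nu 0); apply: le_mean; last first.
    + apply: aeS (vc s ss) => x vx; rewrite mulr_ge0_le0 ?le_max ?lexx//=.
      have : `|a * v s x| <= c by rewrite normrM a1 mul1r.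
      by rewrite ler_norml; linarith.
    + exact: intg_cst.
    + exact: (sqi_intgM (sqi_pos (HB s ss).1) (HB' s ss).1).
  - by apply: aeS e0 => x ->; rewrite /=; linarith.
move=> t tt; have h1 := one 1 (normr1 _) t tt.
have h2 : {ae nu, forall x, -1 * e t x <= c * t} by apply: one => //; rewrite normrN normr1.
by apply: (aeS2 _ h1 h2) => x; rewrite ler_norml; linarith.
Qed.

Lemma L2deriv_sub_cst tau (e v : R -> R -> R) (f : R -> R) : L2curve nu tau e ->
  L2curve nu tau v -> sqi nu f -> L2deriv nu tau e v ->
  L2deriv nu tau (fun t x => 1 * e t x + f x) (fun t x => 1 * v t x + cst 0 x).
Proof.
move=> ce cv sf D.
apply: (@L2deriv_lin _ _ _ nu tau 1 e v (fun=> f) (fun=> cst 0)) => //.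
- exact: L2curve_cst.
- exact: L2curve_cst (sqi_cst nu 0).
- move=> eps eps0; exists 1 => // s h s0 h0 sh.
  have -> : (fun x : R => (f x - f x - h * cst 0 x) ^+ 2) = cst (0 : R).
    by apply/funext => x /=; ring.
  by rewrite mean_cst mulr_ge0 ?sqr_ge0// ltW.
Qed.

Lemma sg_lipschitz (u w : L2 nu) (B t h : R) : krein_feller b u w -> Cspace nu b w ->
  {ae nu, forall x, `|w x| <= B} -> 0 <= B -> 0 <= t -> 0 <= h ->
  {ae nu, forall x, `|T (t + h) u x - T t u x| <= B * h}.
Proof.
move=> kf Cw wB B0 t0 h0.
have kf' := sg_flow T_sg kf t0.
have su : sqi nu (fun x => - T t u x).
  have := sqiZ (-1) (L2_sqi (T t u)).
  by congr (sqi nu _); apply/funext => x; rewrite mulN1r.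
have D := L2deriv_sub_cst (sg_L2curve T_sg h (T t u)) (sg_L2curve T_sg h (T t w)) su
  (sg_L2deriv T_sg h kf').
have cu := L2curve_lin 1 (sg_L2curve T_sg h (T t u)) (L2curve_cst h su).
have cw := L2curve_lin 1 (sg_L2curve T_sg h (T t w)) (L2curve_cst h (sqi_cst nu 0)).
have hh : 0 <= h <= h by rewrite h0 lexx.
have := curve_growth cu cw D _ _ hh => /(_ B) H.
rewrite addrC (sg_add T_sg)//; apply: aeS (H _ _) => [x|s /andP[s0 _]|].
- by rewrite mul1r.
- have := sg_sup_contr (sg_Cspace Cw t0) B0 s0 (sg_sup_contr Cw B0 t0 wB).
  by apply: aeS => x; rewrite /= mul1r addr0.
- by apply: nearW => x; rewrite (sg_0 T_sg) mul1r subrr.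
Qed.

(** The second-order Taylor estimate of an orbit, almost everywhere. *)
Lemma sg_taylor (u w y : L2 nu) (B t h : R) : krein_feller b u w -> krein_feller b w y ->
  Cspace nu b y -> {ae nu, forall x, `|y x| <= B} -> 0 <= B -> 0 <= t -> 0 <= h ->
  {ae nu, forall x, `|T (t + h) u x - T t u x - h * T t w x| <= B * h ^+ 2}.
Proof.
move=> kfu kfw Cy yB B0 t0 h0.
have kf' := sg_flow T_sg kfu t0.
have su : sqi nu (fun x => - T t u x).
  have := sqiZ (-1) (L2_sqi (T t u)).
  by congr (sqi nu _); apply/funext => x; rewrite mulN1r.
have sw : sqi nu (fun x => - T t w x).
  have := sqiZ (-1) (L2_sqi (T t w)).
  by congr (sqi nu _); apply/funext => x; rewrite mulN1r.
have cTu := sg_L2curve T_sg h (T t u); have cTw := sg_L2curve T_sg h (T t w).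
have cg : L2curve nu h (fun s x => s * - T t w x + - T t u x).
  have := L2curve_lin 1 (L2curve_scale h sw) (L2curve_cst h su).
  by congr (L2curve nu h _); apply/funext => s; apply/funext => x; rewrite mul1r.
have cw := L2curve_cst h sw.
have D := L2deriv_lin 1 cTu cTw cg cw (sg_L2deriv T_sg h kf') (L2deriv_affine nu h _ _).
have hh : 0 <= h <= h by rewrite h0 lexx.
have := curve_growth (L2curve_lin 1 cTu cg) (L2curve_lin 1 cTw cw) D _ _ hh => /(_ (B * h)) H.
rewrite addrC (sg_add T_sg)//; apply: aeS (H _ _) => [x|s /andP[s0 sh]|].
- by rewrite expr2 mulrA; congr (`|_| <= _); ring.
- have := sg_lipschitz kfw Cy yB B0 t0 s0; rewrite addrC (sg_add T_sg)//.
  apply: aeS => x; rewrite mul1r => /le_trans; apply.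
  by apply: ler_wpM2l.
- by apply: nearW => x; rewrite (sg_0 T_sg); ring.
Qed.

End semigroup_on_continuous.

(** * Approximate solutions of the evolution equation *)

Section duhamel.
Context {R : realType} (nu : borel_probability R) (b : boundary_condition).
Local Notation mR := (measurableTypeR R).
Local Notation I01 := (`[0, 1]%classic : set R).
Hypothesis nu_adm : admissible nu.
Variable T : R -> L2 nu -> L2 nu.
Hypothesis T_sg : krein_feller_semigroup b T.

Lemma krein_feller_comb (a : R) (u w u' w' q p : L2 nu) :
  krein_feller b u w -> krein_feller b u' w' ->
  {ae nu, forall x, q x = a * u x + u' x} -> {ae nu, forall x, p x = a * w x + w' x} ->
  krein_feller b q p.
Proof.
move=> [f [f' [Df /ae_eq_iff uf bf]]] [g [g' [Dg /ae_eq_iff ug bg]]] qE pE.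
exists (fun x => a * f x + g x), (fun x => a * f' x + g' x); split.
- split; first exact: C1_lin Df.1 Dg.1.
  move=> x Ix; have iw := sqi_intg (L2_sqi w); have iw' := sqi_intg (L2_sqi w').
  have ip := sqi_intg (L2_sqi p).
  rewrite int_seg// (D2_mean nu_adm Df Ix) (D2_mean nu_adm Dg Ix).
  have i1 := intg_upto x iw; have i2 := intg_upto x iw'.
  have -> : mean nu (fun y => p y * upto x y) =
      a * mean nu (fun y => w y * upto x y) + mean nu (fun y => w' y * upto x y).
    rewrite -(meanZ a i1) -(meanD (intgZ a i1) i2).
    apply: ae_eq_mean; [exact: intg_meas (intg_upto x ip)|exact: intg_meas (intgD (intgZ a i1) i2)|].
    by apply/ae_eq_iff; apply: aeS pE => y ->; ring.
  ring.
- by apply/ae_eq_iff; apply: (aeS2 _ qE (aeI uf ug)) => x -> [-> ->].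
- by case: b bf bg => -[-> ->] [-> ->]; rewrite mulr0 addr0.
Qed.

(** Comparison of an orbit of the semigroup with an approximate solution [v] of
    the evolution equation, with defect at most [c]. *)
Lemma duhamel tau (c : R) (v v' : R -> R -> R) (vL wL : R -> L2 nu) : 0 <= tau ->
  (forall t, 0 <= t <= tau -> {ae nu, forall x, vL t x = v t x}) ->
  (forall t, 0 <= t <= tau -> krein_feller b (vL t) (wL t)) ->
  (forall t, 0 <= t <= tau -> {ae nu, forall x, `|wL t x - v' t x| <= c}) ->
  L2curve nu tau v -> L2curve nu tau v' -> L2deriv nu tau v v' ->
  forall t, 0 <= t <= tau -> {ae nu, forall x, `|T t (vL 0) x - v t x| <= c * t}.
Proof.
move=> tau0 vE kf vc cv cv' Dv.
have h0 : 0 <= (0 : R) <= tau by rewrite lexx tau0.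
have kf0 := kf 0 h0.
have cS := sg_L2curve T_sg tau (vL 0); have cW := sg_L2curve T_sg tau (wL 0).
have DS := sg_L2deriv T_sg tau kf0.
have one (a : R) : `|a| = 1 -> forall t, 0 <= t <= tau ->
    {ae nu, forall x, a * (T t (vL 0) x - v t x) <= c * t}.
  move=> a1 t tt.
  have cg : L2curve nu tau (fun t x => t * cst (- c) x + cst 0 x).
    have := L2curve_lin 1 (L2curve_scale tau (sqi_cst nu (- c))) (L2curve_cst tau (sqi_cst nu 0)).
    by congr L2curve; apply/funext => s; apply/funext => x; rewrite mul1r.
  have cc := L2curve_cst tau (sqi_cst nu (- c)).
  have D1 := L2deriv_lin (- a) cv cv' cg cc Dv (L2deriv_affine nu tau (cst (- c)) (cst 0)).
  have c1 := L2curve_lin (- a) cv cg; have c1' := L2curve_lin (- a) cv' cc.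
  have D2 := L2deriv_lin a cS cW c1 c1' DS D1.
  have c2 := L2curve_lin a cS c1; have c2' := L2curve_lin a cW c1'.
  have := curve_nonpos c2 c2' D2 _ _ tt.
  move=> H; apply: aeS (H _ _) => [x|s ss|].
  - by rewrite /=; linarith.
  - have [s0 st] := andP ss.
    have [q /ae_eq_iff qE] := sqi_L2 (sqiD (sqiZ a (L2_sqi (T s (vL 0)))) (sqiZ (- a) (L2_sqi (vL s)))).
    have [p /ae_eq_iff pE] := sqi_L2 (sqiD (sqiZ a (L2_sqi (T s (wL 0)))) (sqiZ (- a) (L2_sqi (wL s)))).
    have kfq : krein_feller b q p.
      have [z /ae_eq_iff zE] := sqi_L2 (sqi_cst nu 0).
      have kz : krein_feller b z z.
        apply: (krein_feller_comb (a := - 1) (sg_flow T_sg kf0 s0) (sg_flow T_sg kf0 s0)).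
          by apply: aeS zE => x ->; rewrite mulN1r addNr.
        by apply: aeS zE => x ->; rewrite mulN1r addNr.
      have [q1 /ae_eq_iff q1E] := sqi_L2 (sqiZ (- a) (L2_sqi (vL s))).
      have [p1 /ae_eq_iff p1E] := sqi_L2 (sqiZ (- a) (L2_sqi (wL s))).
      have k1 : krein_feller b q1 p1.
        apply: (krein_feller_comb (a := - a) (kf s ss) kz).
          by apply: (aeS2 _ q1E zE) => x -> ->; rewrite /= addr0.
        by apply: (aeS2 _ p1E zE) => x -> ->; rewrite /= addr0.
      apply: (krein_feller_comb (a := a) (sg_flow T_sg kf0 s0) k1).
        by apply: (aeS2 _ qE q1E) => x -> ->.
      by apply: (aeS2 _ pE p1E) => x -> ->.
    have [B HB] := c2; have [B' HB'] := c2'.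
    have c0 : 0 <= c.
      have hn : {ae nu, forall x, 0 <= c} by apply: aeS (vc s ss) => x; apply: le_trans.
      have := le_mean (intg_cst nu 0) (intg_cst nu c) hn.
      by rewrite !mean_cst.
    have cs0 : 0 <= c * s by rewrite mulr_ge0.
    have iqp := sqi_intgM (sqi_pos (sqiB (L2_sqi q) (sqi_cst nu (c * s)))) (L2_sqi p).
    apply: le_trans (energy_le0 nu_adm kfq cs0); apply: le_mean.
    + exact: (sqi_intgM (sqi_pos (HB s ss).1) (HB' s ss).1).
    + exact: iqp.
    apply: (aeS2 _ (aeI qE pE) (aeI (vE s ss) (vc s ss))) => x [-> ->] [-> vx].
    have -> : a * T s (vL 0) x + (- a * v s x + (s * cst (- c) x + cst 0 x)) =
      a * T s (vL 0) x + - a * v s x - c * s by rewrite /=; ring.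
    apply: ler_wpM2l; first by rewrite le_max lexx.
    have : `|a * (wL s x - v' s x)| <= c by rewrite normrM a1 mul1r.
    by rewrite ler_norml /=; linarith.
  - by apply: aeS (vE 0 h0) => x; rewrite (sg_0 T_sg) => -> /=; linarith.
move=> t tt; have h1 := one 1 (normr1 _) t tt.
have h2 : {ae nu, forall x, -1 * (T t (vL 0) x - v t x) <= c * t} by apply: one => //; rewrite normrN normr1.
by apply: (aeS2 _ h1 h2) => x; rewrite ler_norml; linarith.
Qed.

End duhamel.

(** * Uniformity in weak convergence *)

Section uniform_weak_convergence.
Context {R : realType} (b : boundary_condition) (mu : borel_probability R)
  (mun : nat -> borel_probability R).
Local Notation mR := (measurableTypeR R).
Local Notation I01 := (`[0, 1]%classic : set R).
Hypothesis mu_adm : admissible mu.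
Hypothesis mun_adm : forall n, admissible (mun n).
Hypothesis mun_cvg : cvg_weakly mun mu.

Lemma int01_cmean (nu : borel_probability R) (f : R -> R) : admissible nu ->
  {within I01, continuous f} -> (\int[nu]_(x in I01) f x)%R = cmean nu f.
Proof.
move=> nu_adm fc.
transitivity ((\int[nu]_(x in I01) (f \o clamp) x)%R).
  by apply: eq_Rintegral => x; rewrite inE => Ix; rewrite /= clampE.
have ic := cont_intg nu fc.
by rewrite (int_seg nu_adm 1 ic) (mean_upto1 nu_adm ic).
Qed.

Lemma cmean_cvg (f : R -> R) (e : R) : {within I01, continuous f} -> 0 < e ->
  \forall n \near \oo, `|cmean (mun n) f - cmean mu f| <= e.
Proof.
move=> fc e0; have /cvgrPdist_le /(_ e e0) := mun_cvg fc.
by apply: filterS => n; rewrite !int01_cmean// distrC.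
Qed.

Lemma cmean_close (nu : borel_probability R) (f g : R -> R) (e : R) : admissible nu ->
  {within I01, continuous f} -> {within I01, continuous g} ->
  (forall x, I01 x -> `|f x - g x| <= e) -> `|cmean nu f - cmean nu g| <= e.
Proof.
move=> nu_adm fc gc fg.
have -> : cmean nu f - cmean nu g = cmean nu (fun x => -1 * g x + f x).
  by rewrite (cmean_lin nu (-1) gc fc); ring.
apply: (cmean_bound nu_adm (cont_lin (-1) gc fc)).
by apply: (ae01 nu_adm) => x Ix; rewrite mulN1r addrC; exact: fg.
Qed.

(** Weak convergence is uniform on totally bounded families of functions. *)
Lemma cmean_cvg_unif (P : choiceType) (D : set P) (F : P -> R -> R) (e : R) : 0 < e ->
  (forall p, D p -> {within I01, continuous (F p)}) ->
  (forall d : R, 0 < d -> exists s : seq P, (forall q, q \in s -> D q) /\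
     forall p, D p -> exists2 q, q \in s & forall x, I01 x -> `|F p x - F q x| <= d) ->
  \forall n \near \oo, forall p, D p -> `|cmean (mun n) (F p) - cmean mu (F p)| <= e.
Proof.
move=> e0 Fc tb; have e3 : 0 < e / 3 by linarith.
have [s [sD sP]] := tb _ e3.
have H : \forall n \near \oo, forall q, q \in s -> `|cmean (mun n) (F q) - cmean mu (F q)| <= e / 3.
  elim: s sD {sP} => [|q s IH] sD; first exact: nearW.
  have h1 := cmean_cvg (Fc q (sD q (mem_head _ _))) e3.
  have h2 : forall q', q' \in s -> D q' by move=> q' q's; apply: sD; rewrite inE q's orbT.
  by apply: filterS2 h1 (IH h2) => n a1 a2 q'; rewrite inE => /orP[/eqP ->//|]; exact: a2.
apply: filterS H => n Hn p Dp; have [q qs pq] := sP p Dp.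
have h1 := cmean_close (mun_adm n) (Fc p Dp) (Fc q (sD q qs)) pq.
have h2 := cmean_close mu_adm (Fc p Dp) (Fc q (sD q qs)) pq.
have h3 := Hn q qs.
move: (cmean (mun n) (F p)) (cmean mu (F p)) (cmean (mun n) (F q)) (cmean mu (F q)) h1 h2 h3.
by move=> x1 x2 x3 x4; rewrite !ler_norml; linarith.
Qed.

(** A finite net of mesh [d] of a compact interval. *)
Lemma interval_net (tau d : R) : 0 <= tau -> 0 < d -> exists s : seq R,
  (forall q, q \in s -> 0 <= q <= tau) /\
  forall t, 0 <= t <= tau -> exists2 q, q \in s & `|t - q| <= d.
Proof.
move=> tau0 d0; pose N := Num.bound (tau / d).
exists [seq Num.min tau (i%:R * d) | i <- iota 0 N]; split.
  move=> q /mapP[i _ ->]; rewrite le_min tau0 mulr_ge0 ?ge_min ?lexx//; exact: ltW.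
move=> t /andP[t0 tt]; have td0 : 0 <= t / d by rewrite divr_ge0// ltW.
pose i := Num.truncn (t / d).
have /andP[i1 i2] : i%:R <= t / d < i.+1%:R by exact: truncn_itv.
have iN : (i < N)%N.
  rewrite -(ltr_nat R); apply: (le_lt_trans i1); apply: (@le_lt_trans _ _ (tau / d)).
    by rewrite ler_pM2r ?invr_gt0.
  by apply: archi_boundP; rewrite divr_ge0// ltW.
exists (Num.min tau (i%:R * d)); first by apply/mapP; exists i => //; rewrite mem_iota.
move: i1 i2; rewrite ler_pdivlMr// ltr_pdivrMr// -natr1 mulrDl mul1r => i1 i2.
have -> : Num.min tau (i%:R * d) = i%:R * d by apply/min_idPr; linarith.
by rewrite ger0_norm; linarith.
Qed.

Variables (tau M : R) (h : R -> R -> R).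
Hypothesis tau0 : 0 <= tau.
Hypothesis hc : forall t, 0 <= t <= tau -> {within I01, continuous (h t)}.
Hypothesis hM : forall t, 0 <= t <= tau -> forall x, I01 x -> `|h t x| <= M.
Hypothesis hL : forall s t, 0 <= s -> s <= t -> t <= tau -> forall x, I01 x ->
  `|h t x - h s x| <= M * (t - s).

Let M0 : 0 <= M.
Proof.
have t0 : 0 <= (0 : R) <= tau by rewrite lexx tau0.
exact: le_trans (normr_ge0 _) (hM t0 I01_0).
Qed.

Let hL' s t x : 0 <= s <= tau -> 0 <= t <= tau -> I01 x -> `|h t x - h s x| <= M * `|t - s|.
Proof.
move=> /andP[s0 s1] /andP[t0 t1] Ix; have [st|ts] := leP s t.
  by rewrite (ger0_norm (_ : 0 <= t - s)) ?subr_ge0//; exact: hL.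
rewrite distrC (distrC t) (gtr0_norm (_ : 0 < s - t)) ?subr_gt0//.
by apply: hL => //; exact: ltW.
Qed.

Lemma cmean_cvg_curve (e : R) : 0 < e -> \forall n \near \oo,
  forall t, 0 <= t <= tau -> `|cmean (mun n) (h t) - cmean mu (h t)| <= e.
Proof.
move=> e0; apply: (cmean_cvg_unif (D := [set t : R | 0 <= t <= tau]) e0 hc).
move=> d d0; have M1 : 0 < M + 1 by have := M0; lra.
have [s [s1 s2]] := interval_net tau0 (divr_gt0 d0 M1); exists s; split => // t tt.
have [q qs tq] := s2 t tt; exists q => // x Ix.
apply: (le_trans (hL' (s1 _ qs) tt Ix)).
move: tq; rewrite ler_pdivlMr//; have := normr_ge0 (t - q); lra.
Qed.

Lemma Qop_cvg_curve (e : R) : 0 < e -> \forall n \near \oo,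
  forall t x, 0 <= t <= tau -> I01 x ->
    `|Qop (mun n) (h t) x - Qop mu (h t) x| <= e.
Proof.
move=> e0; pose D := [set p : R * R | 0 <= p.1 <= tau /\ I01 p.2].
pose F (p : R * R) s := relu p.2 s * h p.1 s.
have Fc p : D p -> {within I01, continuous (F p)}.
  by move=> [p1 _]; exact: Qop_cont_integrand (hc p1).
have := cmean_cvg_unif e0 Fc; move=> H; apply: filterS (H _) => [n Hn t x tt Ix|].
  exact: (Hn (t, x) (conj tt Ix)).
move=> d d0; have M1 : 0 < 2 * (M + 1) by have := M0; lra.
have d1 := divr_gt0 d0 M1.
have [s [s1 s2]] := interval_net tau0 d1; have [r [r1 r2]] := interval_net (@ler01 R) d1.
exists [seq (t, x) | t <- s, x <- r]; split.
  by move=> _ /allpairsP[[t x] /= [ts xr ->]]; split; [exact: s1|apply/I01E; exact: r1].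
move=> [t x] [/= tt Ix]; have [q qs tq] := s2 t tt; have [y yr xy] := r2 x ((I01E x).1 Ix).
exists (q, y); first by apply/allpairsP; exists (q, y).
move=> z Iz; rewrite /F /=.
have Iy : I01 y by apply/I01E; exact: r1.
have -> : relu x z * h t z - relu y z * h q z =
  (relu x z - relu y z) * h t z + relu y z * (h t z - h q z) by ring.
apply: (le_trans (ler_normD _ _)).
move: tq xy; rewrite !ler_pdivlMr// => tq xy.
have p1 : `|(relu x z - relu y z) * h t z| <= `|x - y| * M.
  rewrite normrM ler_pM//; last exact: hM.
  by apply: (le_trans (relu_lip _ _ _ _)); rewrite subrr normr0 addr0.
have p2 : `|relu y z * (h t z - h q z)| <= 1 * (M * `|t - q|).
  rewrite normrM ler_pM//; last exact: hL' (s1 _ qs) tt Iz.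
  by have := relu01 Iy Iz => ?; rewrite ger0_norm; lra.
have := normr_ge0 (t - q); have := normr_ge0 (x - y); lra.
Qed.

End uniform_weak_convergence.

(** * Convergence of the solution operators *)

Section convergence.
Context {R : realType} (b : boundary_condition) (mu : borel_probability R)
  (mun : nat -> borel_probability R).
Local Notation mR := (measurableTypeR R).
Local Notation I01 := (`[0, 1]%classic : set R).
Hypothesis mu_adm : admissible mu.
Hypothesis mun_adm : forall n, admissible (mun n).
Hypothesis mun_cvg : cvg_weakly mun mu.

Lemma Qop_shift (nu : borel_probability R) (h : R -> R) (c x : R) : {within I01, continuous h} ->
  Qop nu (fun s => h s - c) x = Qop nu h x - c * Qop nu (fun=> 1) x.
Proof.
move=> hc; have := Qop_lin nu (- c) x (cont_cst 1) hc.
rewrite (_ : (fun s => - c * (fun=> 1) s + h s) = (fun s => h s - c)); first by move=> ->; ring.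
by apply/funext => s /=; ring.
Qed.

(** The solution operators of two measures are close as soon as the integrals that
    enter them are. *)
Lemma Vop_close (nu : borel_probability R) (h : R -> R) (a x e M : R) :
  admissible nu -> {within I01, continuous h} -> I01 x ->
  (forall y, I01 y -> `|h y| <= M) -> `|mshift nu b h - mshift mu b h| <= e ->
  (forall y, I01 y -> `|Qop nu h y - Qop mu h y| <= e) ->
  `|Qop nu (fun=> 1) x - Qop mu (fun=> 1) x| <= e ->
  `|Vop nu b a h x - Vop mu b a h x| <= (3 + M) * e.
Proof.
move=> nu_adm hc Ix hM me Qe Q1; rewrite /Vop !Qop_shift//.
have e0 : 0 <= e by apply: le_trans Q1.
have m1 : `|mshift mu b h| <= M.
  have M0 : 0 <= M by apply: le_trans (hM x Ix).
  rewrite /mshift; case: b; rewrite ?normr0//.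
  by apply: (cmean_bound mu_adm hc); exact: (ae01 mu_adm).
have q1 : `|Qop nu (fun=> 1) x| <= 1.
  by apply: (Qop_bound nu_adm Ix (cont_cst 1)); apply: nearW => s; rewrite normr1.
have s1 : `|(slope nu b h - slope mu b h) * x| <= e.
  have sl : `|slope nu b h - slope mu b h| <= e.
    rewrite /slope; case: b; first by rewrite subrr normr0.
    by rewrite opprK addrC distrC; exact: Qe I01_1.
  move/I01E: Ix => Ix; rewrite normrM (ger0_norm (_ : 0 <= x)); last by linarith.
  by apply: le_trans sl; apply: ler_piMr => //; linarith.
have := Qe x Ix.
move: (slope nu b h) (slope mu b h) (mshift nu b h) (mshift mu b h) (Qop nu h x) (Qop mu h x)
 (Qop nu _ x) (Qop mu _ x) s1 me Q1 m1 q1 => s s' m m' Q Q' q q' s1 me Q1 m1 q1 QQ.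
have -> : a + s * x + (Q - m * q) - (a + s' * x + (Q' - m' * q')) =
  ((s - s') * x + (Q - Q')) - ((m - m') * q + m' * (q - q')) by ring.
have p1 : `|(m - m') * q| <= e * 1 by rewrite normrM ler_pM.
have p2 : `|m' * (q - q')| <= M * e by rewrite normrM ler_pM.
have := ler_normB ((s - s') * x + (Q - Q')) ((m - m') * q + m' * (q - q')).
have := ler_normD ((s - s') * x) (Q - Q').
have := ler_normD ((m - m') * q) (m' * (q - q')).
linarith.
Qed.

Lemma Vop_cvg_curve (tau M : R) (h : R -> R -> R) (e : R) : 0 <= tau ->
  (forall t, 0 <= t <= tau -> {within I01, continuous (h t)}) ->
  (forall t, 0 <= t <= tau -> forall x, I01 x -> `|h t x| <= M) ->
  (forall s t, 0 <= s -> s <= t -> t <= tau -> forall x, I01 x ->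
    `|h t x - h s x| <= M * (t - s)) -> 0 < e ->
  \forall n \near \oo, forall t, 0 <= t <= tau ->
    `|mshift (mun n) b (h t) - mshift mu b (h t)| <= e /\
    forall a x, I01 x -> `|Vop (mun n) b a (h t) x - Vop mu b a (h t) x| <= e.
Proof.
move=> tau0 hc hM hL e0.
have M0 : 0 <= M.
  have t0 : 0 <= (0 : R) <= tau by rewrite lexx tau0.
  exact: le_trans (normr_ge0 _) (hM 0 t0 0 I01_0).
pose e' := e / (3 + M); have e'0 : 0 < e' by rewrite divr_gt0//; linarith.
have e'E : (3 + M) * e' = e by rewrite /e'; field; rewrite gt_eqF//; linarith.
have e'e : e' <= e.
  have : 0 <= M * e' by apply: mulr_ge0 => //; exact: ltW.
  move: e'E e'0; clearbody e'; linarith.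
have H1 := cmean_cvg_curve mu_adm mun_adm mun_cvg tau0 hc hM hL e'0.
have H2 := Qop_cvg_curve mu_adm mun_adm mun_cvg tau0 hc hM hL e'0.
have H3 : \forall n \near \oo, forall x, I01 x ->
    `|Qop (mun n) (fun=> 1) x - Qop mu (fun=> 1) x| <= e'.
  have c1 (t : R) : 0 <= t <= tau -> {within I01, continuous (fun=> 1 : R)}.
    by move=> _; exact: (cont_cst 1).
  have M1 (t : R) : 0 <= t <= tau -> forall x, I01 x -> `|1 : R| <= 1 by rewrite normr1.
  have L1 (s t : R) : 0 <= s -> s <= t -> t <= tau -> forall x, I01 x -> `|1 - 1 : R| <= 1 * (t - s).
    by move=> _ st _ x _; rewrite subrr normr0 mul1r subr_ge0.
  have := Qop_cvg_curve mu_adm mun_adm mun_cvg tau0 c1 M1 L1 e'0.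
  by apply: filterS => n Hn x Ix; apply: (Hn 0 x) => //; rewrite lexx tau0.
near=> n => t tt.
have h1 : `|mshift (mun n) b (h t) - mshift mu b (h t)| <= e'.
  rewrite /mshift; case: b; last by rewrite subrr normr0 ltW.
  by move: t tt; near: n.
split; first exact: le_trans e'e.
move=> a x Ix; rewrite -e'E.
apply: (Vop_close a (mun_adm n) (hc t tt) Ix (hM t tt) h1).
  by move=> y Iy; move: t y tt Iy {h1 a x Ix}; near: n.
by move: x Ix {h1 a}; near: n.
Unshelve. all: by end_near.
Qed.

Lemma embeddingE (nu : borel_probability R) (u : L2 mu) : admissible nu -> Cspace mu b u ->
  {ae nu, forall x, embedding nu u x = gap_linear_rep mu u x}.
Proof.
move=> nu_adm Cu; apply/ae_eq_iff; rewrite /embedding.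
case: pselect => [h|[]]; first by case: cid.
exact: (cont_L2 nu_adm (gl_glin mu_adm Cu).1).
Qed.

End convergence.

(** * Orbits of smooth elements *)

Section smooth_orbit.
Context {R : realType} (b : boundary_condition) (nu : borel_probability R).
Local Notation I01 := (`[0, 1]%classic : set R).
Local Notation gl := (gap_linear_rep nu).
Hypothesis nu_adm : admissible nu.
Variable T : R -> L2 nu -> L2 nu.
Hypothesis T_sg : krein_feller_semigroup b T.

Lemma orbit_bound (u : L2 nu) (B t : R) : Cspace nu b u -> {ae nu, forall x, `|u x| <= B} ->
  0 <= B -> 0 <= t -> forall x, I01 x -> `|gl (T t u) x| <= B.
Proof.
move=> Cu uB B0 t0; apply: (gl_bound nu_adm (sg_Cspace nu_adm T_sg Cu t0)).
exact: (sg_sup_contr nu_adm T_sg Cu B0 t0 uB).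
Qed.

Lemma orbit_lipschitz (u w : L2 nu) (B s t : R) : krein_feller b u w -> Cspace nu b w ->
  {ae nu, forall x, `|w x| <= B} -> 0 <= B -> 0 <= s -> s <= t ->
  forall x, I01 x -> `|gl (T t u) x - gl (T s u) x| <= B * (t - s).
Proof.
move=> kf Cw wB B0 s0 st x Ix; have Cu := krein_feller_Cspace kf.
have t0 : 0 <= t by linarith.
have ts0 : 0 <= t - s by linarith.
have C1 := sg_Cspace nu_adm T_sg Cu t0; have C2 := sg_Cspace nu_adm T_sg Cu s0.
have H := sg_lipschitz nu_adm T_sg kf Cw wB B0 s0 ts0.
have sE : s + (t - s) = t by ring.
rewrite sE in H.
have := gl_comb_bound (a := -1) (c := 0) nu_adm C2 C2 C1 _ Ix => /(_ (B * (t - s))).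
have E (p r : R) : -1 * p + (0 * p + r) = r - p by ring.
by rewrite E; apply; apply: aeS H => y; rewrite E.
Qed.

Lemma orbit_taylor (u w y : L2 nu) (B t h : R) : krein_feller b u w -> krein_feller b w y ->
  Cspace nu b y -> {ae nu, forall x, `|y x| <= B} -> 0 <= B -> 0 <= t -> 0 <= h ->
  forall x, I01 x -> `|gl (T (t + h) u) x - gl (T t u) x - h * gl (T t w) x| <= B * h ^+ 2.
Proof.
move=> kfu kfw Cy yB B0 t0 h0 x Ix.
have Cu := krein_feller_Cspace kfu; have Cw := krein_feller_Cspace kfw.
have th0 : 0 <= t + h by linarith.
have C1 := sg_Cspace nu_adm T_sg Cu th0; have C2 := sg_Cspace nu_adm T_sg Cu t0.
have C3 := sg_Cspace nu_adm T_sg Cw t0.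
have H := sg_taylor nu_adm T_sg kfu kfw Cy yB B0 t0 h0.
have := gl_comb_bound (a := -1) (c := - h) nu_adm C2 C3 C1 _ Ix => /(_ (B * h ^+ 2)).
have E (p q r : R) : -1 * p + (- h * q + r) = r - p - h * q by ring.
by rewrite E; apply; apply: aeS H => z; rewrite E.
Qed.

Lemma orbit_Vop (u w : L2 nu) (t : R) : krein_feller b u w -> Cspace nu b w -> 0 <= t ->
  mshift nu b (gl (T t w)) = 0 /\
  forall x, I01 x -> gl (T t u) x = Vop nu b (gl (T t u) 0) (gl (T t w)) x.
Proof.
move=> kf Cw t0; have Cw' := sg_Cspace nu_adm T_sg Cw t0.
apply: (Vop_unique nu_adm (sg_flow T_sg kf t0) (gl_glin nu_adm Cw').1).
by apply/ae_eq_iff; exact: (gl_ae nu_adm Cw').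
Qed.

End smooth_orbit.

Lemma Vop_remainder (R : realType) (nu : borel_probability R) (b : boundary_condition)
    (h a2 a1 a0 x : R) (f2 f1 f0 : R -> R) :
  {within `[0, 1]%classic : set R, continuous f2} ->
  {within `[0, 1]%classic : set R, continuous f1} ->
  {within `[0, 1]%classic : set R, continuous f0} ->
  Vop nu b a2 f2 x - Vop nu b a1 f1 x - h * Vop nu b a0 f0 x =
  Vop nu b (a2 - a1 - h * a0) (fun s => f2 s - f1 s - h * f0 s) x.
Proof.
move=> c2 c1 c0; have c12 := cont_lin (-1) c1 c2.
have -> : a2 - a1 - h * a0 = - h * a0 + (-1 * a1 + a2) by ring.
have -> : (fun s => f2 s - f1 s - h * f0 s) = (fun s => - h * f0 s + (-1 * f1 s + f2 s)).
  by apply/funext => s; ring.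
rewrite (Vop_lin nu b (- h) a0 _ x c0 c12) (Vop_lin nu b (-1) a1 a2 x c1 c2).
by move: (Vop nu b a0 f0 x) (Vop nu b a1 f1 x) (Vop nu b a2 f2 x) => p q r; ring.
Qed.

(** * Comparison of two semigroups *)

Section comparison.
Context {R : realType} (b : boundary_condition) (mu nu : borel_probability R).
Local Notation I01 := (`[0, 1]%classic : set R).
Local Notation gl := (gap_linear_rep mu).
Hypothesis mu_adm : admissible mu.
Hypothesis nu_adm : admissible nu.
Variables (T : R -> L2 mu -> L2 mu) (S : R -> L2 nu -> L2 nu).
Hypothesis T_sg : krein_feller_semigroup b T.
Hypothesis S_sg : krein_feller_semigroup b S.
Variables (g0 g1 g2 g3 : L2 mu).
Hypothesis k01 : krein_feller b g0 g1.
Hypothesis k12 : krein_feller b g1 g2.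
Hypothesis k23 : krein_feller b g2 g3.
Hypothesis C3 : Cspace mu b g3.
Variable B : R.
Hypothesis B0 : 0 <= B.
Hypothesis gB0 : {ae mu, forall x, `|g0 x| <= B}.
Hypothesis gB1 : {ae mu, forall x, `|g1 x| <= B}.
Hypothesis gB2 : {ae mu, forall x, `|g2 x| <= B}.
Hypothesis gB3 : {ae mu, forall x, `|g3 x| <= B}.
Variables (tau e : R).
Hypothesis tau0 : 0 <= tau.
Local Notation z t := (gl (T t g1)).
Local Notation y t := (gl (T t g2)).
Hypothesis mz : forall t, 0 <= t <= tau -> `|mshift nu b (z t) - mshift mu b (z t)| <= e.
Hypothesis Vz : forall t, 0 <= t <= tau -> forall a x, I01 x ->
  `|Vop nu b a (z t) x - Vop mu b a (z t) x| <= e.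
Hypothesis Vy : forall t, 0 <= t <= tau -> forall a x, I01 x ->
  `|Vop nu b a (y t) x - Vop mu b a (y t) x| <= e.

(** Here [g0] is smooth of order 3 for [mu], with successive images [g1], [g2],
    [g3], and [e] bounds the difference between the solution operators of [nu] and
    [mu] along the orbits of [g1] and [g2]. The orbit under the semigroup of [nu]
    of a function [p] close to [g0] then stays close to the orbit of [g0] under the
    semigroup of [mu]. *)
Lemma orbit_comparison (p : L2 nu) (d : R) : Cspace nu b p ->
  {ae nu, forall x, `|p x - gl (T 0 g0) x| <= d} ->
  forall t, 0 <= t <= tau ->
    {ae nu, forall x, `|S t p x - gl (T t g0) x| <= d + 2 * e + 2 * e * t}.
Proof.
move=> Cp pd.
have C0 := krein_feller_Cspace k01; have C1 := krein_feller_Cspace k12.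
have C2 := krein_feller_Cspace k23.
(* v t solves, for nu, the problem that the orbit of g0 solves for mu; v' is its
   time derivative *)
pose v (t : R) := Vop nu b (gl (T t g0) 0) (z t).
pose v' (t : R) := Vop nu b (z t 0) (y t).
have zc (t : R) : 0 <= t -> {within I01, continuous (z t)}.
  by move=> t0; exact: (gl_glin mu_adm (sg_Cspace mu_adm T_sg C1 t0)).1.
have yc (t : R) : 0 <= t -> {within I01, continuous (y t)}.
  by move=> t0; exact: (gl_glin mu_adm (sg_Cspace mu_adm T_sg C2 t0)).1.
have vc (t : R) : 0 <= t -> {within I01, continuous (v t)}.
  by move=> t0; exact: Vop_cont (zc t t0).
have v'c (t : R) : 0 <= t -> {within I01, continuous (v' t)}.
  by move=> t0; exact: Vop_cont (yc t t0).
have vu t x : 0 <= t <= tau -> I01 x -> `|v t x - gl (T t g0) x| <= e.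
  move=> tt Ix; have [t0 _] := andP tt.
  have [_ /(_ x Ix)->] := orbit_Vop mu_adm T_sg k01 C1 t0.
  by apply: Vz.
have bz (t : R) : 0 <= t -> {ae nu, forall x, `|z t x| <= B}.
  by move=> t0; apply: (ae01 nu_adm); exact: (orbit_bound mu_adm T_sg C1 gB1 B0 t0).
have b_y (t : R) : 0 <= t -> {ae nu, forall x, `|y t x| <= B}.
  by move=> t0; apply: (ae01 nu_adm); exact: (orbit_bound mu_adm T_sg C2 gB2 B0 t0).
(* elements of the domain for nu that represent v, and their images *)
have [vL vLE] : exists vL : R -> L2 nu, forall t, 0 <= t -> {ae nu, forall x, vL t x = v t x}.
  suff /choice[vL H] : forall t : R, exists w : L2 nu, 0 <= t -> {ae nu, forall x, w x = v t x}.
    by exists vL.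
  move=> t; have [t0|nt] := pselect (0 <= t); last by exists p.
  by have [w /ae_eq_iff wE] := cont_L2 nu_adm (vc t t0); exists w.
pose m (t : R) := mshift nu b (z t).
have [wL wLE] : exists wL : R -> L2 nu, forall t, 0 <= t ->
    {ae nu, forall x, wL t x = z t x - m t}.
  suff /choice[wL H] : forall t : R, exists w : L2 nu, 0 <= t ->
    {ae nu, forall x, w x = z t x - m t} by exists wL.
  move=> t; have [t0|nt] := pselect (0 <= t); last by exists p.
  by have [w /ae_eq_iff wE] := cont_L2 nu_adm (cont_shift (c := m t) (zc t t0)); exists w.
have kfv (t : R) : 0 <= t <= tau -> krein_feller b (vL t) (wL t).
  move=> /andP[t0 _]; apply: (krein_feller_Vop nu_adm (zc t t0) (a := gl (T t g0) 0)).
  - by move=> bD; have := gl_bc mu_adm (sg_Cspace mu_adm T_sg C0 t0); rewrite /bc0 bD => -[].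
  - by apply/ae_eq_iff; exact: vLE.
  - by apply/ae_eq_iff; exact: wLE.
have defect (t : R) : 0 <= t <= tau -> {ae nu, forall x, `|wL t x - v' t (clamp x)| <= 2 * e}.
  move=> tt; have [t0 _] := andP tt.
  have [mz0 _] := orbit_Vop mu_adm T_sg k01 C1 t0.
  have [_ zV] := orbit_Vop mu_adm T_sg k12 C2 t0.
  apply: (aeS2 _ (wLE t t0) (ae01_I nu_adm)) => x -> Ix; rewrite clampE// {1}zV//.
  have := Vy tt (z t 0) Ix; have := mz tt; rewrite mz0 subr0 -/(m t) /v'.
  move: (m t) (Vop nu b _ _ x) (Vop mu b _ _ x) => k q r h1 h2.
  have -> : r - k - q = - (q - r) - k by ring.
  by apply: (le_trans (ler_normB _ _)); rewrite normrN; lra.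
have mv (t : R) : 0 <= t <= tau -> measurable_fun [set: measurableTypeR R] (v t \o clamp).
  by move=> /andP[t0 _]; exact: cont_meas (vc t t0).
have mv' (t : R) : 0 <= t <= tau -> measurable_fun [set: measurableTypeR R] (v' t \o clamp).
  by move=> /andP[t0 _]; exact: cont_meas (v'c t t0).
have bv (t : R) : 0 <= t <= tau -> {ae nu, forall x, `|(v t \o clamp) x| <= B + 3 * B}.
  move=> /andP[t0 _]; apply: nearW => x.
  apply: (Vop_bound b nu_adm (clamp01 x) (zc t t0) _ (bz t t0)).
  exact: (orbit_bound mu_adm T_sg C0 gB0 B0 t0 I01_0).
have bv' (t : R) : 0 <= t <= tau -> {ae nu, forall x, `|(v' t \o clamp) x| <= B + 3 * B}.
  move=> /andP[t0 _]; apply: nearW => x.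
  apply: (Vop_bound b nu_adm (clamp01 x) (yc t t0) _ (b_y t t0)).
  exact: (orbit_bound mu_adm T_sg C1 gB1 B0 t0 I01_0).
have cv := L2curve_bounded mv bv.
have cv' := L2curve_bounded mv' bv'.
have remainder (t h : R) : 0 <= t -> 0 < h -> t + h <= tau -> {ae nu, forall x,
    `|(v (t + h) \o clamp) x - (v t \o clamp) x - h * (v' t \o clamp) x| <= (B + 3 * B) * h ^+ 2}.
  move=> t0 h0 th; apply: nearW => x; rewrite /comp.
  have th0 : 0 <= t + h by lra.
  have h0' := ltW h0.
  have E := Vop_remainder nu b h (gl (T (t + h) g0) 0) (gl (T t g0) 0) (z t 0) (clamp x)
    (zc (t + h) th0) (zc t t0) (yc t t0).
  rewrite mulrDl -mulrA /v /v' E; apply: (Vop_bound b nu_adm (clamp01 x)).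
  - exact: cont_sub (cont_sub (zc (t + h) th0) (zc t t0)) (cont_mul (cont_cst h) (yc t t0)).
  - exact: (orbit_taylor mu_adm T_sg k01 k12 C2 gB2 B0 t0 h0' I01_0).
  - apply: (ae01 nu_adm) => s Is.
    exact: (orbit_taylor mu_adm T_sg k12 k23 C3 gB3 B0 t0 h0' Is).
have Dv := L2deriv_bounded mv mv' remainder.
have t00 : 0 <= (0 : R) <= tau by rewrite lexx tau0.
have vLE' (t : R) : 0 <= t <= tau -> {ae nu, forall x, vL t x = (v t \o clamp) x}.
  by move=> /andP[t0 _]; apply: (aeS2 _ (vLE t t0) (ae01_I nu_adm)) => x -> Ix; rewrite /= clampE.
have H := duhamel nu_adm S_sg tau0 vLE' kfv defect cv cv' Dv.
move=> t tt; have [t0 _] := andP tt.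
have [q /ae_eq_iff qE] := sqi_L2 (sqiD (sqiZ (-1) (L2_sqi (vL 0))) (L2_sqi p)).
have Cv := krein_feller_Cspace (kfv 0 t00).
have Cq := Cspace_comb nu_adm Cv Cp qE.
have qb : {ae nu, forall x, `|q x| <= d + e}.
  apply: (aeS2 _ (aeI qE pd) (aeI (vLE 0 (lexx 0)) (ae01_I nu_adm))) => x [-> h1] [-> Ix].
  have h2 := vu 0 x t00 Ix.
  have -> : -1 * v 0 x + p x = (p x - gl (T 0 g0) x) - (v 0 x - gl (T 0 g0) x) by ring.
  by apply: (le_trans (ler_normB _ _)); lra.
have de0 : 0 <= d + e.
  have hn : {ae nu, forall x, 0 <= d + e} by apply: aeS qb => x; apply: le_trans.
  by have := le_mean (intg_cst nu 0) (intg_cst nu (d + e)) hn; rewrite !mean_cst.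
have Sq := sg_sup_contr nu_adm S_sg Cq de0 t0 qb.
have pE : {ae nu, forall x, p x = 1 * vL 0 x + q x} by apply: aeS qE => x ->; ring.
apply: (aeS2 _ (aeI (sg_lin S_sg t0 pE) Sq) (aeI (H t tt) (ae01_I nu_adm))) => x [-> h1] [h2 Ix].
rewrite /= clampE// in h2; have h3 := vu t x tt Ix.
have -> : 1 * S t (vL 0) x + S t q x - gl (T t g0) x =
  (S t (vL 0) x - v t x) + (S t q x + (v t x - gl (T t g0) x)) by ring.
apply: (le_trans (ler_normD _ _)); have := ler_normD (S t q x) (v t x - gl (T t g0) x); lra.
Qed.

End comparison.

(* [T] and [Tn n] are the semigroups on L^2 generated by the Krein-Feller
   operators; on elements of the spaces (C[0,1])^b their values are those of
   the restricted semigroups. *)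
Theorem theorem1p2 (R : realType) (b : boundary_condition)
    (mu : borel_probability R) (mun : nat -> borel_probability R)
    (mu_adm : admissible mu) (mun_adm : forall n, admissible (mun n))
    (supp_sub : forall n, supp mu `<=` supp (mun n))
    (mun_cvg : cvg_weakly mun mu)
    (T : R -> L2 mu -> L2 mu) (Tn : forall n, R -> L2 (mun n) -> L2 (mun n))
    (T_sg : krein_feller_semigroup b T)
    (Tn_sg : forall n, krein_feller_semigroup b (Tn n)) :
  forall f : L2 mu, Cspace mu b f ->
  forall t0 : R, 0 <= t0 -> forall eps : R, 0 < eps ->
    \forall n \near \oo, forall t : R, 0 <= t <= t0 ->
      (Cnorm (mun n) b
         (embedding (mun n) (T t f) \- Tn n t (embedding (mun n) f))%R
       < eps%:E)%E.
Proof.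
move=> f Cf tau tau0 eps eps0.
have [e e0 eE] : exists2 e : R, 0 < e & eps = 8 * e by exists (eps / 8); linarith.
have [e' e'0 e'E] : exists2 e' : R, 0 < e' & 2 * e' + 2 * e' * tau = e.
  exists (e / (2 + 2 * tau)); first by rewrite divr_gt0//; linarith.
  by field; rewrite gt_eqF//; linarith.
have [g0 [[g1 [k01 [g2 [k12 [g3 [k23 C3]]]]]] fg]] := smooth_dense mu_adm 3 Cf e0.
rewrite /= in C3.
have C0 := krein_feller_Cspace k01; have C1 := krein_feller_Cspace k12.
have C2 := krein_feller_Cspace k23.
have bnd (g : L2 mu) : Cspace mu b g ->
    exists2 M : R, 0 <= M & {ae mu, forall x, `|g x| <= M}.
  move=> Cg; have [M M0 HM] := bnd01 (gl_glin mu_adm Cg).1; exists M => //.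
  by apply: (aeS2 _ (gl_ae mu_adm Cg) (ae01_I mu_adm)) => x -> Ix; exact: HM.
have [B0 B00 gB0] := bnd g0 C0; have [B1 B10 gB1] := bnd g1 C1.
have [B2 B20 gB2] := bnd g2 C2; have [B3 B30 gB3] := bnd g3 C3.
have [B [BB b0 b1 b2 b3]] : exists B : R, [/\ 0 <= B, B0 <= B, B1 <= B, B2 <= B & B3 <= B].
  by clear -B00 B10 B20 B30; exists (B0 + B1 + B2 + B3); split; linarith.
have weaken (g : L2 mu) (M : R) : M <= B -> {ae mu, forall x, `|g x| <= M} ->
    {ae mu, forall x, `|g x| <= B}.
  by move=> MB; apply: aeS => x /le_trans; exact.
have {}gB0 := weaken _ _ b0 gB0; have {}gB1 := weaken _ _ b1 gB1.
have {}gB2 := weaken _ _ b2 gB2; have {}gB3 := weaken _ _ b3 gB3.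
have glc (g : L2 mu) (t : R) : Cspace mu b g -> 0 <= t <= tau ->
    {within `[0, 1]%classic : set R, continuous (gap_linear_rep mu (T t g))}.
  by move=> Cg /andP[t0 _]; exact: (gl_glin mu_adm (sg_Cspace mu_adm T_sg Cg t0)).1.
have Hz := Vop_cvg_curve b mu_adm mun_adm mun_cvg (h := fun t => gap_linear_rep mu (T t g1)) (M := B) tau0
  (fun t => glc g1 t C1)
  (fun t tt => orbit_bound mu_adm T_sg C1 gB1 BB (proj1 (andP tt)))
  (fun s t s0 st _ => orbit_lipschitz mu_adm T_sg k12 C2 gB2 BB s0 st) e'0.
have Hy := Vop_cvg_curve b mu_adm mun_adm mun_cvg (h := fun t => gap_linear_rep mu (T t g2)) (M := B) tau0
  (fun t => glc g2 t C2)
  (fun t tt => orbit_bound mu_adm T_sg C2 gB2 BB (proj1 (andP tt)))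
  (fun s t s0 st _ => orbit_lipschitz mu_adm T_sg k23 C3 gB3 BB s0 st) e'0.
apply: filterS2 Hz Hy => n Hz Hy t tt; have [t0 tt0] := andP tt.
have nu_adm := mun_adm n.
set nu := mun n in Hz Hy nu_adm *.
have CTf := sg_Cspace mu_adm T_sg Cf t0.
have EE (u : L2 mu) : Cspace mu b u -> Cspace nu b (embedding nu u).
  move=> Cu; apply: (Cspace_rep (gl_glin mu_adm Cu).1 (gl_bc mu_adm Cu)).
  exact: (embeddingE mu_adm nu_adm Cu).
have e1 := embeddingE mu_adm nu_adm CTf; have e2 := embeddingE mu_adm nu_adm Cf.
(* the smooth approximation of f, transported by the semigroup of mu *)
have near0 s : 0 <= s -> forall x, (`[0, 1]%classic : set R) x ->
    `|gap_linear_rep mu (T s f) x - gap_linear_rep mu (T s g0) x| <= e.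
  move=> s0 x Ix.
  have [q /ae_eq_iff qE] := sqi_L2 (sqiD (sqiZ (-1) (L2_sqi g0)) (L2_sqi f)).
  have Cq := Cspace_comb mu_adm C0 Cf qE.
  have qb : {ae mu, forall x, `|q x| <= e}.
    by apply: (aeS2 _ qE fg) => z ->; rewrite mulN1r addrC.
  have Tq := sg_sup_contr mu_adm T_sg Cq (ltW e0) s0 qb.
  have TqE := sg_lin T_sg s0 qE.
  have := gl_comb_bound (a := -1) (c := 0) mu_adm (sg_Cspace mu_adm T_sg C0 s0)
    (sg_Cspace mu_adm T_sg C0 s0) (sg_Cspace mu_adm T_sg Cf s0) _ Ix => /(_ e).
  have E (p r : R) : -1 * p + (0 * p + r) = r - p by ring.
  rewrite E; apply; apply: (aeS2 _ Tq TqE) => z + TE.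
  by rewrite E TE mulN1r addrC.
have Ep : {ae nu, forall x, `|embedding nu f x - gap_linear_rep mu (T 0 g0) x| <= e}.
  apply: (aeS2 _ e2 (ae01_I nu_adm)) => x -> Ix.
  by have H := near0 0 (lexx 0) x Ix; rewrite (sg_0 T_sg f) in H; exact: H.
have main := orbit_comparison mu_adm nu_adm T_sg (Tn_sg n) k01 k12 k23 C3 BB gB0 gB1 gB2 gB3 tau0
  (fun t tt => (Hz t tt).1) (fun t tt => (Hz t tt).2) (fun t tt => (Hy t tt).2)
  (EE f Cf) Ep tt.
pose X := (embedding nu (T t f) \- Tn n t (embedding nu f))%R.
have CX : Cspace nu b X.
  apply: (Cspace_comb (a := -1) nu_adm (sg_Cspace nu_adm (Tn_sg n) (EE f Cf) t0) (EE _ CTf)).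
  by apply: nearW => x; rewrite /X /= mulN1r addrC.
have Xb : {ae nu, forall x, `|X x| <= 3 * e}.
  apply: (aeS2 _ main (aeI e1 (ae01_I nu_adm))) => x h1 [h2 Ix].
  rewrite /X /= h2; have h3 := near0 t t0 x Ix.
  have h4 : 2 * e' * t <= 2 * e' * tau by rewrite ler_pM2l// mulr_gt0.
  move: (Tn n t (embedding nu f) x) (gap_linear_rep mu (T t g0) x) (gap_linear_rep mu (T t f) x) h1 h3.
  move=> p q r h1 h3; have -> : r - p = (r - q) - (p - q) by ring.
  by apply: (le_trans (ler_normB _ _)); linarith.
rewrite -/X /Cnorm asboolT//.
apply: (@le_lt_trans _ _ (3 * e)%:E); last by rewrite lte_fin eE; linarith.
apply: ge_ereal_sup => _ [x sx <-]; rewrite lee_fin.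
exact: (gl_bound nu_adm CX Xb (supp_sub01 nu_adm sx)).
Qed.
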